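(* For every fixed integer $\ell\ge 1$, as $N\to\infty$, $$C_\ell(N)=2^\ell N^\ell+\gamma_\ell N^{\ell-1}+\delta_\ell N^{\ell-2}+O_\ell(N^{\ell-3}),$$ where $$\gamma_\ell=3\ell(\ell-1)2^{\ell-2}-\frac{\ell^2 2^{2\ell}}{2^\ell-1}$$ and $$\begin{aligned}\delta_\ell=2^\ell\bigg[&-\frac34\binom{\ell}{2}+\frac{15}{4}\binom{\ell}{4}+\frac{2^\ell\ell\bigl(\ell-6\binom{\ell}{3}\bigr)}{2^\ell-1}+\frac{2^\ell\ell^2\binom{\ell}{2}(5\cdot2^\ell-3)}{2(2^\ell-1)^2}+\frac{2^{2\ell}\ell^4}{(2^\ell-1)^3}\\&-\frac{3^{\ell+1}}{2(3^\ell-1)}\left(\binom{\ell}{2}-\frac{2^\ell\ell^2}{2^\ell-1}\right)^2-\frac{2^{2\ell}\ell^2}{4(2^{2\ell}-1)}\bigg].\end{aligned}$$ Equivalently, for every $\ell\geq 1$ there are constants $N_0(\ell)$ and $A_\ell$ such that $$\left|C_\ell(N)-2^\ell N^\ell-\gamma_\ell N^{\ell-1}-\delta_\ell N^{\ell-2}\right|\le A_\ell N^{\ell-3}\qquad\text{for every } N\ge N_0(\ell).$$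
   Context: For an integer $N\ge1$, let $L_N$ be the non-negative combinatorial Laplacian on $\mathbb Z^N$, $(L_Nu)(n)=2Nu(n)-\sum_{|m-n|=1}u(m)$, where $|\cdot|$ is the Euclidean norm. $C_c(\mathbb Z^N)$ denotes the finitely supported complex-valued functions on $\mathbb Z^N$, and $\langle\cdot,\cdot\rangle$ is the $\ell^2(\mathbb Z^N)$ inner product. For an integer $\ell\ge1$, $$C_\ell(N)=\inf_{\substack{u\in C_c(\mathbb Z^N),\ u(0)=0\\ u\ne0}}\frac{\langle u,L_N^\ell u\rangle}{\sum_{n\ne0}|u(n)|^2/|n|^{2\ell}}.$$ Here $L_N^\ell$ is the $\ell$th power of the Laplacian of the whole lattice $\mathbb Z^N$ (the condition $u(0)=0$ is imposed only on the test functions). Convention: $\binom{\ell}{j}=0$ for $j>\ell$. $O_\ell$ means the implied constant depends only on $\ell$. *)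

(* Defs.v *)
From HB Require Import structures.
From mathcomp Require Import all_boot all_order all_algebra.
From mathcomp Require Import complex.
From mathcomp Require Import all_classical all_reals.

Set Implicit Arguments.
Unset Strict Implicit.
Unset Printing Implicit Defensive.

Import Order.TTheory GRing.Theory Num.Theory.
Local Open Scope classical_set_scope.
Local Open Scope ring_scope.
Local Open Scope complex_scope.

Definition lattice (N : nat) := 'rV[int]_N.

Definition enorm (R : realType) (N : nat) (n : lattice N) : R :=
  Num.sqrt (\sum_(i < N) ((n 0 i)%:~R) ^+ 2).

(* The sums indexed with \in below are the finitely supported sums of
   mathcomp.classical.fsbigop, which are 0 on infinite supports. The set
   indexing the sum in [laplacian] is always finite, and the sums over the
   whole lattice are only used with finitely supported u. *)
Definition laplacian (R : realType) (N : nat) (u : lattice N -> R[i]) :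
    lattice N -> R[i] :=
  fun n => (2 * N)%:R * u n
           - \sum_(m \in [set m : lattice N | enorm R (m - n) = 1]) u m.

Definition finitely_supported (R : realType) (N : nat)
    (u : lattice N -> R[i]) : Prop :=
  finite_set [set n | u n != 0].

Definition inner (R : realType) (N : nat) (u v : lattice N -> R[i]) : R[i] :=
  \sum_(n \in [set: lattice N]) ((u n)^* * v n).

Definition hardy_weighted_norm (R : realType) (l N : nat)
    (u : lattice N -> R[i]) : R :=
  \sum_(n \in [set n : lattice N | n != 0])
     (ComplexField.Normc.normc (u n) ^+ 2 / enorm R n ^+ (2 * l)).

(* The real part only transports the numerator from R[i] to R: it is a real
   number because the Laplacian is symmetric. *)
Definition rayleigh (R : realType) (l N : nat) (u : lattice N -> R[i]) : R :=
  complex.Re (inner u (iter l (@laplacian R N) u)) / hardy_weighted_norm l u.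

(* For N >= 1 the set is nonempty and bounded below by 0, so that [inf] is its
   greatest lower bound. *)
Definition hardy_constant (R : realType) (l N : nat) : R :=
  inf [set rayleigh l u | u in
         [set u : lattice N -> R[i] |
           [/\ finitely_supported u, u 0 = 0 & u <> 0]]].

(* The powers with exponent l - 1, l - 2, l - 3 are powers with an integer
   (possibly negative) exponent. *)
Definition gamma_coef (R : realType) (l : nat) : R :=
  3 * l%:R * (l%:R - 1) * 2 ^ (l%:Z - 2)
  - l%:R ^+ 2 * 2 ^+ (2 * l) / (2 ^+ l - 1).

Definition delta_coef (R : realType) (l : nat) : R :=
  2 ^+ l *
  (- (3 / 4) * 'C(l, 2)%:R
   + 15 / 4 * 'C(l, 4)%:R
   + 2 ^+ l * l%:R * (l%:R - 6 * 'C(l, 3)%:R) / (2 ^+ l - 1)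
   + 2 ^+ l * l%:R ^+ 2 * 'C(l, 2)%:R * (5 * 2 ^+ l - 3)
       / (2 * (2 ^+ l - 1) ^+ 2)
   + 2 ^+ (2 * l) * l%:R ^+ 4 / (2 ^+ l - 1) ^+ 3
   - 3 ^+ l.+1 / (2 * (3 ^+ l - 1))
       * ('C(l, 2)%:R - 2 ^+ l * l%:R ^+ 2 / (2 ^+ l - 1)) ^+ 2
   - 2 ^+ (2 * l) * l%:R ^+ 2 / (4 * (2 ^+ (2 * l) - 1))).

(* Main.v *)
(* With A the adjacency operator and G = 1 - A / (2 N), the quadratic form is
   (2 N)^l <u, G^l u>. On functions supported in a fixed ball, A has norm
   O(N^(1/2)), so for large N the problem is a perturbation problem in powers
   of N^(-1/2) whose unperturbed operator is |n|^(2 l), with bottom eigenvalue 1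
   on the unit sphere; among functions on the sphere, the constant is selected
   at order 1/N. The upper bound evaluates the quotient at an explicit trial
   function psi living on the orbits of e_i, e_i + e_j, e_i + e_j + e_k and
   2 e_i. For the lower bound write u = alpha psi + v with v of mean zero on the
   sphere: the form of v exceeds mu <v, v>_W by a multiple of the weighted norm
   of v off the sphere, while the cross term only sees the residual
   (G^l - mu W) psi off the sphere, which is O(N^(-3/2)); completing the square
   costs O(N^(-3)). Far from the origin, where A is not small, positivity comes
   from the superharmonicity of the functions (|n|^2 + M)^(-k). *)
Require Import Defs.
From HB Require Import structures.
From mathcomp Require Import all_boot all_order all_algebra.
From mathcomp Require Import complex finmap.
From mathcomp Require Import all_classical all_reals.
From mathcomp Require Import ring lra zify.

Set Implicit Arguments.
Unset Strict Implicit.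
Unset Printing Implicit Defensive.

Import Order.TTheory GRing.Theory Num.Theory.
Local Open Scope classical_set_scope.
Local Open Scope ring_scope.
Local Open Scope complex_scope.

(** * Finitely supported functions *)

(** The operator A / (2 N) has norm 1 on the whole lattice and is small only on a ball whose radius
    is fixed before N grows. This forces the split into a near and a far region; in the far one any
    factor above the eigenvalue 1 would do, and 2^l is what the near region offers on level 2. The
    origin decides the order 1/N. Test functions vanish there, but walks still pass through it. To
    second order, a function f on the unit sphere gains C(l,2) |B f|^2, with B = A / (2 N), and
    loses l^2 2^l / (2^l - 1) times the part of |B f|^2 on level 2. For constant f the origin
    carries about a third of |B f|^2 = (3 / (2 N)) |f|^2, and level 2 nearly all the rest. For f of
    mean zero nothing reaches the origin and |B f|^2 <= |f|^2 / (2 N). As l^2 2^l / (2 (2^l - 1)) -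
    C(l,2) > l / 2, the constant wins by at least l / (2 N). The residual matters only off the
    sphere because the trial function is invariant under lattice isometries: G^l psi and W psi are
    constant on the sphere, hence orthogonal there to every v of mean zero. Parity of |n|^2 removes
    the odd powers of N^(-1/2) from the energy of psi. *)

Section FiniteSupport.
Variables (R : realType) (V : choiceType).

(** Bundling the support condition makes [Sum] and [ip] linear without side conditions, whereas a
    bare [\in] sum silently becomes 0 on an infinite support. *)
Record fsf := FSF {
  fsf_val :> V -> R;
  fsf_fin : finite_set [set n | fsf_val n != 0] }.

Lemma fsfP (f g : fsf) : (forall n, f n = g n) -> f = g.
Proof.
case: f g => f hf [g hg] /= /funext fg; subst g.
by rewrite (Prop_irrelevance hf hg).
Qed.

HB.instance Definition _ := gen_eqMixin fsf.
HB.instance Definition _ := gen_choiceMixin fsf.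

Lemma zero_fin : finite_set [set n : V | (0 : R) != 0].
Proof. by apply: (sub_finite_set _ (@finite_set0 V)) => n /=; rewrite eqxx. Qed.

Lemma add_fin (f g : fsf) : finite_set [set n | f n + g n != 0].
Proof.
have := conj (fsf_fin f) (fsf_fin g); rewrite -finite_setU.
apply: sub_finite_set => n /= fg.
have [f0|] := eqVneq (f n) 0; last by left.
by right; move: fg; rewrite f0 add0r.
Qed.

Lemma opp_fin (f : fsf) : finite_set [set n | - f n != 0].
Proof. by apply: sub_finite_set (fsf_fin f) => n /=; rewrite oppr_eq0. Qed.

Lemma mul_fin (a : V -> R) (f : fsf) : finite_set [set n | a n * f n != 0].
Proof.
by apply: sub_finite_set (fsf_fin f) => n /=; apply: contra_neq => ->; rewrite mulr0.
Qed.

Definition fzero := FSF zero_fin.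
Definition fadd f g := FSF (add_fin f g).
Definition fopp f := FSF (opp_fin f).
Definition fscale a f := FSF (mul_fin (fun=> a) f).
Definition fmul (a : V -> R) f := FSF (mul_fin a f).

Fact faddA : associative fadd.
Proof. by move=> f g h; apply: fsfP => n /=; rewrite addrA. Qed.
Fact faddC : commutative fadd.
Proof. by move=> f g; apply: fsfP => n /=; rewrite addrC. Qed.
Fact fadd0 : left_id fzero fadd.
Proof. by move=> f; apply: fsfP => n /=; rewrite add0r. Qed.
Fact faddN : left_inverse fzero fopp fadd.
Proof. by move=> f; apply: fsfP => n /=; rewrite addNr. Qed.

HB.instance Definition _ := GRing.isZmodule.Build fsf faddA faddC fadd0 faddN.

Fact fscaleA a b (f : fsf) : fscale a (fscale b f) = fscale (a * b) f.
Proof. by apply: fsfP => n /=; rewrite mulrA. Qed.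
Fact fscale1 : left_id 1 fscale.
Proof. by move=> f; apply: fsfP => n /=; rewrite mul1r. Qed.
Fact fscaleDr : right_distributive fscale +%R.
Proof. by move=> a f g; apply: fsfP => n /=; rewrite mulrDr. Qed.
Fact fscaleDl f : {morph fscale^~ f : a b / a + b}.
Proof. by move=> a b; apply: fsfP => n /=; rewrite mulrDl. Qed.

HB.instance Definition _ :=
  GRing.Zmodule_isLmodule.Build R fsf fscaleA fscale1 fscaleDr fscaleDl.

Lemma fsf0E n : (0 : fsf) n = 0. Proof. by []. Qed.
Lemma fsfDE (f g : fsf) n : (f + g) n = f n + g n. Proof. by []. Qed.
Lemma fsfNE (f : fsf) n : (- f) n = - f n. Proof. by []. Qed.
Lemma fsfBE (f g : fsf) n : (f - g) n = f n - g n. Proof. by []. Qed.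
Lemma fsfZE a (f : fsf) n : (a *: f) n = a * f n. Proof. by []. Qed.
Lemma fmulE a (f : fsf) n : fmul a f n = a n * f n. Proof. by []. Qed.
Lemma fsf_sumE (I : Type) (r : seq I) (F : I -> fsf) n :
  (\sum_(i <- r) F i) n = \sum_(i <- r) F i n.
Proof.
elim: r => [|i r IH]; first by rewrite !big_nil fsf0E.
by rewrite !big_cons fsfDE IH.
Qed.

Definition fsfE := (fsf0E, fsfDE, fsfNE, fsfZE, fmulE, fsf_sumE).

Definition Sum (f : V -> R) : R := \sum_(n \in [set: V]) f n.

Definition supp (f : fsf) : {fset V} := fset_set [set n | f n != 0].

Lemma notin_supp (f : fsf) n : n \notin supp f -> f n = 0.
Proof.
rewrite /supp in_fset_set; last exact: fsf_fin.
by move=> /negP/negP; rewrite notin_setE /= => /negP; rewrite negbK => /eqP.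
Qed.

Lemma SumE (A : {fset V}) (f : V -> R) :
  (forall n, n \notin A -> f n = 0) -> Sum f = \sum_(n <- A) f n.
Proof. exact: fsbigTE. Qed.

Lemma eq_Sum (f g : V -> R) : (forall n, f n = g n) -> Sum f = Sum g.
Proof. by move=> /funext ->. Qed.

Lemma SumD (f g : fsf) : Sum (f + g) = Sum f + Sum g.
Proof.
have h (k : fsf) n : n \notin (supp f `|` supp g `|` supp k)%fset -> k n = 0.
  by rewrite !inE !negb_or => /andP[_ /notin_supp].
pose A := (supp f `|` supp g)%fset.
have fA n : n \notin A -> f n = 0.
  by rewrite !inE negb_or => /andP[/notin_supp].
have gA n : n \notin A -> g n = 0.
  by rewrite !inE negb_or => /andP[_ /notin_supp].
rewrite !(@SumE A) ?big_split// => n nA; by rewrite fsfDE fA ?gA ?addr0.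
Qed.

Lemma SumZ a (f : fsf) : Sum (a *: f) = a * Sum f.
Proof.
rewrite !(@SumE (supp f)) ?mulr_sumr// => n /notin_supp nf; rewrite ?fsfZE nf //.
by rewrite mulr0.
Qed.

Lemma Sum0 : Sum (0 : fsf) = 0.
Proof. by rewrite (@SumE fset0) ?big_seq_fset0. Qed.

Lemma Sum_sum (I : Type) (r : seq I) (F : I -> fsf) :
  Sum (\sum_(i <- r) F i) = \sum_(i <- r) Sum (F i).
Proof.
elim: r => [|i r IH]; first by rewrite !big_nil Sum0.
by rewrite !big_cons SumD IH.
Qed.

Lemma Sum_ge0 (f : V -> R) : (forall n, 0 <= f n) -> 0 <= Sum f.
Proof. by move=> f0; apply: fsumr_ge0. Qed.

Lemma SumN (f : fsf) : Sum (- f) = - Sum f.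
Proof. by rewrite -scaleN1r SumZ mulN1r. Qed.

Lemma le_Sum (f g : fsf) : (forall n, f n <= g n) -> Sum f <= Sum g.
Proof.
move=> fg; rewrite -subr_ge0 -SumN -SumD; apply: Sum_ge0 => n.
by rewrite fsfDE fsfNE subr_ge0.
Qed.

Lemma Sum_eq0 (f : fsf) : (forall n, 0 <= f n) -> Sum f = 0 -> f = 0.
Proof.
move=> f0 S0; apply: fsfP => n; apply/eqP; rewrite fsf0E eq_le f0 andbT.
rewrite -[leRHS]S0 (@SumE (n |` supp f)%fset); last first.
  by move=> m; rewrite !inE negb_or => /andP[_ /notin_supp].
rewrite (big_fsetD1 n) ?fset1U1//= lerDl.
by apply: sumr_ge0 => m _; exact: f0.
Qed.

Lemma Sum_bij (h : V -> V) (f : V -> R) : bijective h ->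
  Sum (fun n => f (h n)) = Sum f.
Proof. by move=> hb; exact/esym/(reindex_fsbigT h f hb). Qed.

Lemma fin_bij (h : V -> V) (f : fsf) : bijective h ->
  finite_set [set n | f (h n) != 0].
Proof.
case=> k hk kh; have := finite_image k (fsf_fin f).
by apply: sub_finite_set => n /= fh; exists (h n).
Qed.

Definition fcomp (h : V -> V) (hb : bijective h) f := FSF (fin_bij f hb).

Implicit Types f g h : fsf.

Definition ip (f g : fsf) : R := Sum (fmul f g).

Lemma ipE f g : ip f g = Sum (fun n => f n * g n). Proof. by []. Qed.

Lemma ipC f g : ip f g = ip g f.
Proof. by apply: eq_Sum => n; rewrite !fmulE mulrC. Qed.

Lemma ipDr f g h : ip f (g + h) = ip f g + ip f h.
Proof. by rewrite /ip -SumD; apply: eq_Sum => n; rewrite !fsfE mulrDr. Qed.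

Lemma ipDl f g h : ip (f + g) h = ip f h + ip g h.
Proof. by rewrite ipC ipDr !(ipC h). Qed.

Lemma ipZr a f g : ip f (a *: g) = a * ip f g.
Proof. by rewrite /ip -SumZ; apply: eq_Sum => n; rewrite !fsfE mulrCA. Qed.

Lemma ipZl a f g : ip (a *: f) g = a * ip f g.
Proof. by rewrite ipC ipZr ipC. Qed.

Lemma ipNr f g : ip f (- g) = - ip f g.
Proof. by rewrite -scaleN1r ipZr mulN1r. Qed.

Lemma ipNl f g : ip (- f) g = - ip f g.
Proof. by rewrite ipC ipNr ipC. Qed.

Lemma ip0r f : ip f 0 = 0. Proof. by rewrite -(scale0r 0) ipZr mul0r. Qed.
Lemma ip0l f : ip 0 f = 0. Proof. by rewrite ipC ip0r. Qed.

Lemma ip_sumr f (I : Type) (r : seq I) (F : I -> fsf) :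
  ip f (\sum_(i <- r) F i) = \sum_(i <- r) ip f (F i).
Proof.
elim: r => [|i r IH]; first by rewrite !big_nil ip0r.
by rewrite !big_cons ipDr IH.
Qed.

Lemma ip_ge0 f : 0 <= ip f f.
Proof. by apply: Sum_ge0 => n; rewrite fmulE -expr2 sqr_ge0. Qed.

Lemma ip_eq0 f : ip f f = 0 -> f = 0.
Proof.
move=> /Sum_eq0 h; apply: fsfP => n.
have /(congr1 (fun k : fsf => k n)) : fmul f f = 0.
  by apply: h => m; rewrite fmulE -expr2 sqr_ge0.
by rewrite fmulE fsf0E => /eqP; rewrite mulf_eq0 orbb => /eqP.
Qed.

Lemma ip_fmul a f g : ip (fmul a f) g = ip f (fmul a g).
Proof. by apply: eq_Sum => n; rewrite !fmulE mulrCA mulrA. Qed.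

Lemma ip_disjoint f g : (forall n, f n * g n = 0) -> ip f g = 0.
Proof. by move=> fg; rewrite ipE (eq_Sum fg) (@SumE fset0) ?big_seq_fset0. Qed.

Definition nrm f : R := Num.sqrt (ip f f).

Lemma nrm_ge0 f : 0 <= nrm f. Proof. exact: sqrtr_ge0. Qed.
Lemma nrm_sqr f : nrm f ^+ 2 = ip f f. Proof. by rewrite sqr_sqrtr ?ip_ge0. Qed.

Lemma cauchy_schwarz_sqr f g : ip f g ^+ 2 <= ip f f * ip g g.
Proof.
have [/ip_eq0 ->|] := eqVneq (ip g g) 0.
  by rewrite !ip0r expr0n mulr0.
rewrite neq_lt ltNge ip_ge0 /= => g0.
have := ip_ge0 (ip g g *: f - ip f g *: g).
rewrite !(ipDr, ipDl, ipNr, ipNl, ipZr, ipZl) (ipC g f).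
set a := ip f f; set b := ip f g; set c := ip g g => H.
have : 0 <= c * (a * c - b ^+ 2).
  by move: H; congr (_ <= _); ring.
by rewrite pmulr_rge0// subr_ge0.
Qed.

Lemma cauchy_schwarz f g : `|ip f g| <= nrm f * nrm g.
Proof.
rewrite -sqrtrM ?ip_ge0// -sqrtr_sqr ler_sqrt ?cauchy_schwarz_sqr//.
by rewrite mulr_ge0 ?ip_ge0.
Qed.

Lemma nrmD f g : nrm (f + g) <= nrm f + nrm g.
Proof.
rewrite -(@ler_pXn2r _ 2) ?nnegrE ?addr_ge0 ?nrm_ge0//.
rewrite sqrrD !nrm_sqr !(ipDl, ipDr) (ipC g f).
have := le_trans (ler_norm _) (cauchy_schwarz f g).
rewrite mulr2n; lra.
Qed.

Lemma nrmZ a f : nrm (a *: f) = `|a| * nrm f.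
Proof.
rewrite /nrm ipZl ipZr mulrA -expr2 sqrtrM ?sqr_ge0// sqrtr_sqr //.
Qed.

Lemma nrm0 : nrm 0 = 0. Proof. by rewrite -(scale0r 0) nrmZ normr0 mul0r. Qed.

Lemma ler_nrm f g : (forall n, f n ^+ 2 <= g n ^+ 2) -> nrm f <= nrm g.
Proof.
move=> fg; rewrite ler_sqrt ?ip_ge0//; apply: le_Sum => n.
by rewrite !fmulE -!expr2.
Qed.

Lemma nrm_le (f : fsf) (c : R) : 0 <= c -> ip f f <= c ^+ 2 -> nrm f <= c.
Proof.
by move=> c0 h; rewrite -(ger0_norm c0) -sqrtr_sqr ler_sqrt ?sqr_ge0.
Qed.

End FiniteSupport.

(** * The lattice and its nearest neighbours *)

Section Lattice.
Variable N : nat.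
Implicit Types (n m : lattice N) (p : 'I_N * bool).

(** Kept in [nat] rather than as a real norm, so that levels are indexed by natural numbers and
    their arithmetic and parity are decidable. *)
Definition sq n : nat := (\sum_(i < N) `|n 0%R i| ^ 2)%N.

Definition sgn p : int := if p.2 then -1 else 1.

Definition unitv p : lattice N := sgn p *: delta_mx 0 p.1.

Lemma unitvE p i : unitv p 0 i = sgn p * (i == p.1)%:R.
Proof. by rewrite /unitv mxE mxE eqxx. Qed.

Lemma sqZ n : (sq n)%:Z = \sum_(i < N) n 0 i ^+ 2.
Proof.
rewrite /sq -natz natr_sum; apply: eq_bigr => i _.
by rewrite natz -mulnn PoszM abszE -expr2 real_normK ?num_real.
Qed.

Lemma sq0 : sq 0 = 0%N.
Proof. by apply: big1 => i _; rewrite mxE. Qed.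

Lemma sq_eq0 n : (sq n == 0%N) = (n == 0).
Proof.
apply/eqP/eqP => [|->]; last exact: sq0.
move=> /eqP; rewrite sum_nat_eq0 => /forallP h; apply/matrixP => i j.
have := h j; rewrite implyTb expn_eq0 andbT absz_eq0 (ord1 i) mxE => /eqP //.
Qed.

Lemma coord_le_sq n i : (`|n 0%R i| ^ 2 <= sq n)%N.
Proof. by rewrite /sq (bigD1 i)//= leq_addr. Qed.

Lemma sq_unitvD n p : (sq (n + unitv p))%:Z = (sq n)%:Z + 1 + 2 * (sgn p * n 0 p.1).
Proof.
rewrite !sqZ (bigD1 p.1)//= [in RHS](bigD1 p.1)//= !mxE !eqxx /=.
rewrite (eq_bigr (fun i => n 0 i ^+ 2)); last first.
  by move=> i /negPf ip; rewrite !mxE ip andbF mulr0 addr0.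
have -> : sgn p * 1 = sgn p by rewrite mulr1.
have : sgn p ^+ 2 = 1 by rewrite /sgn; case: ifP.
by move=> h; rewrite sqrrD h; ring.
Qed.

Lemma sq_unitv p : sq (unitv p) = 1%N.
Proof. by have := sq_unitvD 0 p; rewrite add0r sq0 mxE; lia. Qed.

Definition flip p := (p.1, ~~ p.2).

Lemma flipK : involutive flip.
Proof. by case=> i b; rewrite /flip negbK. Qed.

Lemma unitv_flip p : unitv (flip p) = - unitv p.
Proof. by case: p => i b; rewrite /unitv /sgn /=; case: b; rewrite ?scaleN1r ?scale1r ?opprK. Qed.

Lemma shift_bij m : bijective (fun n => n + m).
Proof. by exists (fun n => n - m) => n; rewrite ?addrK ?subrK. Qed.

Lemma unitv_inj : injective unitv.
Proof.
move=> p q /rowP h; have := h p.1; rewrite !unitvE eqxx.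
move: h => _; case: p q => [i b] [j c] /=; rewrite /sgn /=.
by have [->|_] := eqVneq i j; case: b; case: c.
Qed.

Lemma sq_eq1 n : sq n = 1%N -> exists p, n = unitv p.
Proof.
move=> h; have [i ni] : exists i, n 0 i != 0.
  apply/existsP; rewrite -negb_forall; apply/negP => /forallP n0.
  by move: h; rewrite /sq big1// => i _; rewrite (eqP (n0 i)).
have a1 : (0 < `|n 0%R i| ^ 2)%N by rewrite expn_gt0 absz_gt0 ni.
have := h; rewrite /sq (bigD1 i)//=; set r := (\sum_(j < N | _) _)%N.
move=> h1; have /eqP : r = 0%N.
  by move: a1 h1; case: (_ ^ 2)%N => [//|k _]; rewrite addSn => -[] /eqP; rewrite addn_eq0 => /andP[_ /eqP].
rewrite sum_nat_eq0 => /forallP rest.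
have ai : `|(n 0 i)%R|%N = 1%N.
  move: a1; have : (`|n 0%R i| ^ 2 <= 1)%N by rewrite -[leqRHS]h; exact: coord_le_sq.
  by rewrite -mulnn; case: (absz _) => [|[|j]]//; rewrite !mulSn; lia.
exists (i, n 0 i < 0); apply/rowP => j; rewrite unitvE /sgn /=.
have [->|ji] := eqVneq j i.
  by case: ifP => s; lia.
by have := rest j; rewrite ji /= expn_eq0 andbT absz_eq0 mulr0 => /eqP.
Qed.

Lemma fin_sq K : finite_set [set n | (sq n <= K)%N].
Proof.
(* The ball lies in the cube with coordinates in [-K, K]; a shift by K identifies this cube with row
   vectors of ordinals, a finite type. *)
pose c (M : 'rV['I_(K.*2.+1)]_N) : lattice N :=
  \row_i ((M 0 i)%:Z - K%:Z).
have := finite_image c (@finite_finset _ [set: 'rV['I_(K.*2.+1)]_N]).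
apply: sub_finite_set => n /= nK.
have b i : (`|(n 0 i)%R|%N <= K)%N.
  apply: leq_trans nK; apply: leq_trans (coord_le_sq n i).
  by rewrite -mulnn; case: (absz _) => // k; rewrite leq_pmulr.
have lt i : (`|(n 0 i + K%:Z)%R|%N < K.*2.+1)%N by have := b i; lia.
exists (\row_i (Ordinal (lt i))) => //.
by apply/rowP => i; rewrite !mxE /=; have := b i; lia.
Qed.

End Lattice.

Lemma sum_dir (M : nmodType) N (F : 'I_N * bool -> M) :
  \sum_p F p = \sum_(i < N) (F (i, false) + F (i, true)).
Proof.
transitivity (\sum_(i < N) \sum_(b : bool) F (i, b)).
  by rewrite pair_bigA; apply: eq_bigr => -[].
by apply: eq_bigr => i _; rewrite big_bool addrC.
Qed.

Section NeighbourSum.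
Variables (R : realType) (N : nat).
Implicit Types (n m : lattice N) (f g : fsf R (lattice N)) (a : lattice N -> R).

Definition nsum a n : R := \sum_p a (n + unitv p).

Definition hop f : fsf R (lattice N) := \sum_p fcomp (shift_bij (unitv p)) f.

Lemma hopE f n : hop f n = nsum f n.
Proof. by rewrite /hop fsfE. Qed.

Lemma hopD f g : hop (f + g) = hop f + hop g.
Proof.
apply: fsfP => n; rewrite fsfDE !hopE /nsum -big_split; exact: eq_bigr.
Qed.

Lemma hopZ c f : hop (c *: f) = c *: hop f.
Proof.
apply: fsfP => n; rewrite fsfZE !hopE /nsum mulr_sumr; exact: eq_bigr.
Qed.

Lemma Sum_hop a f : Sum (fmul a (hop f)) = Sum (fmul (nsum a) f).
Proof.
have -> : fmul a (hop f) = \sum_p fmul a (fcomp (shift_bij (unitv p)) f).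
  by apply: fsfP => n; rewrite !fsfE mulr_sumr; exact: eq_bigr.
have -> : fmul (nsum a) f = \sum_p fmul (fun n => a (n + unitv p)) f.
  by apply: fsfP => n; rewrite !fsfE /nsum mulr_suml; apply: eq_bigr.
rewrite !Sum_sum [RHS](reindex_inj (inv_inj (@flipK N))) /=.
apply: eq_bigr => p _; rewrite -(Sum_bij _ (shift_bij (unitv (flip p)))).
by apply: eq_Sum => n /=; rewrite unitv_flip subrK.
Qed.

Lemma ip_hop f g : ip f (hop g) = ip (hop f) g.
Proof.
rewrite /ip Sum_hop; apply: eq_Sum => n; by rewrite !fmulE hopE.
Qed.

(* When [sq n <= 3] all coordinates of [n] are in [-1, 1], so the neighbours of
   [n] lie on three levels only. *)
Lemma nsum_sq (g : nat -> R) n : (sq n <= 3)%N ->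
  nsum (fun m => g (sq m)) n =
  (sq n)%:R * g (sq n).-1 + 2 * (N%:R - (sq n)%:R) * g (sq n).+1
  + (sq n)%:R * g (sq n).+3.
Proof.
move=> n3; rewrite /nsum sum_dir.
set k := sq n.
have c i : (`|n 0%R i| <= 1)%N.
  have := leq_trans (coord_le_sq n i) n3; rewrite -mulnn.
  by case: (absz _) => [|[|j]]//; rewrite !mulSn; lia.
transitivity (\sum_(i < N) (2 * g k.+1
     + (`|n 0%R i| ^ 2)%N%:R * (g k.+3 + g k.-1 - 2 * g k.+1))).
  apply: eq_bigr => i _.
  set u := sq (n + unitv (i, false)); set v := sq (n + unitv (i, true)).
  have hu : u%:Z = k%:Z + 1 + 2 * n 0 i.
    by rewrite /u sq_unitvD /sgn /= mul1r.
  have hv : v%:Z = k%:Z + 1 - 2 * n 0 i.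
    by rewrite /v sq_unitvD /sgn /= mulN1r mulrN.
  have [n0|[n1|n1]] : n 0 i = 0 \/ n 0 i = 1 \/ n 0 i = -1 by have := c i; lia.
  - have [-> ->] : u = k.+1 /\ v = k.+1 by lia.
    by rewrite n0 /=; ring.
  - have [-> ->] : u = k.+3 /\ v = k.-1 by lia.
    by rewrite n1 /=; ring.
  - have [-> ->] : u = k.-1 /\ v = k.+3 by lia.
    by rewrite n1 /=; ring.
rewrite big_split /= sumr_const card_ord.
have -> (D : R) : \sum_(i < N) (`|n 0%R i| ^ 2)%N%:R * D = k%:R * D.
  by rewrite -mulr_suml -natr_sum.
by rewrite -[_ *+ N]mulr_natl; ring.
Qed.

(** Each coordinate of absolute value 2 uses up 4 units of [sq n], and only one of its two
    directions is counted. So for [sq n] below 8 at most one step lowers [sq] by 3, which makes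
    [tips] and [rest5] indicator functions. *)
Lemma count_two_le n :
  (4 * \sum_(p : 'I_N * bool) (sgn p * n 0 p.1 == -2)%R <= sq n)%N.
Proof.
rewrite sum_dir big_distrr /= /sq; apply: leq_sum => i _; rewrite /sgn /= mul1r mulN1r.
case: eqP => [->//|_]; case: eqP => [h|//].
by have -> : n 0 i = 2 by lia.
Qed.

End NeighbourSum.

(** * The normalized adjacency operator near the origin *)

Definition eps (R : realType) (N : nat) : R := (Num.sqrt N%:R)^-1.

Lemma eps_gt0 (R : realType) N : (0 < N)%N -> 0 < eps R N.
Proof. by move=> N0; rewrite invr_gt0 sqrtr_gt0 ltr0n. Qed.

Lemma eps_sqr (R : realType) N : eps R N ^+ 2 = N%:R^-1.
Proof. by rewrite /eps exprVn sqr_sqrtr ?ler0n. Qed.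

Lemma eps_le1 (R : realType) N : (0 < N)%N -> eps R N <= 1.
Proof.
move=> N0; rewrite invf_le1 ?sqrtr_gt0 ?ltr0n//.
by rewrite -[leLHS]sqrtr1 ler_sqrt ?ler1n ?ler0n.
Qed.

Lemma weighted_cauchy_schwarz (R : realFieldType) (I : finType) (P : pred I)
    (w a : I -> R) : (forall i, 0 < w i) ->
  (\sum_(i | P i) a i) ^+ 2 <=
  (\sum_(i | P i) w i) * \sum_(i | P i) (w i)^-1 * a i ^+ 2.
Proof.
move=> w0; set s := \sum_(i | P i) a i; set W := \sum_(i | P i) w i.
set T := \sum_(i | P i) _.
have W0 : 0 <= W by apply: sumr_ge0 => i _; exact: ltW.
have : 0 <= \sum_(i | P i) (w i)^-1 * (W * a i - s * w i) ^+ 2.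
  by apply: sumr_ge0 => i _; rewrite mulr_ge0 ?sqr_ge0// invr_ge0 ltW.
have -> : \sum_(i | P i) (w i)^-1 * (W * a i - s * w i) ^+ 2 = W * (W * T - s ^+ 2).
  transitivity (\sum_(i | P i)
      (W ^+ 2 * ((w i)^-1 * a i ^+ 2) - 2 * W * s * a i + s ^+ 2 * w i)).
    by apply: eq_bigr => i _; field; rewrite gt_eqF.
  by rewrite !big_split /= sumrN -!mulr_sumr -/s -/W -/T; ring.
(* The weights are positive, so a zero total weight means that no index is selected and the
   left-hand sum is empty. *)
move: W0; rewrite le_eqVlt => /predU1P[W0|W0]; last first.
  by rewrite pmulr_rge0// subr_ge0.
move=> _; have -> : s = 0.
  apply: big1 => i Pi; move/esym/eqP: W0; rewrite psumr_eq0 => [/allP h|j _]; last exact: ltW.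
  by have := h i (mem_index_enum i); rewrite Pi gt_eqF.
by rewrite -W0 mul0r expr0n.
Qed.

Section Near.
Variables (R : realType) (N : nat).
Implicit Types (n m : lattice N) (f g : fsf R (lattice N)).

Definition near K f := forall n, f n != 0 -> (sq n <= K)%N.

Lemma near_le K K' f : (K <= K')%N -> near K f -> near K' f.
Proof. by move=> KK nf n /nf /leq_trans; exact. Qed.

Lemma nearD K f g : near K f -> near K g -> near K (f + g).
Proof.
move=> nf ng n; rewrite fsfDE; have [f0|/nf//] := eqVneq (f n) 0.
by rewrite f0 add0r => /ng.
Qed.

Lemma nearZ K c f : near K f -> near K (c *: f).
Proof.
by move=> nf n; rewrite fsfZE mulf_eq0 negb_or => /andP[_ /nf].
Qed.

Lemma near_fmul K a f : near K f -> near K (fmul a f).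
Proof.
by move=> nf n; rewrite fmulE mulf_eq0 negb_or => /andP[_ /nf].
Qed.

(** Squaring |n| <= |n + e| + 1 gives this. The crude factor 2 is harmless: only a support radius
    independent of N is wanted. *)
Lemma sq_le_unitvD n p : (sq n <= 2 * sq (n + unitv p)%R + 2)%N.
Proof.
have := sq_unitvD (n + unitv p) (flip p); rewrite unitv_flip addrK.
set a := sq n; set b := sq _; set x := (n + _) 0 _; set s := sgn _ => h.
have : (`|x| ^ 2 <= b)%N by exact: coord_le_sq.
have : 0 <= (s * x + 1) ^+ 2 /\ 0 <= (s * x - 1) ^+ 2 by rewrite !sqr_ge0.
have : (s * x) ^+ 2 = (`|x| ^ 2)%N%:Z.
  rewrite exprMn -mulnn PoszM abszE -expr2 real_normK ?num_real//.
  by rewrite /s /sgn; case: ifP; rewrite ?sqrrN expr1n mul1r.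
set y := (`|x| ^ 2)%N; set z := s * x in h *; rewrite sqrrD sqrrB; lia.
Qed.

Lemma near_hop K f : near K f -> near (2 * K + 2) (hop f).
Proof.
move=> nf n; rewrite hopE /nsum; apply: contraNT; rewrite -ltnNge => Kn.
rewrite big1// => p _; apply/eqP; apply: contraTT Kn => /nf fK; rewrite -leqNgt.
by apply: leq_trans (sq_le_unitvD n p) _; rewrite leq_add2r leq_mul2l.
Qed.

Definition l1 n : nat := (\sum_(i < N) `|n 0%R i|)%N.

Lemma l1_unitvD n p :
  (l1 (n + unitv p)%R + `|n 0%R p.1| = l1 n + `|(n 0%R p.1 + sgn p)%R|)%N.
Proof.
rewrite /l1 (bigD1 p.1)//= [in RHS](bigD1 p.1)//= !mxE !eqxx /= mulr1.
rewrite (eq_bigr (fun i => `|n 0%R i|)%N); first by lia.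
by move=> i /negPf ip; rewrite !mxE ip andbF mulr0 addr0.
Qed.

(* Test function for the Schur test: each of the 2 N steps up costs a factor
   eps, a step down gains 1 / eps but there are boundedly many of them. *)
Definition schur n : R := eps R N ^+ l1 n.

(** A zero coordinate gives two upward steps, hence at most 2 N eps = 2 sqrt N in all. A nonzero
    coordinate gives one step each way, and there are at most [sq n] of them, each downward step
    costing 1 / eps = sqrt N. *)
Lemma nsum_schur n : (0 < N)%N ->
  nsum schur n <= (sq n + 2)%:R * Num.sqrt N%:R * schur n.
Proof.
move=> N0; rewrite /nsum sum_dir.
have e0 := eps_gt0 R N0; have e1 := eps_le1 R N0.
have s0 : 0 <= schur n by rewrite exprn_ge0// ltW.
have ev : (eps R N)^-1 = Num.sqrt N%:R by rewrite /eps invrK.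
apply: (@le_trans _ _ (\sum_(i < N) (2 * eps R N
     + (`|n 0%R i| ^ 2)%N%:R * (eps R N)^-1) * schur n)).
  apply: ler_sum => i _; rewrite /schur.
  have := l1_unitvD n (i, false); have := l1_unitvD n (i, true).
  rewrite /sgn /=.
  set u := l1 (n + unitv (i, true)); set v := l1 (n + unitv (i, false)).
  set k := l1 n; set x := n 0 i => hu hv.
  have [x0|x0] := eqVneq x 0.
    have -> : u = k.+1 by lia.
    have -> : v = k.+1 by lia.
    by rewrite x0 /= mul0r addr0 exprS; lra.
  (* The square of a nonzero coordinate is at least 1, so summing the squares overcounts the nonzero
     coordinates and yields [sq n]. *)
  have x1 : 1 <= (`|x| ^ 2)%N%:R :> R by rewrite ler1n expn_gt0 absz_gt0 x0.
  have k0 : (0 < k)%N.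
    by rewrite /k /l1 (bigD1 i)//= addn_gt0 absz_gt0 -/x x0.
  have kE : eps R N ^+ k.-1 = (eps R N)^-1 * eps R N ^+ k.
    by rewrite -[in RHS](prednK k0) exprS mulrA mulVf ?mul1r// gt_eqF.
  have le : eps R N ^+ k.+1 + eps R N ^+ k.-1 <=
      (2 * eps R N + (`|x| ^ 2)%N%:R * (eps R N)^-1) * eps R N ^+ k.
    rewrite kE exprS -mulrDl ler_wpM2r ?exprn_ge0 ?(ltW e0)// lerD//.
      by rewrite ler_peMl ?(ltW e0)// ler1n.
    by rewrite ler_peMl// invr_ge0 ltW.
  have [xp|xn] : 0 < x \/ x < 0 by lia.
    have -> : u = k.-1 by lia.
    by have -> : v = k.+1 by lia.
  have -> : u = k.+1 by lia.
  have -> : v = k.-1 by lia.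
  by rewrite addrC.
rewrite -mulr_suml; apply: ler_wpM2r => //; rewrite big_split /= sumr_const card_ord.
have -> (D : R) : \sum_(i < N) (`|n 0%R i| ^ 2)%N%:R * D = (sq n)%:R * D.
  by rewrite -mulr_suml -natr_sum.
have Ne : N%:R * eps R N = Num.sqrt N%:R.
  rewrite -[X in X * _](@sqr_sqrtr _ N%:R) ?ler0n// /eps expr2 mulfK//.
  by rewrite gt_eqF// sqrtr_gt0 ltr0n.
by rewrite ev (natrD _ (sq n) 2) [in leRHS]mulrDl addrC lerD2l -[leLHS]mulr_natl mulrCA Ne.
Qed.

(** Schur test with the weight [schur], used once at points of the support of [hop f] and once,
    after moving the neighbour sum across by symmetry, at points of the support of f. The first is
    the worse: there [sq n <= 2 * K + 2], whence the constant [2 * K + 4]. *)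
Lemma nrm_hop K f : (0 < N)%N -> near K f ->
  nrm (hop f) <= (2 * K + 4)%:R * Num.sqrt N%:R * nrm f.
Proof.
move=> N0 nf; set c : R := _%:R * _.
have c0 : 0 <= c by rewrite mulr_ge0 ?ler0n ?sqrtr_ge0.
have s0 n : 0 < schur n by rewrite exprn_gt0// eps_gt0.
apply: nrm_le; first by rewrite mulr_ge0 ?nrm_ge0.
rewrite exprMn nrm_sqr.
have step n : hop f n ^+ 2 <=
    c * schur n * hop (fmul (fun m => (schur m)^-1 * f m) f) n.
  set rhs := hop (fmul _ _) n.
  have rhs0 : 0 <= rhs.
    rewrite /rhs hopE; apply: sumr_ge0 => p _ /=.
    by rewrite -mulrA -expr2 mulr_ge0 ?sqr_ge0// invr_ge0 ltW.
  have [->|/(near_hop nf) Kn] := eqVneq (hop f n) 0.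
    by rewrite expr0n /= mulr_ge0// mulr_ge0// ltW.
  rewrite hopE.
  apply: (le_trans (weighted_cauchy_schwarz xpredT (fun p => f (n + unitv p))
    (fun p => s0 (n + unitv p)))).
  rewrite -/(nsum schur n).
  have -> : \sum_i (schur (n + unitv i))^-1 * f (n + unitv i) ^+ 2 = rhs.
    by rewrite /rhs hopE; apply: eq_bigr => p _ /=; rewrite expr2 mulrA.
  apply: ler_wpM2r => //; apply: le_trans (nsum_schur n N0) _.
  rewrite ler_wpM2r ?(ltW (s0 n))// ler_wpM2r ?sqrtr_ge0// ler_nat; lia.
pose F := fmul (fun m => (schur m)^-1 * f m) f.
apply: (@le_trans _ _ (Sum (c *: fmul schur (hop F)))).
  by apply: le_Sum => n; rewrite fmulE fsfZE fmulE -expr2 mulrA step.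
rewrite SumZ Sum_hop expr2 -mulrA ler_wpM2l// -SumZ; apply: le_Sum => n.
rewrite fsfZE !fmulE; have [->|fn] := eqVneq (f n) 0; first by rewrite !mulr0.
apply: (@le_trans _ _ (c * schur n * ((schur n)^-1 * f n * f n))).
  apply: ler_wpM2r; first by rewrite -mulrA -expr2 mulr_ge0 ?sqr_ge0// invr_ge0 ltW.
  apply: le_trans (nsum_schur n N0) _.
  rewrite ler_wpM2r ?(ltW (s0 n))// ler_wpM2r ?sqrtr_ge0// ler_nat.
  by have := nf n fn; lia.
by rewrite !mulrA mulfK ?gt_eqF// -!mulrA.
Qed.

Definition B f := (2 * N%:R)^-1 *: hop f.
Definition G f := f - B f.

Lemma BD f g : B (f + g) = B f + B g.
Proof. by rewrite /B hopD scalerDr. Qed.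

Lemma BZ c f : B (c *: f) = c *: B f.
Proof. by rewrite /B hopZ !scalerA [_^-1 * c]mulrC. Qed.

Lemma B0 : B 0 = 0.
Proof. by have := BZ 0 0; rewrite !scale0r. Qed.

Lemma B_sum (I : Type) (r : seq I) (F : I -> fsf R (lattice N)) :
  B (\sum_(i <- r) F i) = \sum_(i <- r) B (F i).
Proof.
elim: r => [|i r IH]; first by rewrite !big_nil B0.
by rewrite !big_cons BD IH.
Qed.

Lemma ip_B f g : ip f (B g) = ip (B f) g.
Proof. by rewrite /B ipZr ipZl ip_hop. Qed.

Lemma ip_iterB j f g : ip f (iter j B g) = ip (iter j B f) g.
Proof. by elim: j f g => // j IH f g; rewrite iterSr IH /= ip_B. Qed.

Lemma ip_G f g : ip f (G g) = ip (G f) g.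
Proof. by rewrite /G ipDr ipDl ipNr ipNl ip_B. Qed.

Lemma ip_iterG j f g : ip f (iter j G g) = ip (iter j G f) g.
Proof. by elim: j f g => // j IH f g; rewrite iterSr IH /= ip_G. Qed.

Lemma GD f g : G (f + g) = G f + G g.
Proof. by rewrite /G BD opprD addrACA. Qed.

Lemma GZ c f : G (c *: f) = c *: G f.
Proof. by rewrite /G BZ scalerBr. Qed.

Lemma iterBD j f g : iter j B (f + g) = iter j B f + iter j B g.
Proof. by elim: j => // j IH; rewrite !iterS IH BD. Qed.

Lemma iterGD j f g : iter j G (f + g) = iter j G f + iter j G g.
Proof. by elim: j => // j IH; rewrite !iterS IH GD. Qed.

Lemma iterGZ j c f : iter j G (c *: f) = c *: iter j G f.
Proof. by elim: j => // j IH; rewrite !iterS IH GZ. Qed.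

Lemma near_B K f : near K f -> near (2 * K + 2) (B f).
Proof. by move=> /near_hop; exact: nearZ. Qed.

Lemma nrm_B K f : (0 < N)%N -> near K f -> nrm (B f) <= (K + 2)%:R * eps R N * nrm f.
Proof.
move=> N0 nf; rewrite /B nrmZ ger0_norm ?invr_ge0 ?mulr_ge0//.
have N2 : 0 < 2 * N%:R :> R by rewrite mulr_gt0// ltr0n.
rewrite ler_pdivrMl//; apply: le_trans (nrm_hop N0 nf) _.
rewrite !mulrA ler_wpM2r ?nrm_ge0// le_eqVlt; apply/orP; left; apply/eqP.
rewrite mulrAC -[in RHS](@sqr_sqrtr _ N%:R) ?ler0n// /eps.
have : Num.sqrt N%:R != 0 :> R by rewrite gt_eqF// sqrtr_gt0 ltr0n.
have -> : (2 * K + 4)%:R = 2 * (K + 2)%:R :> R by rewrite -natrM; congr _%:R; lia.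
by move: (Num.sqrt _) => s s0; field.
Qed.

Definition binc l j : R := (-1) ^+ j * 'C(l, j)%:R.

Lemma binc0 l : binc l 0 = 1.
Proof. by rewrite /binc bin0 expr0 mul1r. Qed.

Lemma bincS l j : binc l.+1 j.+1 = binc l j.+1 - binc l j.
Proof. by rewrite /binc binS natrD exprS; ring. Qed.

Lemma binc_small l j : (l < j)%N -> binc l j = 0.
Proof. by move=> lj; rewrite /binc bin_small// mulr0. Qed.

(** The cutoff J may be any number above l, the surplus coefficients being 0; thus one expansion can
    be cut at any order, even beyond l. *)
Lemma iterG_binomial l J f : (l < J)%N ->
  iter l G f = \sum_(j < J) binc l j *: iter j B f.
Proof.
elim: l J => [|l IH] [//|J].
  move=> _; rewrite big_ord_recl big1 ?addr0 => [|i _].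
    by rewrite binc0 scale1r.
  by rewrite binc_small ?scale0r.
rewrite ltnS => lJ; rewrite iterS (IH J lJ) /G B_sum.
rewrite [RHS]big_ord_recl /= binc0 scale1r.
have -> : \sum_(j < J) binc l j *: iter j B f =
    f + \sum_(j < J) binc l (bump 0 j) *: B (iter j B f).
  have : \sum_(j < J.+1) binc l j *: iter j B f =
    \sum_(j < J) binc l j *: iter j B f + binc l J *: iter J B f.
    by rewrite big_ord_recr.
  rewrite big_ord_recl /= (binc_small lJ) scale0r addr0 => <-.
  by rewrite binc0 scale1r.
rewrite -addrA; congr (_ + _); rewrite -sumrB; apply: eq_bigr => j _.
by rewrite BZ -scalerBl /bump /= add1n bincS.
Qed.

End Near.

Arguments B {R N} f.
Arguments G {R N} f.

(** The order of the quantifiers is the point: the constant and the new radius are chosen before N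
    and f. *)
Lemma iterB_near (R : realType) (j K : nat) : exists C : R, 0 <= C /\
  exists K' : nat, forall N (f : fsf R (lattice N)), (0 < N)%N -> near K f ->
    near K' (iter j (@B R N) f) /\ nrm (iter j (@B R N) f) <= C * eps R N ^+ j * nrm f.
Proof.
elim: j K => [|j IH] K.
  exists 1; split=> //; exists K => N f _ nf; split=> //=.
  by rewrite expr0 !mul1r.
have [C [C0 [K' h]]] := IH (2 * K + 2)%N.
exists (C * (K + 2)%:R); split; first by rewrite mulr_ge0.
exists K' => N f N0 nf; rewrite iterSr; have [h1 h2] := h N _ N0 (near_B nf).
split=> //; apply: (le_trans h2).
rewrite exprSr mulrACA -[leRHS]mulrA ler_wpM2l ?nrm_B//.
by rewrite mulr_ge0// exprn_ge0// ltW// eps_gt0.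
Qed.

(** * A weighted Hardy inequality *)

Lemma inv_pow_le (R : realType) (k : nat) : exists C : R, 0 <= C /\
  forall y, `|y| <= 2^-1 -> (1 + y)^-1 ^+ k <= 1 - k%:R * y + C * y ^+ 2.
Proof.
elim: k => [|k [C [C0 IH]]].
  by exists 0; split=> // y _; rewrite expr0; lra.
(* The product of the two quadratic bounds has y^2 coefficient C + k + 2; the additional 2 C + 2 k
   absorbs its cubic and quartic terms when |y| <= 1/2. *)
exists (3 * C + k%:R + 2 + 2 * k%:R); split; first by rewrite !addr_ge0 ?mulr_ge0.
move=> y yh; have := IH y yh; move: yh; rewrite ler_norml => /andP[y1 y2] h.
have y0 : 0 < 1 + y by lra.
have inv : (1 + y)^-1 <= 1 - y + 2 * y ^+ 2.
  rewrite -[leLHS]div1r ler_pdivrMr//.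
  have -> : (1 - y + 2 * y ^+ 2) * (1 + y) = 1 + y ^+ 2 * (1 + 2 * y) by ring.
  by rewrite lerDl mulr_ge0 ?sqr_ge0//; lra.
have iv0 : 0 <= (1 + y)^-1 by rewrite invr_ge0 ltW.
rewrite exprSr; apply: (le_trans (ler_pM _ _ h inv)) => //; first by rewrite exprn_ge0.
have k0 : 0 <= k%:R :> R by [].
rewrite -[k.+1]addn1 natrD.
rewrite -subr_ge0.
have -> : 1 - (k%:R + 1) * y + (3 * C + k%:R + 2 + 2 * k%:R) * y ^+ 2
    - (1 - k%:R * y + C * y ^+ 2) * (1 - y + 2 * y ^+ 2) =
    y ^+ 2 * (C * (2 + y - 2 * y ^+ 2) + 2 * k%:R * (1 + y)) by ring.
have q : y ^+ 2 <= 4^-1 by nra.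
rewrite mulr_ge0 ?sqr_ge0// addr_ge0// mulr_ge0//; first by lra.
  by rewrite mulr_ge0.
by lra.
Qed.

Section FarField.
Variables (R : realType) (N : nat).
Implicit Types (n : lattice N) (u f g : fsf R (lattice N)).

Definition rho (M : nat) n : R := (sq n)%:R + M%:R.

Definition irho M k n : R := (rho M n)^-1 ^+ k.

(** Second-order expansion in y = (1 + 2 x) / r and y = (1 - 2 x) / r for each coordinate x. The
    terms linear in x cancel, leaving a total decrement 2 k N / r. The quadratic errors add up to at
    most N / r: half of it from [4 * C <= M], half from [16 * C <= N]. As k >= 1, the decrement k N
    / r survives. *)
Lemma nsum_irho_bound (k M : nat) (C : R) n :
  (forall y : R, `|y| <= 2^-1 -> (1 + y)^-1 ^+ k <= 1 - k%:R * y + C * y ^+ 2) ->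
  0 <= C -> (0 < k)%N -> (6 <= M)%N -> 4 * C <= M%:R -> 16 * C <= N%:R ->
  nsum (irho M k) n <= (2 * N%:R - k%:R * N%:R / rho M n) * irho M k n.
Proof.
move=> HC C0 k0 M6 MC NC; set r := rho M n.
have rM : M%:R <= r by rewrite lerDr.
have M6' : 6 <= M%:R :> R by rewrite ler_nat.
have r0 : 0 < r by lra.
have s0 : 0 <= irho M k n by rewrite exprn_ge0// invr_ge0 ltW.
rewrite /nsum sum_dir.
apply: (@le_trans _ _ (\sum_(i < N) (2 - 2 * k%:R / r
     + C * (2 + 8 * (`|n 0%R i| ^ 2)%N%:R) / r ^+ 2) * irho M k n)).
  apply: ler_sum => i _.
  set x : R := (n 0 i)%:~R.
  have xx : (`|n 0%R i| ^ 2)%N%:R = x ^+ 2.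
    by rewrite natrX natr_absz intr_norm real_normK ?num_real.
  have xr : x ^+ 2 + M%:R <= r by rewrite -xx lerD2r ler_nat coord_le_sq.
  have rE p : rho M (n + unitv p) = r + 1 + 2 * ((sgn p)%:~R * (n 0 p.1)%:~R).
    have /(congr1 (intr : int -> R)) := sq_unitvD n p.
    rewrite /r /rho !rmorphD !rmorphM /= -!pmulrn => ->; ring.
  have step (y : R) m : rho M m = r * (1 + y) -> `|y| <= 2^-1 ->
      irho M k m <= (1 - k%:R * y + C * y ^+ 2) * irho M k n.
    move=> rm yh; rewrite /irho rm invfM exprMn -/r mulrC ler_wpM2r//.
    exact: HC.
  (* With [6 <= M] the requirement |y| <= 1/2 reduces to 2 + 4 |x| <= x^2 + 6, that is (|x| - 2)^2
     >= 0. *)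
  have p1 : 0 <= x ^+ 2 - 4 * x + 4 by have := sqr_ge0 (x - 2); congr (_ <= _); ring.
  have p2 : 0 <= x ^+ 2 + 4 * x + 4 by have := sqr_ge0 (x + 2); congr (_ <= _); ring.
  have ya : `|(1 + 2 * x) / r| <= 2^-1.
    rewrite normrM normfV (gtr0_norm r0) ler_pdivrMr// ler_norml; apply/andP; split; lra.
  have yb : `|(1 - 2 * x) / r| <= 2^-1.
    rewrite normrM normfV (gtr0_norm r0) ler_pdivrMr// ler_norml; apply/andP; split; lra.
  have rn : r != 0 by rewrite gt_eqF.
  have ha : rho M (n + unitv (i, false)) = r * (1 + (1 + 2 * x) / r).
    by rewrite rE /sgn /= -/x; field.
  have hb : rho M (n + unitv (i, true)) = r * (1 + (1 - 2 * x) / r).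
    by rewrite rE /sgn /= -/x; field.
  apply: (le_trans (lerD (step _ _ ha ya) (step _ _ hb yb))).
  rewrite -mulrDl ler_wpM2r// xx le_eqVlt; apply/orP; left; apply/eqP.
  by field.
rewrite -mulr_suml; apply: ler_wpM2r => //.
rewrite (eq_bigr (fun i => (2 - 2 * k%:R / r + 2 * C / r ^+ 2)
     + (`|n 0%R i| ^ 2)%N%:R * (8 * C / r ^+ 2))); last by move=> i _; field; rewrite gt_eqF.
rewrite big_split /= sumr_const card_ord.
have -> (D : R) : \sum_(i < N) (`|n 0%R i| ^ 2)%N%:R * D = (sq n)%:R * D.
  by rewrite -mulr_suml -natr_sum.
rewrite -[_ *+ N]mulr_natl.
have sr : (sq n)%:R <= r by rewrite lerDl.
have -> : 2 * N%:R - k%:R * N%:R / r = N%:R * (2 - 2 * k%:R / r + 2 * C / r ^+ 2) +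
   r^-1 * (k%:R * N%:R - N%:R * (2 * C / r)).
  by field; rewrite gt_eqF.
rewrite lerD2l.
have -> : (sq n)%:R * (8 * C / r ^+ 2) = r^-1 * (8 * C * ((sq n)%:R / r)).
  by field; rewrite gt_eqF.
rewrite ler_pM2l ?invr_gt0//.
have h1 : (sq n)%:R / r <= 1 by rewrite ler_pdivrMr// mul1r.
have h2 : 2 * C / r <= 2^-1 by rewrite ler_pdivrMr//; lra.
have N0 : 0 <= N%:R :> R by [].
have k1 : 1 <= k%:R :> R by rewrite ler1n.
have h3 : 8 * C * ((sq n)%:R / r) <= 8 * C by rewrite ler_piMr// mulr_ge0.
have h4 : N%:R * (2 * C / r) <= N%:R / 2 by rewrite ler_wpM2l.
have h5 : N%:R <= k%:R * N%:R :> R by rewrite ler_peMl.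
lra.
Qed.

Variable M : nat.
Hypothesis M0 : (0 < M)%N.

Lemma rho_gt0 n : 0 < rho M n.
Proof. by rewrite ltr_wpDl ?ltr0n. Qed.

Lemma irho_gt0 k n : 0 < irho M k n.
Proof. by rewrite exprn_gt0// invr_gt0 rho_gt0. Qed.

Lemma irhoD j k n : irho M (j + k) n = irho M j n * irho M k n.
Proof. exact: exprD. Qed.

Definition Srho q f g := ip (fmul (irho M q) f) g.

Variable k : nat.
Hypothesis N0 : (0 < N)%N.

(** Equivalent to G phi >= (k / (2 rho)) phi for phi = [irho M j]: a positive supersolution with a
    Hardy potential. The decrement k stays fixed while the exponent j grows, so every application of
    G below gains the same factor k / 2. *)
Definition superharmonic j := forall n,
  nsum (irho M j) n <= (2 * N%:R - k%:R * N%:R / rho M n) * irho M j n.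

(* Each product [u n * u m] over an edge is split by the arithmetic-geometric
   inequality with ratio [irho k m / irho k n]; what remains is the
   superharmonicity of [irho k] and of [irho (q + k)]. *)
Lemma weighted_hardy q u : superharmonic k -> superharmonic (q + k) ->
  k%:R / 2 * Srho q.+1 u u <= Srho q u (G u).
Proof.
move=> sk sqk.
pose phi := irho M k.
pose F := fmul (fun m => (phi m)^-1 * u m) u.
have phi0 n : 0 < phi n by exact: irho_gt0.
have q0 n : 0 < irho M q n by exact: irho_gt0.
have key : ip (fmul (irho M q) u) (hop u) <=
    Sum (fmul (fun n => (2 * N%:R - k%:R * N%:R / rho M n) * irho M q n * u n) u).
  pose E1 := fmul (fun n => irho M q n * (phi n)^-1 * nsum phi n * u n) u.
  pose E2 := fmul (fun n => irho M q n * phi n) (hop F).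
  apply: (@le_trans _ _ (Sum (2^-1 *: (E1 + E2)))).
    apply: le_Sum => n; rewrite fsfZE fsfDE !fmulE !hopE /nsum.
    have -> : irho M q n / phi n * (\sum_p phi (n + unitv p)) * u n * u n +
       irho M q n * phi n * \sum_p F (n + unitv p) =
       irho M q n * \sum_p (phi (n + unitv p) / phi n * u n ^+ 2
         + phi n / phi (n + unitv p) * u (n + unitv p) ^+ 2).
      rewrite big_split /= mulrDr -mulr_suml -mulr_suml; congr (_ + _).
        by ring.
      rewrite -mulrA; congr (_ * _); rewrite mulr_sumr; apply: eq_bigr => p _ /=.
      by rewrite expr2 !mulrA.
    rewrite mulrCA -mulrA ler_pM2l// !mulr_sumr; apply: ler_sum => p _.
    have : 0 < phi (n + unitv p) / phi n by rewrite divr_gt0.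
    rewrite -[phi n / phi _]invf_div.
    move: (phi _ / phi n) (u n) (u _) => t a b t0.
    have : 0 <= t^-1 * (t * a - b) ^+ 2 by rewrite mulr_ge0 ?sqr_ge0// invr_ge0 ltW.
    have -> : t^-1 * (t * a - b) ^+ 2 = t * a ^+ 2 + t^-1 * b ^+ 2 - 2 * (a * b).
      by field; rewrite gt_eqF.
    lra.
  (* Symmetry moves the neighbour sum from u^2 / phi onto the product of [irho M q] and phi, which
     is [irho M (q + k)]; this is where the second superharmonicity enters. *)
  rewrite SumZ SumD Sum_hop -SumD -SumZ; apply: le_Sum => n.
  rewrite fsfZE fsfDE !fmulE.
  have h1 := sk n; have := sqk n.
  have -> : nsum (irho M (q + k)) n = nsum (fun n => irho M q n * phi n) n.
    by apply: eq_bigr => p _; rewrite irhoD.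
  rewrite irhoD -/(phi n) => h2.
  have u0 : 0 <= irho M q n * (phi n)^-1 * u n ^+ 2.
    by rewrite mulr_ge0 ?sqr_ge0// mulr_ge0 ?invr_ge0 ?ltW.
  have u1 : 0 <= (phi n)^-1 * u n ^+ 2.
    by rewrite mulr_ge0 ?sqr_ge0// ?invr_ge0 ?ltW.
  have := lerD (ler_wpM2l u0 h1) (ler_wpM2l u1 h2).
  rewrite -/phi; have pn : phi n != 0 by rewrite gt_eqF.
  set D := 2 * N%:R - _; set a := nsum phi n; set b := nsum _ n.
  move: (irho M q n) (phi n) (u n) pn => i f v fn.
  have -> : i / f * v ^+ 2 * (D * f) + f^-1 * v ^+ 2 * (D * (i * f)) = 2 * (D * i * v * v).
    by field.
  have -> : i / f * a * v * v + b * (f^-1 * v * v) =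
    i / f * v ^+ 2 * a + f^-1 * v ^+ 2 * b by field.
  lra.
have N2 : 0 < 2 * N%:R :> R by rewrite mulr_gt0// ltr0n.
rewrite /Srho /G ipDr ipNr /B ipZr lerBrDr -lerBrDl.
rewrite ler_pdivrMl//; apply: (le_trans key).
rewrite /ip -SumZ -SumN -SumD -SumZ; apply: le_Sum => n.
rewrite !fsfE /irho exprSr -/(irho M q n) le_eqVlt; apply/orP; left; apply/eqP.
have rn : rho M n != 0 by rewrite gt_eqF// rho_gt0.
by field.
Qed.

(** With t = k / 2, expand the square of G u - t u / rho in the weight [irho M q]. By
    [weighted_hardy] at q + 1 its cross term is at least 2 t^2 times the form at q + 2, of which the
    square of t u / rho takes back one half. *)
Lemma Srho_G q u : superharmonic k -> superharmonic (q.+1 + k) ->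
  (k%:R / 2) ^+ 2 * Srho q.+2 u u <= Srho q (G u) (G u).
Proof.
move=> sk sqk; move: (G u) (weighted_hardy u sk sqk) => v h.
have : 0 <= Srho q (v - (k%:R / 2) *: fmul (irho M 1) u)
                   (v - (k%:R / 2) *: fmul (irho M 1) u).
  apply: Sum_ge0 => n; rewrite !fmulE -mulrA -expr2 mulr_ge0 ?sqr_ge0//.
  exact/ltW/irho_gt0.
rewrite /Srho !ip_fmul.
have addf f g : fmul (irho M q) (f + g) = fmul (irho M q) f + fmul (irho M q) g.
  by apply: fsfP => n; rewrite !fsfE mulrDr.
have negf f : fmul (irho M q) (- f) = - fmul (irho M q) f.
  by apply: fsfP => n; rewrite !fsfE mulrN.
have scf c f : fmul (irho M q) (c *: f) = c *: fmul (irho M q) f.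
  by apply: fsfP => n; rewrite !fsfE mulrCA.
have e1 : fmul (irho M q) (fmul (irho M 1) u) = fmul (irho M q.+1) u.
  by apply: fsfP => n; rewrite !fsfE mulrA -irhoD addn1.
rewrite addf negf scf e1 !(ipDr, ipDl, ipNr, ipNl, ipZr, ipZl).
have -> : ip (fmul (irho M 1) u) (fmul (irho M q) v) = ip v (fmul (irho M q.+1) u).
  by rewrite -ip_fmul e1 ipC.
have -> : ip (fmul (irho M 1) u) (fmul (irho M q.+1) u) = ip u (fmul (irho M q.+2) u).
  rewrite ip_fmul; congr (ip _ _); apply: fsfP => n.
  by rewrite !fsfE mulrA -irhoD add1n.
move: h; rewrite /Srho [ip (fmul (irho M q.+1) u) v]ipC ip_fmul.
set a := ip v (fmul (irho M q) v); set b := ip v _.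
set c := ip u _; set t : R := k%:R / 2 => h.
have t0 : 0 <= t by rewrite divr_ge0.
have := ler_wpM2l t0 h; nra.
Qed.

Lemma Srho_iterG q m u : superharmonic k ->
  (forall j, (j <= q + 2 * m)%N -> superharmonic (j + k)) ->
  (k%:R / 2) ^+ (2 * m) * Srho (q + 2 * m) u u <= Srho q (iter m G u) (iter m G u).
Proof.
move=> sk; elim: m q => [|m IH] q sj; first by rewrite muln0 addn0 expr0 mul1r.
rewrite iterS; apply: le_trans (Srho_G _ sk _); last by apply: sj; lia.
have -> : (2 * m.+1 = 2 + 2 * m)%N by lia.
rewrite exprD -mulrA ler_wpM2l ?sqr_ge0//.
have -> : (q + (2 + 2 * m) = q.+2 + 2 * m)%N by lia.
by apply: IH => j jh; apply: sj; lia.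
Qed.

(** By self-adjointness half of the powers of G go to each side, so that [Srho_iterG] applies with
    two units of weight per power; for odd l the remaining G is handled by one use of
    [weighted_hardy] with q = 0. *)
Lemma far_field_form l u :
  (forall j, (j <= l)%N -> superharmonic (j + k)) ->
  (k%:R / 2) ^+ l * Srho l u u <= ip u (iter l G u).
Proof.
move=> sj; have sk : superharmonic k by rewrite -[k]add0n; exact: sj.
have i0 f g : Srho 0 f g = ip f g.
  by apply: eq_Sum => n; rewrite !fmulE /irho expr0 mul1r.
have t0 : 0 <= k%:R / 2 :> R by rewrite divr_ge0.
have [m [lE|lE]] : exists m, l = (2 * m)%N \/ l = (2 * m).+1.
  by exists l./2; lia.
  subst l; have := @Srho_iterG 0 m u sk _; rewrite add0n i0 => h.
  apply: (le_trans (h _)); first by move=> j jm; apply: sj.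
  by rewrite -ip_iterG -iterD addnn mul2n lexx.
subst l; have := @Srho_iterG 1 m u sk _; rewrite add1n => h.
have -> : ip u (iter (2 * m).+1 G u) = Srho 0 (iter m G u) (G (iter m G u)).
  by rewrite i0 mul2n -addnn -addnS iterD ip_iterG iterS.
apply: le_trans (@weighted_hardy 0 _ sk _); last by rewrite add0n.
by rewrite exprS -mulrA ler_wpM2l// h.
Qed.

End FarField.

(* At the origin the weight is 0 (for 0 < l), since the inverse of 0 is 0. *)
Definition wt (R : realType) N (l : nat) (n : lattice N) : R := (sq n)%:R^-1 ^+ l.

Definition wip (R : realType) N l (f g : fsf R (lattice N)) : R := ip (fmul (wt R l) f) g.

(** * Coercivity away from the unit sphere *)

Lemma exists_nat_ge (R : realType) (x : R) : exists M : nat, forall m : nat, (M <= m)%N -> x <= m%:R.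
Proof.
exists (Num.truncn x).+1 => m Mm; apply: ltW; apply: lt_le_trans (truncnS_gt x) _.
by rewrite ler_nat.
Qed.

Lemma eps_small (R : realType) (C d : R) : 0 <= C -> 0 < d ->
  exists N0 : nat, forall N, (N0 <= N)%N -> (0 < N)%N /\ C * eps R N <= d.
Proof.
move=> C0 d0; have [M hM] := exists_nat_ge ((C / d) ^+ 2).
exists M.+1 => N MN; have N0 : (0 < N)%N by lia.
split=> //; have := hM N (ltnW MN); rewrite /eps => h.
rewrite ler_pdivrMr ?sqrtr_gt0 ?ltr0n// mulrC -ler_pdivrMr//.
by rewrite -(ger0_norm (divr_ge0 C0 (ltW d0))) -sqrtr_sqr ler_sqrt.
Qed.

(** The constant of [inv_pow_le] depends on the exponent j + k; as j runs over a finite range, one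
    threshold for M and N serves all of them. *)
Lemma superharmonic_large (R : realType) (k l : nat) : (0 < k)%N -> exists M0 : nat,
  forall M N : nat, (M0 <= M)%N -> (M0 <= N)%N ->
    forall j, (j <= l)%N -> superharmonic R N M k (j + k).
Proof.
move=> k0; elim: l => [|l [M1 IH]].
  have [C [C0 HC]] := inv_pow_le R k.
  have [M1 hM1] := exists_nat_ge (16 * C).
  exists (M1 + 6)%N => M N MM NN j; rewrite leqn0 => /eqP -> n.
  have hM : 16 * C <= M%:R by apply: hM1; lia.
  have hN : 16 * C <= N%:R by apply: hM1; lia.
  by rewrite add0n; apply: nsum_irho_bound HC _ _ _ _ _ => //; [lia | lra].
have [C [C0 HC]] := inv_pow_le R (l.+1 + k).
have [M2 hM2] := exists_nat_ge (16 * C).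
exists (M1 + M2 + 6)%N => M N MM NN j.
rewrite leq_eqVlt => /predU1P[->|]; last first.
  by rewrite ltnS => jl; apply: IH => //; lia.
move=> n.
have hM : 16 * C <= M%:R by apply: hM2; lia.
have hN : 16 * C <= N%:R by apply: hM2; lia.
have := @nsum_irho_bound R N (l.+1 + k) M C n HC C0.
move=> /(_ _ _ _ hN); rewrite addSn => h; apply: (le_trans (h _ _ _)) => //; [lia|lra|].
(* The exponent l + 1 + k comes with its own, larger decrement, which is weakened to k. *)
rewrite ler_wpM2r ?exprn_ge0 ?invr_ge0 ?addr_ge0// lerD2l lerN2.
rewrite ler_wpM2r ?invr_ge0 ?addr_ge0// ler_wpM2r// ler_nat; lia.
Qed.

(** This is |n|^l, the inverse square root of the weight off the origin. Multiplication by it gives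
    the norm dual to [wnrm] in [weighted_cs]. *)
Definition sroot (R : realType) N (l : nat) (n : lattice N) : R :=
  Num.sqrt ((sq n)%:R ^+ l).

Definition wnrm (R : realType) N l (f : fsf R (lattice N)) : R :=
  nrm (fmul (fun n => (sroot R l n)^-1) f).

Section WeightedNorm.
Variables (R : realType) (N l : nat).
Implicit Types (n : lattice N) (f g : fsf R (lattice N)).

Lemma sroot_sqr n : sroot R l n ^+ 2 = (sq n)%:R ^+ l.
Proof. by rewrite sqr_sqrtr// exprn_ge0. Qed.

Lemma sroot_gt0 n : (0 < sq n)%N -> 0 < sroot R l n.
Proof. by move=> n0; rewrite sqrtr_gt0 exprn_gt0// ltr0n. Qed.

Lemma wnrm_ge0 f : 0 <= wnrm l f. Proof. exact: nrm_ge0. Qed.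

Lemma wnrm_sqr f : wnrm l f ^+ 2 = wip l f f.
Proof.
rewrite nrm_sqr; apply: eq_Sum => n; rewrite !fmulE mulrACA -expr2 exprVn sroot_sqr.
by rewrite /wt exprVn mulrA.
Qed.

Lemma weighted_cs f g : f 0 = 0 ->
  `|ip f g| <= wnrm l f * nrm (fmul (sroot R l) g).
Proof.
move=> f0; apply: le_trans (cauchy_schwarz _ _).
rewrite le_eqVlt; apply/orP; left; apply/eqP; congr (`| _ |); apply: eq_Sum => n.
rewrite !fmulE; have [->|n0] := eqVneq n 0; first by rewrite f0 mulr0 !mul0r.
have : 0 < sroot R l n by apply: sroot_gt0; rewrite lt0n sq_eq0.
by move=> s0; rewrite mulrACA mulVf ?mul1r// gt_eqF.
Qed.

Lemma nrm_sroot_near K g : (0 < K)%N -> near K g ->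
  nrm (fmul (sroot R l) g) <= K%:R ^+ l * nrm g.
Proof.
move=> K0 ng; have K1 : 1 <= K%:R ^+ l :> R by rewrite exprn_ege1// ler1n.
rewrite -[X in X * _](ger0_norm (le_trans ler01 K1)) -nrmZ; apply: ler_nrm => n.
rewrite fmulE fsfZE !exprMn; have [->|/ng nK] := eqVneq (g n) 0.
  by rewrite expr0n !mulr0.
rewrite ler_wpM2r ?sqr_ge0// sroot_sqr.
apply: (@le_trans _ _ (K%:R ^+ l)); first by rewrite lerXn2r ?nnegrE// ler_nat.
by rewrite expr2 ler_peMl// exprn_ge0.
Qed.

Lemma wip_le_nrm (m : nat) f : (0 < m)%N -> (forall n, f n != 0 -> (m <= sq n)%N) ->
  m%:R ^+ l * wip l f f <= ip f f.
Proof.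
move=> m0 fm; rewrite /wip /ip -SumZ; apply: le_Sum => n.
rewrite fsfZE !fmulE; have [->|/fm mn] := eqVneq (f n) 0; first by rewrite !mulr0.
have -> : m%:R ^+ l * (wt R l n * f n * f n) = (m%:R / (sq n)%:R) ^+ l * (f n * f n).
  by rewrite exprMn /wt !mulrA.
rewrite ler_piMl -?expr2 ?sqr_ge0// exprn_ile1 ?divr_ge0//.
by rewrite ler_pdivrMr ?mul1r ?ler_nat// ltr0n; lia.
Qed.

Lemma wipC f g : wip l f g = wip l g f.
Proof. by rewrite /wip ip_fmul ipC. Qed.

Lemma wipDl f g h : wip l (f + g) h = wip l f h + wip l g h.
Proof.
rewrite /wip -ipDl; congr (ip _ _); apply: fsfP => n; by rewrite !fsfE mulrDr.
Qed.

Lemma wipDr f g h : wip l h (f + g) = wip l h f + wip l h g.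
Proof. by rewrite wipC wipDl !(wipC h). Qed.

Lemma wipZl c f g : wip l (c *: f) g = c * wip l f g.
Proof.
rewrite /wip -ipZl; congr (ip _ _); apply: fsfP => n; by rewrite !fsfE mulrCA.
Qed.

Lemma wipZr c f g : wip l g (c *: f) = c * wip l g f.
Proof. by rewrite wipC wipZl wipC. Qed.

Lemma wip_ge0 f : 0 <= wip l f f.
Proof. by rewrite -wnrm_sqr sqr_ge0. Qed.

Lemma wip_disjoint f g : (forall n, f n * g n = 0) -> wip l f g = 0.
Proof.
by move=> fg; apply: ip_disjoint => n; rewrite fmulE -mulrA fg mulr0.
Qed.

End WeightedNorm.

Lemma far_field (R : realType) (l : nat) : exists M : nat, (0 < M)%N /\
  forall N (u : fsf R (lattice N)), (M <= N)%N ->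
    (forall n, u n != 0 -> (M <= sq n)%N) ->
    2 ^+ l * wip l u u <= ip u (iter l G u).
Proof.
(* The decrement 8 gives (8 / 2)^l = 4^l against rho^(-l). Since the support lies where [sq n] is at
   least the shift in rho, rho <= 2 [sq n], which costs 2^l and leaves 2^l. *)
have [M hM] := @superharmonic_large R 8 l isT.
exists M.+1; split=> // N u MN uM.
have N0 : (0 < N)%N by lia.
have h := @far_field_form R N M.+1 isT 8 N0 l u.
apply: le_trans (h _); last by move=> j jl; apply: hM => //; lia.
rewrite /wip /Srho /ip -!SumZ; apply: le_Sum => n; rewrite !fsfZE !fmulE.
have [->|/uM un] := eqVneq (u n) 0; first by rewrite !mulr0.
have -> : 2 ^+ l * (wt R l n * u n * u n) = (2 / (sq n)%:R) ^+ l * (u n * u n).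
  by rewrite exprMn /wt !mulrA.
have -> : (8 / 2) ^+ l * (irho R M.+1 l n * u n * u n) =
    (8 / 2 / rho R M.+1 n) ^+ l * (u n * u n).
  by rewrite [in RHS]exprMn /irho !mulrA.
rewrite ler_wpM2r -?expr2 ?sqr_ge0//.
rewrite lerXn2r ?nnegrE ?mulr_ge0 ?invr_ge0 ?addr_ge0//.
have m0 : 1 <= M.+1%:R :> R by rewrite ler1n.
have : M.+1%:R <= (sq n)%:R :> R by rewrite ler_nat.
rewrite /rho; move: (sq n)%:R M.+1%:R m0 => s m m0 ms.
by rewrite ler_pdivrMr ?(lt_le_trans _ (le_trans m0 ms))// mulrAC ler_pdivlMr; lra.
Qed.

(** The remainder consists of the terms of index J to J + l, each O(eps^J) with the same support
    radius; beyond index l the coefficients vanish, so even J > l is covered. *)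
Lemma iterG_taylor (R : realType) (l J K : nat) : exists C : R, 0 <= C /\
  exists K' : nat, (0 < K')%N /\ forall N (f : fsf R (lattice N)), (0 < N)%N -> near K f ->
    exists r : fsf R (lattice N),
    [/\ iter l G f = \sum_(j < J) binc R l j *: iter j B f + r,
        near K' r & nrm r <= C * eps R N ^+ J * nrm f].
Proof.
have tail m : exists C : R, 0 <= C /\ exists K' : nat,
    forall N (f : fsf R (lattice N)), (0 < N)%N -> near K f ->
    near K' (\sum_(i < m) binc R l (J + i) *: iter (J + i) B f) /\
    nrm (\sum_(i < m) binc R l (J + i) *: iter (J + i) B f) <= C * eps R N ^+ J * nrm f.
  elim: m => [|m [C [C0 [K1 IH]]]].
    exists 0; split=> //; exists 0%N => N f N0 nf; rewrite big_ord0 nrm0 !mul0r.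
    by split=> // n; rewrite fsf0E eqxx.
  have [C2 [C20 [K2 h]]] := iterB_near R (J + m) K.
  exists (C + `|binc R l (J + m)| * C2); split; first by rewrite addr_ge0 ?mulr_ge0.
  exists (K1 + K2)%N => N f N0 nf; have [a1 a2] := IH N f N0 nf.
  have [b1 b2] := h N f N0 nf; rewrite big_ord_recr /=; split.
    apply: nearD; first by apply: near_le a1; lia.
    by apply: nearZ; apply: near_le b1; lia.
  apply: (le_trans (nrmD _ _)); rewrite !mulrDl lerD// nrmZ -!mulrA ler_wpM2l//.
  apply: (le_trans b2); rewrite !mulrA ler_wpM2r ?nrm_ge0// ler_wpM2l//.
  have e0 := eps_gt0 R N0.
  by rewrite exprD ler_piMr ?exprn_ge0 ?exprn_ile1 ?eps_le1 ?ltW.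
have [C [C0 [K' h]]] := tail l.+1.
exists C; split=> //; exists K'.+1; split=> // N f N0 nf; have [h1 h2] := h N f N0 nf.
exists (\sum_(i < l.+1) binc R l (J + i) *: iter (J + i) B f); split => //.
  by rewrite (@iterG_binomial _ _ _ (J + l.+1)) ?big_split_ord//; lia.
by apply: near_le h1.
Qed.

Definition mask (R : realType) N (P : pred nat) (f : fsf R (lattice N)) :
  fsf R (lattice N) := fmul (fun n => (P (sq n))%:R) f.

Section Mask.
Variables (R : realType) (N : nat).
Implicit Types (f g : fsf R (lattice N)) (P Q : pred nat).

Lemma maskE P f n : mask P f n = if P (sq n) then f n else 0.
Proof. by rewrite fmulE; case: ifP; rewrite ?mul1r ?mul0r. Qed.

Lemma mask_split P f : f = mask P f + mask (predC P) f.
Proof.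
by apply: fsfP => n; rewrite fsfDE !maskE /=; case: (P _); rewrite ?addr0 ?add0r.
Qed.

Lemma near_mask K P f : near K f -> near K (mask P f).
Proof. exact: near_fmul. Qed.

Lemma maskD P f g : mask P (f + g) = mask P f + mask P g.
Proof. by apply: fsfP => n; rewrite !fsfE mulrDr. Qed.

Lemma maskZ P c f : mask P (c *: f) = c *: mask P f.
Proof. by apply: fsfP => n; rewrite !fsfE mulrCA. Qed.

Lemma nrm_mask P f : nrm (mask P f) <= nrm f.
Proof.
apply: ler_nrm => n; rewrite maskE; case: ifP => // _.
by rewrite expr0n /= sqr_ge0.
Qed.

Lemma ip_mask P f g : ip (mask P f) g = ip f (mask P g).
Proof. exact: ip_fmul. Qed.

End Mask.

(* Away from the unit sphere the weight beats the leading term by a factor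
   2^l: near the origin since [G] is then close to the identity, far away by
   the Hardy inequality above; the two regions barely interact. *)
Lemma coercive_off_sphere (R : realType) (l : nat) (eta : R) : 0 < eta -> eta <= 2 ^+ l ->
  exists N0 : nat, (0 < N0)%N /\ forall N (w : fsf R (lattice N)), (N0 <= N)%N ->
    (forall n, w n != 0 -> (2 <= sq n)%N) ->
    (2 ^+ l - eta) * wip l w w <= ip w (iter l G w).
Proof.
move=> eta0 etal; have [M [M0 far]] := far_field R l.
have [C [C0 [K [K0 tay]]]] := iterG_taylor R l 1 M.
pose D : R := K%:R ^+ l.
have D0 : 0 <= D by rewrite exprn_ge0.
have p0 : 0 < 2 ^+ l :> R by rewrite exprn_gt0.
(* A relative loss d of |wa|^2 becomes a loss eta of the weighted form, because |wa|^2 is at least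
   2^l times that form. *)
pose d := eta / 2 ^+ l.
have d0 : 0 < d by rewrite divr_gt0.
have de : d <= eta by rewrite ler_pdivrMr// ler_peMr ?(ltW eta0)// exprn_ege1// ler1n.
have [N1 hN1] := @eps_small R (C + D * C) d (addr_ge0 C0 (mulr_ge0 D0 C0)) d0.
exists (N1 + M)%N; split=> [|N w NN w2]; first by lia.
have [|N0 small] := hN1 N; first by lia.
pose P : pred nat := fun k => (k < M)%N.
have ws : w = mask P w + mask (predC P) w := mask_split P w.
set wa := mask P w in ws; set wb := mask (predC P) w in ws.
have na : near M wa.
  by move=> n; rewrite maskE /P; case: ifP => [/ltnW//|]; rewrite eqxx.
have [r [Gr nr rn]] := tay N wa N0 na.
have {}Gr : iter l G wa = wa + r by rewrite Gr big_ord1 binc0 scale1r.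
have ab n : wa n * wb n = 0.
  by rewrite !maskE /=; case: (P _); rewrite ?mulr0 ?mul0r.
have hb : 2 ^+ l * wip l wb wb <= ip wb (iter l G wb).
  apply: far; first by lia.
  by move=> n; rewrite maskE /=; case: ifP; rewrite ?eqxx// /P -leqNgt.
have ha : 2 ^+ l * wip l wa wa <= ip wa wa.
  apply: wip_le_nrm => // n; rewrite maskE; case: ifP; rewrite ?eqxx// => _; exact: w2.
have rr : `|ip wa r| <= nrm wa * nrm r by exact: cauchy_schwarz.
have wb0 : wb 0 = 0.
  rewrite maskE; case: ifP => // _; apply/eqP; apply: contraT => /w2.
  by rewrite sq0.
have rb : `|ip wb r| <= wnrm l wb * (D * nrm r).
  apply: (le_trans (weighted_cs l _ wb0)); rewrite ler_wpM2l ?wnrm_ge0//.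
  exact: nrm_sroot_near.
rewrite ws iterGD !(ipDl, ipDr) Gr ipDr.
(* The supports of [wa] and [wb] are disjoint, so the leading term of G^l [wa] does not see [wb]:
   the two regions interact only through the remainder r = O(eps). *)
have -> : ip wa (iter l G wb) = ip wb r.
  by rewrite ip_iterG Gr ipDl (ip_disjoint ab) add0r ipC.
rewrite ipDr (ipC wb wa) (ip_disjoint ab) add0r.
rewrite !(wipDl, wipDr) (wipC l wb wa) (wip_disjoint l ab) addr0 add0r.
move: ha hb rr rb; rewrite -!wnrm_sqr -!nrm_sqr.
have := rn; rewrite expr1.
have := nrm_ge0 r; have := nrm_ge0 wa; have := wnrm_ge0 l wb; have := wnrm_ge0 l wa.
have := eps_gt0 R N0.
move: (nrm r) (nrm wa) (wnrm l wb) (wnrm l wa) (eps R N) small (ip wb _) (ip wa r) (ip wb r).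
move=> z a t s e small X Y Z e0 s0 t0 a0 z0 zle ha hb.
rewrite !ler_norml => /andP[y1 _] /andP[z1 _].
have h1 : a * z <= C * e * a ^+ 2.
  by apply: le_trans (ler_wpM2l a0 zle) _; rewrite expr2 mulrCA.
have h2 : t * (D * z) <= D * C * e * (a * t).
  have := ler_wpM2l (mulr_ge0 t0 D0) zle; rewrite mulrA => /le_trans; apply.
  by rewrite le_eqVlt; apply/orP; left; apply/eqP; ring.
have h3 : 2 * (a * t) <= a ^+ 2 + t ^+ 2.
  by have := sqr_ge0 (a - t); rewrite sqrrB -mulr_natr; lra.
have DCe : 0 <= D * C * e by rewrite !mulr_ge0// ltW.
have Ce : 0 <= C * e by rewrite mulr_ge0// ltW.
have h4 := ler_wpM2l DCe h3.
have a2 := sqr_ge0 a; have t2 := sqr_ge0 t; have s2 := sqr_ge0 s.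
have small2 : C * e + D * C * e <= d by move: small; rewrite mulrDl.
have h5 := ler_wpM2r a2 small2.
have h6 : (C * e + D * C * e) * t ^+ 2 <= eta * t ^+ 2.
  by rewrite ler_wpM2r// (le_trans small2).
have h7 : (2 ^+ l - eta) * s ^+ 2 <= a ^+ 2 - d * a ^+ 2.
  have -> : a ^+ 2 - d * a ^+ 2 = (2 ^+ l - eta) * (a ^+ 2 / 2 ^+ l).
    by rewrite /d; field; rewrite gt_eqF.
  by rewrite ler_wpM2l ?subr_ge0// ler_pdivlMr// mulrC.
have Cet : 0 <= C * e * t ^+ 2 by rewrite mulr_ge0.
lra.
Qed.

(** * Level sets near the origin *)

Section Tables.
Variables (R : realType) (N : nat).
Implicit Types (n m : lattice N) (f g : fsf R (lattice N)).

Lemma chi_fin k : finite_set [set n : lattice N | (sq n == k)%:R != 0 :> R].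
Proof.
by apply: sub_finite_set (@fin_sq N k) => n /=; have [->//|] := eqVneq (sq n) k; rewrite eqxx.
Qed.

Definition chi k : fsf R (lattice N) := FSF (chi_fin k).

Lemma chiE k n : chi k n = (sq n == k)%:R. Proof. by []. Qed.

Lemma near_chi k : near k (chi k).
Proof. by move=> n; rewrite chiE; have [->//|] := eqVneq (sq n) k; rewrite eqxx. Qed.

Lemma sq_unitv_odd n p : odd (sq (n + unitv p)) = ~~ odd (sq n).
Proof.
have := sq_unitvD n p.
move: (sq _) (sq n) (sgn p * _) => a b c; lia.
Qed.

Definition parity b f := forall n, f n != 0 -> odd (sq n) = b.

Lemma parity_hop b f : parity b f -> parity (~~ b) (hop f).
Proof.
move=> pf n; rewrite hopE /nsum => h.
have [p fp] : exists p, f (n + unitv p) != 0.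
  apply/existsP; rewrite -negb_forall; apply: contraNN h => /forallP f0.
  by rewrite big1// => p _; apply/eqP.
by have := pf _ fp; rewrite sq_unitv_odd => <-; rewrite negbK.
Qed.

Lemma parity_B b f : parity b f -> parity (~~ b) (B f).
Proof.
by move=> /parity_hop pf n; rewrite /B fsfZE mulf_eq0 negb_or => /andP[_ /pf].
Qed.

Lemma parity_iterB j b f : parity b f -> parity (odd j (+) b) (iter j B f).
Proof.
elim: j => // j IH pf; have := parity_B (IH pf); rewrite -addNb //.
Qed.

Lemma ip_parity b f g : parity b f -> parity (~~ b) g -> ip f g = 0.
Proof.
move=> pf pg; apply: ip_disjoint => n.
have [->|/pf h1] := eqVneq (f n) 0; first by rewrite mul0r.
have [->|/pg] := eqVneq (g n) 0; first by rewrite mulr0.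
by rewrite h1; case: b {pf pg h1}.
Qed.

Lemma parity_chi k : parity (odd k) (chi k).
Proof. by move=> n; rewrite chiE; have [->//|] := eqVneq (sq n) k; rewrite eqxx. Qed.

Lemma parityZ b c f : parity b f -> parity b (c *: f).
Proof. by move=> pf n; rewrite fsfZE mulf_eq0 negb_or => /andP[_ /pf]. Qed.

Lemma parity_mask b P f : parity b f -> parity b (mask P f).
Proof. by move=> pf n; rewrite /mask fmulE mulf_eq0 negb_or => /andP[_ /pf]. Qed.

Lemma hop_chi j n : (sq n <= 3)%N -> let k := sq n in
  hop (chi j) n = k%:R * (k.-1 == j)%:R + 2 * (N%:R - k%:R) * (k.+1 == j)%:R
    + k%:R * (k.+3 == j)%:R.
Proof. by move=> n3 k; rewrite hopE (nsum_sq (fun k => (k == j)%:R) n3). Qed.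

(* [tips] is the indicator function of the points 2 *: unitv p. *)
Definition tips := mask (pred1 4) (hop (chi 1)).
(** The indicator function of the points with one coordinate 2 or -2 and one coordinate 1 or -1; the
    points of level 5 with five nonzero coordinates are not adjacent to level 2. *)
Definition rest5 := mask (pred1 5) (hop (chi 2)).

Lemma unitv_tip n p j : sq n = (j + 3)%N -> (sq (n + unitv p) == j) = (sgn p * n 0 p.1 == -2).
Proof. by move=> h; have := sq_unitvD n p; rewrite h; lia. Qed.

Lemma hop_tip01 j n : sq n = (j + 3)%N -> (j <= 2)%N ->
  hop (chi j) n = 0 \/ hop (chi j) n = 1.
Proof.
move=> h j2; rewrite hopE /nsum.
rewrite (eq_bigr (fun p => (sgn p * n 0 p.1 == -2)%:R)) => [|p _]; last first.
  by rewrite chiE unitv_tip.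
rewrite -natr_sum; have := count_two_le n; rewrite h.
by case: (\sum_p _)%N => [|[|c]]; [left|right|lia].
Qed.

Lemma tips01 n : tips n = 0 \/ tips n = 1.
Proof.
by rewrite /tips maskE /=; case: eqP => [h|]; [exact: (@hop_tip01 1) | left].
Qed.

Lemma rest501 n : rest5 n = 0 \/ rest5 n = 1.
Proof.
by rewrite /rest5 maskE /=; case: eqP => [h|]; [exact: (@hop_tip01 2) | left].
Qed.

Lemma hop_chi1 : hop (chi 1) = (2 * N%:R) *: chi 0 + 2 *: chi 2 + tips.
Proof.
apply: fsfP => n; rewrite !fsfDE !fsfZE !chiE /tips maskE /=.
have [n3|n4] := leqP (sq n) 3.
  rewrite hop_chi//; move: (sq n) n3 => [|[|[|[|k]]]]//= _; ring.
have [->|n5] := eqVneq (sq n) 4; first by rewrite /=; ring.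
have -> : hop (chi 1) n = 0.
  apply/eqP; apply: contraT => /(near_hop (@near_chi 1)); lia.
by move: (sq n) n4 n5 => [|[|[|k]]]//= _ _; ring.
Qed.

Lemma hop_chi2 : hop (chi 2) = (2 * N%:R - 2) *: chi 1 + 3 *: chi 3 + rest5.
Proof.
apply: fsfP => n; rewrite !fsfDE !fsfZE !chiE /rest5 maskE /=.
have [n3|n4] := leqP (sq n) 3.
  rewrite hop_chi//; move: (sq n) n3 => [|[|[|[|k]]]]//= _; ring.
have [->|n5] := eqVneq (sq n) 5; first by rewrite /=; ring.
have -> : hop (chi 2) n = 0.
  (* The support bound only gives [sq n <= 6]; parity excludes the levels 4 and 6. *)
  apply/eqP; apply: contraT => h; have := near_hop (@near_chi 2) h.
  have := parity_hop (@parity_chi 2) h; move: (sq n) n4 n5 => k; lia.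
by move: (sq n) n4 n5 => [|[|[|[|k]]]]//= _ _; ring.
Qed.

Lemma ip_chi_hop k j : (k <= 3)%N -> ip (chi k) (hop (chi j)) =
  (k%:R * (k.-1 == j)%:R + 2 * (N%:R - k%:R) * (k.+1 == j)%:R
    + k%:R * (k.+3 == j)%:R) * Sum (chi k).
Proof.
move=> k3; rewrite -SumZ; apply: eq_Sum => n; rewrite fmulE fsfZE chiE mulrC.
by case: eqP => h; rewrite ?mulr0// hop_chi h.
Qed.

Lemma chi_idem k : fmul (chi k) (chi k) = chi k.
Proof. by apply: fsfP => n; rewrite fmulE chiE; case: (_ == _); rewrite /= ?mulr0 ?mulr1. Qed.

Lemma ip_chi k : ip (chi k) (chi k) = Sum (chi k).
Proof. by rewrite /ip chi_idem. Qed.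

Lemma ip_chi_neq k j : k != j -> ip (chi k) (chi j) = 0.
Proof.
move=> kj; apply: ip_disjoint => n; rewrite !chiE.
by case: eqP => [->|_]; rewrite ?mul0r// (negPf kj) mulr0.
Qed.

Lemma Sum_chi0 : Sum (chi 0) = 1.
Proof.
rewrite (@SumE _ _ [fset (0 : lattice N)]%fset).
  by rewrite big_seq_fset1 chiE sq0.
by move=> n; rewrite inE chiE sq_eq0 => /negPf ->.
Qed.

(** Double counting of the edges between two consecutive levels, using the symmetry of [hop]. The
    sizes of levels 1, 2 and 3 follow one from the other without enumerating points. *)
Lemma Sum_chi1 : Sum (chi 1) = 2 * N%:R.
Proof.
have := @ip_chi_hop 0 1 isT; have := @ip_chi_hop 1 0 isT.
rewrite ip_hop ipC Sum_chi0 /= => -> ; lra.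
Qed.

Lemma Sum_chi2 : Sum (chi 2) = 2 * N%:R * (N%:R - 1).
Proof.
have := @ip_chi_hop 1 2 isT; have := @ip_chi_hop 2 1 isT.
rewrite ip_hop ipC Sum_chi1 /= => -> ; nra.
Qed.

Lemma Sum_chi3 : Sum (chi 3) = 4 / 3 * N%:R * (N%:R - 1) * (N%:R - 2).
Proof.
have := @ip_chi_hop 2 3 isT; have := @ip_chi_hop 3 2 isT.
rewrite ip_hop ipC Sum_chi2 /= => -> h.
have : 3 * Sum (chi 3) = 2 * (N%:R - 2) * (2 * N%:R * (N%:R - 1)) by move: h; lra.
move=> h2; have -> : Sum (chi 3) = 3 * Sum (chi 3) / 3 by field.
by rewrite h2; field.
Qed.

Lemma Sum_tips : Sum tips = 2 * N%:R.
Proof.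
have -> : Sum tips = ip (chi 4) (hop (chi 1)).
  by apply: eq_Sum => n; rewrite [RHS]fmulE maskE chiE /=; case: eqP; rewrite ?mul1r ?mul0r.
by rewrite ip_hop ipC ip_chi_hop// Sum_chi1 /=; ring.
Qed.

Lemma ip_tips_tips : ip tips tips = 2 * N%:R.
Proof.
rewrite -Sum_tips; apply: eq_Sum => n; rewrite fmulE.
by case: (tips01 n) => ->; rewrite ?mulr0 ?mulr1.
Qed.

Lemma ip_rest5_le : ip rest5 rest5 <= 4 * N%:R ^+ 2.
Proof.
have -> : ip rest5 rest5 = ip (chi 5) (hop (chi 2)).
  apply: eq_Sum => n; rewrite !fmulE.
  have -> : chi 5 n * hop (chi 2) n = rest5 n.
    by rewrite maskE chiE /=; case: eqP; rewrite ?mul1r ?mul0r.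
  by case: (rest501 n) => ->; rewrite ?mulr0 ?mulr1.
rewrite ip_hop ipC ip_chi_hop// Sum_chi2 /=.
have : 0 <= N%:R :> R by []; nra.
Qed.

Lemma chi_tips k n : k != 4 -> chi k n * tips n = 0.
Proof.
move=> k4; rewrite maskE chiE /=; case: eqP => [->|]; last by rewrite mul0r.
by rewrite (negPf k4) mulr0.
Qed.

Lemma chi_rest5 k n : k != 5 -> chi k n * rest5 n = 0.
Proof.
move=> k4; rewrite maskE chiE /=; case: eqP => [->|]; last by rewrite mul0r.
by rewrite (negPf k4) mulr0.
Qed.

Lemma ip_chi1_hop_tips : ip (chi 1) (hop tips) = 2 * N%:R.
Proof.
rewrite ip_hop -ip_tips_tips; apply: eq_Sum => n; rewrite !fmulE.
by case: (pred1 _ _); rewrite ?mul1r ?mul0r ?mulr0.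
Qed.

(** A point of level 4 next to level 3 has a coordinate 1 or -1, whereas a tip has a coordinate 2 or
    -2; having both would need 4 + 1 <= 4. *)
Lemma ip_chi3_hop_tips : ip (chi 3) (hop tips) = 0.
Proof.
rewrite ip_hop; apply: ip_disjoint => n.
rewrite /tips maskE /=; case: eqP => [n4|_]; last by rewrite mulr0.
apply/eqP; rewrite mulf_eq0; apply/negPn/negP; rewrite negb_or => /andP[].
have ex j : hop (chi j) n != 0 -> exists p, sq (n + unitv p) = j.
  rewrite hopE /nsum => h.
  have /existsP[p /eqP hp] : [exists p, sq (n + unitv p) == j].
    apply: contraNT h; rewrite negb_exists => /forallP f0.
    by rewrite big1// => p _; rewrite chiE (negPf (f0 p)).
  by exists p.
move=> /ex[p hp] /ex[r hr].
have := sq_unitvD n p; have := sq_unitvD n r; rewrite hp hr n4 => h1 h2.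
have a1 : `|(n 0 r.1)%R|%N = 2%N.
  by move: h1; rewrite /sgn; case: ifP => _; move: (n 0 r.1) => x; lia.
have a2 : `|(n 0 p.1)%R|%N = 1%N.
  by move: h2; rewrite /sgn; case: ifP => _; move: (n 0 p.1) => x; lia.
have rp : p.1 != r.1 by apply/eqP => e; move: a2; rewrite e a1.
have := n4; rewrite /sq (bigD1 r.1)//= (bigD1 p.1)//= a1 a2.
by move: (\sum_(i < N | _) _)%N => x; rewrite /expn /=; lia.
Qed.

End Tables.

(** * Functions of mean zero on the unit sphere *)

Section Sphere.
Variables (R : realType) (N : nat).
Implicit Types (n m : lattice N) (f g : fsf R (lattice N)).

Lemma delta_fin m : finite_set [set n : lattice N | (n == m)%:R != 0 :> R].
Proof.
by apply: sub_finite_set (finite_set1 m) => n /=; have [->//|] := eqVneq n m; rewrite eqxx.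
Qed.

Definition delta m : fsf R (lattice N) := FSF (delta_fin m).

Lemma deltaE m n : delta m n = (n == m)%:R. Proof. by []. Qed.

Lemma Sum_delta m : Sum (delta m) = 1.
Proof.
rewrite (@SumE _ _ [fset m]%fset); first by rewrite big_seq_fset1 deltaE eqxx.
by move=> n; rewrite inE deltaE => /negPf ->.
Qed.

Lemma hop_delta m : hop (delta m) = \sum_p delta (unitv p + m).
Proof.
apply: fsfP => n; rewrite hopE fsf_sumE /nsum.
rewrite [RHS](reindex_inj (inv_inj (@flipK N))); apply: eq_bigr => p _ /=.
by rewrite unitv_flip [- _ + m]addrC [n == _]eq_sym subr_eq eq_sym.
Qed.

Lemma sphere_sum f : near 1 f -> f 0 = 0 ->
  f = \sum_p f (unitv p) *: delta (unitv p).
Proof.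
move=> nf f0; apply: fsfP => n; rewrite fsf_sumE.
have [[r ->]|ns] := pselect (exists p, n = unitv p).
  rewrite (bigD1 r)//= big1 => [|p pr].
    by rewrite addr0 eqxx mulr1.
  by rewrite (inj_eq (@unitv_inj N)) eq_sym (negPf pr) mulr0.
rewrite big1 => [|p _]; last first.
  by rewrite fsfZE deltaE; case: eqP => [h|_]; [case: ns; exists p | rewrite mulr0].
apply/eqP; apply: contraT => fn; have := nf n fn.
rewrite leq_eqVlt ltnS leqn0 sq_eq0 => /orP[/eqP/sq_eq1//|/eqP n0].
by move: fn; rewrite n0 f0 eqxx.
Qed.

Lemma Sum_sphere f : near 1 f -> f 0 = 0 -> Sum f = \sum_p f (unitv p).
Proof.
move=> nf f0; rewrite {1}(sphere_sum nf f0) Sum_sum; apply: eq_bigr => p _.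
by rewrite SumZ Sum_delta mulr1.
Qed.

Lemma hop_sphere f : near 1 f -> f 0 = 0 ->
  hop f = \sum_(i : ('I_N * bool) * ('I_N * bool))
            f (unitv i.2) *: delta (unitv i.1 + unitv i.2).
Proof.
move=> nf f0; rewrite {1}(sphere_sum nf f0).
have hop_sum (F : 'I_N * bool -> fsf R (lattice N)) : hop (\sum_p F p) = \sum_p hop (F p).
  apply: (big_morph _ (@hopD R N)).
  by have := hopZ 0 (0 : fsf R (lattice N)); rewrite !scale0r.
rewrite hop_sum; under eq_bigr do rewrite hopZ hop_delta scaler_sumr.
rewrite exchange_big pair_bigA; exact: eq_bigr.
Qed.

Lemma hop_chi_le2 n : n != 0 -> hop (chi R N 1) n <= 2.
Proof.
rewrite -sq_eq0 hop_chi1 !fsfDE !fsfZE !chiE => /negPf ->; rewrite mulr0 add0r.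
have [h|_] := eqVneq (sq n) 2%N.
  have -> : tips R N n = 0 by rewrite maskE /= h.
  by rewrite mulr1 addr0.
rewrite mulr0 add0r; case: (tips01 R n) => ->; lra.
Qed.

(* [hop f] is a sum over ordered pairs of unit vectors; symmetrizing over the
   two orders replaces the coefficient [f (unitv i.2)] by the mean of the two,
   and every nonzero [n] is reached by at most two ordered pairs. *)
Lemma nrm_hop_sphere f : near 1 f -> f 0 = 0 -> ip (chi R N 1) f = 0 ->
  ip (hop f) (hop f) <= 2 * N%:R * ip f f.
Proof.
move=> nf f0 mf.
have Sf : \sum_p f (unitv p) = 0.
  rewrite -Sum_sphere// -[RHS]mf; apply: eq_Sum => n; rewrite fmulE chiE.
  have [->|fn] := eqVneq (f n) 0; first by rewrite mulr0.
  have := nf n fn; rewrite leq_eqVlt ltnS leqn0 sq_eq0 => /orP[/eqP ->|/eqP n0].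
    by rewrite mul1r.
  by move: fn; rewrite n0 f0 eqxx.
pose a (i : ('I_N * bool) * ('I_N * bool)) := f (unitv i.1) + f (unitv i.2).
pose d (i : ('I_N * bool) * ('I_N * bool)) := delta (unitv i.1 + unitv i.2).
pose E : fsf R (lattice N) := \sum_i (a i ^+ 2 / 2) *: d i.
have hopP n : hop f n = \sum_(i | n == unitv i.1 + unitv i.2) a i / 2.
  have h1 : hop f n = \sum_(i | n == unitv i.1 + unitv i.2) f (unitv i.2).
    rewrite hop_sphere// fsf_sumE [RHS]big_mkcond; apply: eq_bigr => i _ /=.
    by case: eqP => _; rewrite ?mulr1 ?mulr0.
  have h2 : hop f n = \sum_(i | n == unitv i.1 + unitv i.2) f (unitv i.1).
    have sw : involutive (fun i : ('I_N * bool) * ('I_N * bool) => (i.2, i.1)) by case.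
    rewrite h1 (reindex_inj (inv_inj sw)) /=.
    by apply: eq_bigl => i; rewrite addrC.
  rewrite -mulr_suml big_split /= -h1 -h2. by field.
have cnt n : hop (chi R N 1) n = \sum_(i | n == unitv i.1 + unitv i.2) 1.
  have c0 : chi R N 1 0 = 0 by rewrite chiE sq0.
  rewrite (hop_sphere (@near_chi R N 1) c0) fsf_sumE [RHS]big_mkcond; apply: eq_bigr => i _.
  by rewrite fsfZE deltaE chiE sq_unitv eqxx mul1r; case: eqP.
have step n : hop f n ^+ 2 <= E n.
  have E0 : 0 <= E n.
    rewrite /E fsf_sumE; apply: sumr_ge0 => i _.
    by rewrite fsfZE deltaE mulr_ge0 ?divr_ge0 ?sqr_ge0.
  have [->|n0] := eqVneq n 0.
    (* The origin is the exception to the count: all 2 N pairs of opposite unit vectors end there.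
       The mean-zero hypothesis is what makes their contribution vanish. *)
    suff -> : hop f 0 = 0.
      rewrite expr0n; rewrite /E fsf_sumE; apply: sumr_ge0 => i _.
      by rewrite fsfZE deltaE mulr_ge0 ?divr_ge0 ?sqr_ge0.
    by rewrite hopE /nsum -[RHS]Sf; apply: eq_bigr => p _; rewrite add0r.
  rewrite hopP; apply: le_trans (weighted_cauchy_schwarz _ _ (fun=> ltr01)) _.
  rewrite -cnt; apply: le_trans (ler_wpM2r _ (hop_chi_le2 n0)) _.
    by apply: sumr_ge0 => i _; rewrite invr1 mul1r sqr_ge0.
  rewrite /E fsf_sumE mulr_sumr [leLHS]big_mkcond; apply: ler_sum => i _ /=.
  by case: eqP => _; rewrite ?mulr0 ?mulr1//; lra.
apply: (@le_trans _ _ (Sum E)).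
  by apply: le_Sum => n; rewrite fmulE -expr2.
rewrite /E Sum_sum.
have -> : ip f f = \sum_p f (unitv p) ^+ 2.
  rewrite /ip Sum_sphere.
  - by apply: eq_bigr => p _; rewrite fmulE expr2.
  - exact: near_fmul.
  - by rewrite fmulE f0 mulr0.
set T := \sum_p f (unitv p) ^+ 2.
under eq_bigr do rewrite SumZ Sum_delta mulr1.
rewrite -(pair_bigA _ (fun p r => (f (unitv p) + f (unitv r)) ^+ 2 / 2)) /=.
have cst (y : R) : \sum_(r : 'I_N * bool) y = 2 * N%:R * y.
  by rewrite sumr_const card_prod card_ord card_bool -[LHS]mulr_natl natrM [_ * 2]mulrC.
have inner p : \sum_r (f (unitv p) + f (unitv r)) ^+ 2 / 2 =
    N%:R * f (unitv p) ^+ 2 + f (unitv p) * (\sum_r f (unitv r)) + T / 2.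
  transitivity (\sum_(r : 'I_N * bool) (f (unitv p) ^+ 2 / 2 + f (unitv p) * f (unitv r)
     + f (unitv r) ^+ 2 / 2)); first by apply: eq_bigr => r _; field.
  rewrite !big_split /= cst -mulr_sumr -mulr_suml -/T; congr (_ + _ + _).
  by field.
rewrite (eq_bigr _ (fun p _ => inner p)) Sf.
under eq_bigr do rewrite mulr0 addr0.
rewrite big_split /= -mulr_sumr -/T cst le_eqVlt; apply/orP; left; apply/eqP.
by field.
Qed.

(** A point of level 4 has at most one neighbour on the unit sphere, and a unit vector exactly one
    neighbour on level 4. The bound is free of N, so in [coercive] the larger factor 4^l on this
    level is felt only at order N^(-2). *)
Lemma nrm_hop_sphere_tips f : near 1 f -> f 0 = 0 ->
  ip (mask (pred1 4) (hop f)) (mask (pred1 4) (hop f)) <= ip f f.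
Proof.
move=> nf f0.
pose F := fmul f f.
apply: (@le_trans _ _ (Sum (fmul (fun n => (sq n == 4)%:R) (hop F)))).
  apply: le_Sum => n; rewrite [leRHS]fmulE fmulE -expr2 maskE /=.
  case: eqP => [n4|_]; last by rewrite expr0n mul0r.
  rewrite mul1r !hopE /nsum.
  have -> : \sum_p f (n + unitv p) =
      \sum_(p : 'I_N * bool | sgn p * n 0 p.1 == -2) f (n + unitv p).
    rewrite [RHS]big_mkcond; apply: eq_bigr => p _; case: ifP => // h.
    apply/eqP; apply: contraFT h => fn; rewrite -(@unitv_tip _ n p 1)//.
    have := nf _ fn; rewrite leq_eqVlt ltnS leqn0 sq_eq0 => /orP[//|/eqP n0].
    by move: fn; rewrite n0 f0 eqxx.
  apply: le_trans (weighted_cauchy_schwarz _ _ (fun=> ltr01)) _.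
  have c1 : (#|fun p : ('I_N * bool) => (sgn p * n 0 p.1 == -2)%R| <= 1)%N.
    have := count_two_le n; rewrite n4 -sum1_card [X in (X <= 1)%N]big_mkcond.
    by rewrite -[X in (_ <= X)%N](muln1 4) leq_pmul2l.
  rewrite sumr_const; apply: (@le_trans _ _ (1 * \sum_(p : 'I_N * bool | sgn p * n 0 p.1 == -2) F (n + unitv p))).
    rewrite (eq_bigr (fun p => F (n + unitv p))) => [|p _]; last first.
      by rewrite invr1 mul1r fmulE expr2.
    apply: ler_wpM2r; first by apply: sumr_ge0 => p _; rewrite fmulE -expr2 sqr_ge0.
    by rewrite lern1.
  rewrite mul1r [leLHS]big_mkcond; apply: ler_sum => p _; case: ifP => // _.
  by rewrite fmulE -expr2 sqr_ge0.
rewrite Sum_hop; apply: le_Sum => n; rewrite !fmulE.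
have [->|fn] := eqVneq (f n) 0; first by rewrite !mulr0.
have n1 : sq n = 1%N.
  have := nf n fn; rewrite leq_eqVlt ltnS leqn0 sq_eq0 => /orP[/eqP//|/eqP n0].
  by move: fn; rewrite n0 f0 eqxx.
rewrite (nsum_sq (fun k => (k == 4)%:R)) n1//=.
by rewrite le_eqVlt; apply/orP; left; apply/eqP; ring.
Qed.

End Sphere.

Section Coefficients.
Variables (R : realType) (l : nat).

Definition x2 : R := 2 ^+ l.
Definition binr j : R := 'C(l, j)%:R.
(** Second-order perturbation of the eigenvalue 1 at the constant function on the sphere: 3/2 counts
    the two-step returns to the sphere through the origin and level 2, and the other term comes from
    eliminating level 2, where the unperturbed gap is 1 - 2^(-l). *)
Definition g1 : R := 3 / 2 * binr 2 - l%:R ^+ 2 * x2 / (x2 - 1).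

Lemma binr2 : binr 2 = l%:R * (l%:R - 1) / 2.
Proof.
rewrite /binr; case: l => [|k]; first by rewrite mul0r mul0r.
have := congr1 (fun n : nat => n%:R : R) (bin_ffact k.+1 2).
rewrite /= natrM !ffactnSr ffactn0 mul1n subn0 subn1 /= natrM (_ : 2`! = 2)%N// => h.
have -> : 'C(k.+1, 2)%:R = 'C(k.+1, 2)%:R * 2 / 2 :> R by field.
by rewrite h -[k.+1]addn1 natrD; field.
Qed.

Hypothesis l1 : (1 <= l)%N.

Lemma x2_ge2 : 2 <= x2.
Proof. by rewrite /x2 -(prednK l1) exprS ler_peMr// exprn_ege1// ler1n. Qed.

End Coefficients.

Lemma big_ord2 (V : nmodType) (F : nat -> V) : \sum_(j < 2) F j = F 0%N + F 1%N.
Proof. by rewrite !big_ord_recr big_ord0 /= add0r. Qed.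

Lemma big_ord3 (V : nmodType) (F : nat -> V) : \sum_(j < 3) F j = F 0%N + F 1%N + F 2%N.
Proof. by rewrite !big_ord_recr big_ord0 /= add0r. Qed.

(** Here m is the norm on the sphere, t the weighted norm off it, Y = |hop v1|^2, h = 1 / N and e =
    eps. The cross term L t b is completed to a square against ka t^2. The four eta missing in ka
    pay for the loss in H3, the 1/N terms multiplying t^2, the remainder D t m, and the eta t^2 kept
    in the conclusion. The coefficient of Y then being nonpositive, Y is replaced by its upper bound
    and [gap] decides at order h. *)
Lemma coercive_arith (R : realFieldType)
    (m t b Y q1 cr q2 x eta ka C2 C3 D L h e g g2 n : R) :
  m ^+ 2 + C2 * (h ^+ 2 / 4 * Y) - C3 * e ^+ 3 * m ^+ 2 <= q1 ->
  - (L * (t * b)) - D * e ^+ 2 * (t * m) <= cr ->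
  (x - eta) * t ^+ 2 <= q2 ->
  Y <= 2 * n * m ^+ 2 -> 0 <= Y ->
  b ^+ 2 <= h ^+ 2 / 4 * (x * Y + x ^+ 2 * m ^+ 2) ->
  0 <= m -> 0 <= t -> 0 <= b -> n * h = 1 -> e ^+ 2 = h -> 0 < e -> e <= 1 ->
  L / 4 <= - g + C2 / 2 - L ^+ 2 * x / (2 * ka) ->
  ka = x - 1 - 4 * eta -> C2 <= L ^+ 2 / 2 ->
  (C3 + D ^+ 2 / eta + `|g2| + L ^+ 2 * x ^+ 2 / (4 * ka)) * e <= L / 4 ->
  (`|g| + `|g2|) * e <= eta ->
  0 <= D -> 0 <= C3 -> 0 < eta -> 0 < ka ->
  (1 + g * h + g2 * h ^+ 2) * (t ^+ 2 + m ^+ 2) + eta * t ^+ 2 <= q2 + 2 * cr + q1.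
Proof.
move=> H1 H2 H3 Yle Y0 ble m0 t0 b0 nh e2 e0 e1 gap kE Cle sa sb D0 C30 eta0 ka0.
have A : 2 * (L * (t * b)) <= ka * t ^+ 2 + L ^+ 2 / ka * b ^+ 2.
  have : 0 <= ka^-1 * (ka * t - L * b) ^+ 2 by rewrite mulr_ge0 ?sqr_ge0 ?invr_ge0 ?ltW.
  have -> : ka^-1 * (ka * t - L * b) ^+ 2 =
      ka * t ^+ 2 + L ^+ 2 / ka * b ^+ 2 - 2 * (L * (t * b)) by field; rewrite gt_eqF.
  by rewrite subr_ge0.
have Bq : 2 * (D * e ^+ 2 * (t * m)) <= eta * t ^+ 2 + D ^+ 2 / eta * (h ^+ 2 * m ^+ 2).
  have : 0 <= eta^-1 * (eta * t - D * h * m) ^+ 2 by rewrite mulr_ge0 ?sqr_ge0 ?invr_ge0 ?ltW.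
  have -> : eta^-1 * (eta * t - D * h * m) ^+ 2 =
      eta * t ^+ 2 + D ^+ 2 / eta * (h ^+ 2 * m ^+ 2) - 2 * (D * h * (t * m)).
    by field; rewrite gt_eqF.
  by rewrite e2 subr_ge0.
have h0 : 0 < h by rewrite -e2 exprn_gt0.
have he : h <= e by rewrite -e2 expr2 ler_piMl// ltW.
have hhe : h ^+ 2 <= h * e by rewrite expr2 ler_pM2l.
have h1 : h <= 1 by exact: le_trans e1.
have hh : h ^+ 2 <= e by apply: le_trans he; rewrite expr2 ler_piMl// ltW.
have small : g * h + g2 * h ^+ 2 <= eta.
  apply: le_trans sb; rewrite mulrDl lerD//.
    apply: (@le_trans _ _ (`|g| * h)); first by rewrite ler_wpM2r ?ler_norm// ltW.
    exact: ler_wpM2l.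
  apply: (@le_trans _ _ (`|g2| * h ^+ 2)); first by rewrite ler_wpM2r ?ler_norm ?sqr_ge0.
  exact: ler_wpM2l.
have tt := sqr_ge0 t; have mm := sqr_ge0 m.
have T1 : (g * h + g2 * h ^+ 2) * t ^+ 2 <= eta * t ^+ 2 by rewrite ler_wpM2r.
have kx : ka <= x by lra.
have neg : C2 - L ^+ 2 * x / ka <= 0.
  rewrite subr_le0 (le_trans Cle)// -mulrA ler_wpM2l ?sqr_ge0//.
  have : 1 <= x / ka by rewrite ler_pdivlMr// mul1r.
  lra.
have Bb : L ^+ 2 / ka * b ^+ 2 <=
    L ^+ 2 / ka * (h ^+ 2 / 4 * (x * Y + x ^+ 2 * m ^+ 2)).
  by rewrite ler_wpM2l// divr_ge0 ?sqr_ge0// ltW.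
have YY : (C2 - L ^+ 2 * x / ka) * (h / 2 * m ^+ 2) <=
    (C2 - L ^+ 2 * x / ka) * (h ^+ 2 / 4 * Y).
  rewrite ler_wnM2l//.
  have -> : h / 2 * m ^+ 2 = h ^+ 2 / 4 * (2 * n * m ^+ 2).
    have -> : h ^+ 2 / 4 * (2 * n * m ^+ 2) = (n * h) * (h / 2 * m ^+ 2) by field.
    by rewrite nh mul1r.
  by rewrite ler_wpM2l// divr_ge0 ?sqr_ge0.
pose S := C3 + D ^+ 2 / eta + `|g2| + L ^+ 2 * x ^+ 2 / (4 * ka).
have e3 : e ^+ 3 = h * e by rewrite exprSr e2.
have M1 : 0 <= h * m ^+ 2 * (L / 4 - S * e).
  by rewrite mulr_ge0 ?subr_ge0// mulr_ge0// ltW.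
have M2 : 0 <= h * m ^+ 2 * (- g + C2 / 2 - L ^+ 2 * x / (2 * ka) - L / 4).
  by rewrite mulr_ge0 ?subr_ge0// mulr_ge0// ltW.
have K1 : 0 <= (D ^+ 2 / eta + L ^+ 2 * x ^+ 2 / (4 * ka)) * m ^+ 2 * (h * e - h ^+ 2).
  rewrite mulr_ge0 ?subr_ge0// mulr_ge0// addr_ge0// divr_ge0 ?sqr_ge0 ?(ltW eta0)//.
    by rewrite mulr_ge0 ?sqr_ge0.
  by rewrite mulr_ge0// ltW.
have K2 : g2 * h ^+ 2 * m ^+ 2 <= `|g2| * (h * e) * m ^+ 2.
  rewrite ler_wpM2r// (le_trans (ler_wpM2r (sqr_ge0 h) (ler_norm g2)))//.
  exact: ler_wpM2l.
have E1 : L ^+ 2 / ka * (h ^+ 2 / 4 * (x * Y + x ^+ 2 * m ^+ 2)) =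
    L ^+ 2 * x / ka * (h ^+ 2 / 4 * Y) + L ^+ 2 * x ^+ 2 / (4 * ka) * m ^+ 2 * h ^+ 2.
  by field; rewrite gt_eqF.
have E2 : L ^+ 2 * x / (2 * ka) = L ^+ 2 * x / ka / 2 by field; rewrite gt_eqF.
move: M1 M2 K1 K2 YY Bb A Bq T1 H1 H2 H3 neg; rewrite E1 E2 e3 /S.
move: (L ^+ 2 * x / ka) (L ^+ 2 * x ^+ 2 / (4 * ka)) (L ^+ 2 / ka * b ^+ 2) => P Q V.
rewrite kE; move: (D ^+ 2 / eta) `|g2| (L * (t * b)) (D * e ^+ 2 * (t * m)) => DD gg tb tm.
clear; lra.
Qed.

(** The strict gap at order 1/N between mean-zero and constant functions on the sphere absorbs any
    term of order N^(-2), whatever [g2] is. *)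
Lemma coercive (R : realType) (l : nat) (g2 : R) : (1 <= l)%N ->
  exists c : R, 0 < c /\ exists N0 : nat, (0 < N0)%N /\
  forall N (v : fsf R (lattice N)), (N0 <= N)%N -> v 0 = 0 -> ip (chi R N 1) v = 0 ->
    (1 + g1 R l / N%:R + g2 / N%:R ^+ 2) * wip l v v +
      c * wip l (mask (fun k => (2 <= k)%N) v) (mask (fun k => (2 <= k)%N) v)
    <= ip v (iter l G v).
Proof.
move=> l1; have xge := x2_ge2 R l1.
set x := x2 R l in xge *; pose C2 := binr R l 2.
have lr1 : 1 <= l%:R :> R by rewrite ler1n.
pose L : R := l%:R.
have L1 : 1 <= L by [].
(* With 1 - th = 2 L / (2 L + 1) the elimination term L^2 x / (2 ka) equals L (2 L + 1) x / (4 (x -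
   1)); the gap, above L / 2 for th = 0, stays at least L / 4. *)
pose th := (2 * L + 1)^-1; pose ka := (x - 1) * (1 - th).
pose eta := (x - 1) * th / 4.
have th0 : 0 < th by rewrite invr_gt0; lra.
have th1 : th <= 3^-1 by rewrite lef_pV2 ?posrE; lra.
have eta0 : 0 < eta by rewrite /eta !mulr_gt0//; lra.
have ka0 : 0 < ka by rewrite /ka mulr_gt0//; lra.
have kE : ka = x - 1 - 4 * eta by rewrite /ka /eta; field.
have etax : eta <= 2 ^+ l by rewrite -/(x2 R l) -/x; lra.
have [N1 [N10 coer]] := coercive_off_sphere eta0 etax.
(* On the sphere the error must be o(1/N), hence three Taylor terms. In the cross term an error
   O(1/N) is enough, since completing the square turns it into O(N^(-2)). *)
have [C3 [C30 [K3 [K30 tay3]]]] := iterG_taylor R l 3 1.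
have [D2 [D20 [K2 [K20 tay2]]]] := iterG_taylor R l 2 1.
pose D := K2%:R ^+ l * D2.
have D0 : 0 <= D by rewrite mulr_ge0 ?exprn_ge0.
pose g1' := g1 R l.
pose cc := C3 + D ^+ 2 / eta + `|g2| + L ^+ 2 * x ^+ 2 / (4 * ka).
have cc0 : 0 <= cc.
  have a1 : 0 <= D ^+ 2 / eta by rewrite divr_ge0 ?sqr_ge0 ?ltW.
  have a2 : 0 <= L ^+ 2 * x ^+ 2 / (4 * ka).
    by rewrite divr_ge0 ?mulr_ge0 ?sqr_ge0//; lra.
  by rewrite /cc !addr_ge0.
have L40 : 0 < L / 4 by lra.
have [Na hNa] := eps_small cc0 L40.
have [Nb hNb] := @eps_small R (`|g1'| + `|g2|) eta (addr_ge0 (normr_ge0 _) (normr_ge0 _)) eta0.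
exists eta; split=> //; exists (N1 + Na + Nb)%N; split=> [|N v NN v0 mv]; first by rewrite !addn_gt0 N10.
have [NN1 NNa NNb] : [/\ (N1 <= N)%N, (Na <= N)%N & (Nb <= N)%N].
  by clear -NN; split; lia.
have [N0 smalla] := hNa N NNa; have [_ smallb] := hNb N NNb.
set w := mask _ v; pose v1 := mask (predC (fun k => (2 <= k)%N)) v.
have vs : v = w + v1 by exact: mask_split.
have v1P n : v1 n != 0 -> sq n = 1%N.
  rewrite maskE /= -ltnNge ltnS; case: ifP => [|_]; last by rewrite eqxx.
  rewrite leq_eqVlt ltnS leqn0 sq_eq0 => /orP[/eqP//|/eqP ->].
  by rewrite v0 eqxx.
have nv1 : near 1 v1 by move=> n /v1P ->.
have v10 : v1 0 = 0 by rewrite maskE v0 if_same.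
have w0 : w 0 = 0 by rewrite maskE v0 if_same.
have w2 n : w n != 0 -> (2 <= sq n)%N by rewrite maskE; case: ifP => //; rewrite eqxx.
have wv1 n : w n * v1 n = 0.
  rewrite !maskE /=; by case: (_ <= _)%N; rewrite ?mulr0 ?mul0r.
clearbody w v1.
have mv1 : ip (chi R N 1) v1 = 0.
  rewrite -mv vs ipDr (_ : ip _ w = 0) ?add0r//; apply: ip_disjoint => n.
  rewrite chiE; have [->|/w2 h] := eqVneq (w n) 0; first by rewrite mulr0.
  by case: eqP h => [->|]; rewrite ?mul0r.
have pv1 : parity true v1 by move=> n /v1P ->.
have [r3 [G3 nr3 r3n]] := tay3 N v1 N0 nv1.
have [r2 [G2 nr2 r2n]] := tay2 N v1 N0 nv1.
have NR : 0 < N%:R :> R by rewrite ltr0n.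
set h : R := N%:R^-1.
have h0 : 0 < h by rewrite invr_gt0.
have e0 := eps_gt0 R N0; have e1 := eps_le1 R N0; have e2 := eps_sqr R N.
set e := eps R N in smalla smallb e0 e1 e2 r3n r2n; rewrite -/h in e2.
pose m := nrm v1; pose t := wnrm l w.
have m0 : 0 <= m := nrm_ge0 _; have t0 : 0 <= t := wnrm_ge0 _ _.
pose Y := ip (hop v1) (hop v1).
have Yle : Y <= 2 * N%:R * m ^+ 2 by rewrite /m nrm_sqr nrm_hop_sphere.
have Y0 : 0 <= Y := ip_ge0 _.
have q11 : m ^+ 2 + C2 * (h ^+ 2 / 4 * Y) - C3 * e ^+ 3 * m ^+ 2 <= ip v1 (iter l G v1).
  rewrite G3 (big_ord3 (fun j => binc R l j *: iter j B v1)) /= !ipDr (ipZr _ v1 v1) (ipZr _ v1 (B v1)) (ipZr _ v1 (B (B v1))).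
  rewrite binc0 mul1r.
  have -> : ip v1 (B v1) = 0 by apply: ip_parity pv1 (parity_B pv1).
  have -> : ip v1 (B (B v1)) = h ^+ 2 / 4 * Y.
    by rewrite ip_B /B ipZl ipZr mulrA /h; congr (_ * _); field; rewrite gt_eqF.
  have -> : binc R l 2 = C2.
    by rewrite /binc sqrrN expr1n mul1r.
  rewrite mulr0 addr0 -nrm_sqr -/m -[leRHS]addrA -addrA lerD2l lerD2l.
  have := cauchy_schwarz v1 r3; rewrite ler_norml => /andP[a _].
  have : nrm v1 * nrm r3 <= C3 * e ^+ 3 * m ^+ 2.
    by apply: le_trans (ler_wpM2l m0 r3n) _; rewrite -/m expr2 mulrCA mulrA.
  lra.
pose b := nrm (fmul (sroot R l) (B v1)).
have b0 : 0 <= b := nrm_ge0 _.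
have ble : b ^+ 2 <= h ^+ 2 / 4 * (x * Y + x ^+ 2 * m ^+ 2).
  rewrite nrm_sqr /m nrm_sqr.
  have ht := nrm_hop_sphere_tips nv1 v10.
  have c4 : 0 <= h ^+ 2 / 4 by rewrite divr_ge0 ?sqr_ge0.
  apply: (@le_trans _ _ (h ^+ 2 / 4 * (x * Y + x ^+ 2 *
    ip (mask (pred1 4) (hop v1)) (mask (pred1 4) (hop v1))))); last first.
    by rewrite ler_wpM2l// lerD2l ler_wpM2l// sqr_ge0.
  rewrite -ipZr -ipZr -SumD -SumZ; apply: le_Sum => n.
  rewrite fmulE /B fmulE fsfZE fsfZE fsfDE [fmul (hop v1) _ n]fmulE fsfZE.
  rewrite [fmul (mask _ _) _ n]fmulE fsfZE maskE /=.
  have [->|hn] := eqVneq (hop v1 n) 0.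
    by rewrite if_same !(mulr0, mul0r) addr0 mulr0.
  have -> : sroot R l n * ((2 * N%:R)^-1 * hop v1 n) * (sroot R l n * ((2 * N%:R)^-1 * hop v1 n))
     = h ^+ 2 / 4 * (sroot R l n ^+ 2 * hop v1 n ^+ 2).
    by rewrite /h; field; rewrite gt_eqF.
  rewrite sroot_sqr ler_wpM2l//.
  have hh := sqr_ge0 (hop v1 n); have x0 : 0 <= x by lra.
  (* Radius and parity leave only the levels 0, 2 and 4, where |n|^(2 l) is 0 (as l >= 1), x and
     x^2. *)
  have := near_hop nv1 hn; have := parity_hop pv1 hn.
  case: eqP => [->|n4] /= par n5.
    have -> : (4 : nat)%:R ^+ l = x ^+ 2 :> R.
      by rewrite /x /x2 -exprM mulnC exprM expr2 -natrM.
    have : 0 <= x * hop v1 n ^+ 2 by rewrite mulr_ge0.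
    by clear; move: (hop v1 n) x => H y; lra.
  have xH : 0 <= x * hop v1 n ^+ 2 by rewrite mulr_ge0.
  rewrite !mulr0 addr0.
  have -> : hop v1 n * (x * hop v1 n) = x * hop v1 n ^+ 2 by rewrite expr2 mulrCA.
  have [->|n0] := eqVneq (sq n) 0%N.
    by rewrite expr0n (_ : (l == 0)%N = false) ?mul0r// eqn0Ngt l1.
  have -> : sq n = 2%N by clear -par n5 n4 n0; move: (sq n) par n5 n4 n0 => k; lia.
  exact: lexx.
have cross : - (L * (t * b)) - D * e ^+ 2 * (t * m) <= ip w (iter l G v1).
  rewrite G2 (big_ord2 (fun j => binc R l j *: iter j B v1)) /= !ipDr.
  rewrite (ipZr _ w v1) (ipZr _ w (B v1)) (ip_disjoint wv1) mulr0 add0r.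
  have -> : binc R l 1 = - L by rewrite /binc bin1 expr1 mulN1r.
  have a1 : `|ip w (B v1)| <= t * b by exact: weighted_cs.
  have a2 : `|ip w r2| <= D * e ^+ 2 * (t * m).
    apply: le_trans (weighted_cs l r2 w0) _.
    have -> : D * e ^+ 2 * (t * m) = t * (K2%:R ^+ l * (D2 * e ^+ 2 * m)).
      by rewrite /D; ring.
    rewrite ler_wpM2l// (le_trans (nrm_sroot_near l K20 nr2))// ler_wpM2l//.
    by rewrite exprn_ge0.
  move: a1 a2; rewrite !ler_norml => /andP[_ a1] /andP[a2 _].
  have := ler_wpM2l (le_trans ler01 L1) a1; lra.
have q22 : (x - eta) * t ^+ 2 <= ip w (iter l G w).
  by rewrite wnrm_sqr; exact: coer.
have qv : ip v (iter l G v) =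
    ip w (iter l G w) + 2 * ip w (iter l G v1) + ip v1 (iter l G v1).
  rewrite [in LHS]vs iterGD !(ipDl _ _ (_ + _), ipDr).
  by rewrite [ip v1 (iter l G w)]ip_iterG [ip (iter l G v1) w]ipC; ring.
have wv : wip l v v = t ^+ 2 + m ^+ 2.
  rewrite vs wipDl !wipDr (wipC l v1 w) (wip_disjoint l wv1) addr0 add0r.
  rewrite wnrm_sqr nrm_sqr; congr (_ + _); apply: eq_Sum => n; rewrite !fmulE.
  have [->|/v1P n1] := eqVneq (v1 n) 0; first by rewrite !mulr0.
  by rewrite /wt n1 invr1 expr1n mul1r.
rewrite qv wv -wnrm_sqr -/t.
have Nh : N%:R * h = 1 by rewrite mulfV// gt_eqF.
have -> : g2 / N%:R ^+ 2 = g2 * h ^+ 2 by rewrite exprVn.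
rewrite -/h.
move: q11 cross q22 Yle Y0 ble m0 t0 b0 smalla smallb; rewrite -/x.
have Cle : C2 <= L ^+ 2 / 2.
  rewrite /C2 binr2 -/L; clear -L1; nra.
have gap : L / 4 <= - g1' + C2 / 2 - L ^+ 2 * x / (2 * ka).
  rewrite /g1' /g1 -/x -/C2 -/L.
  have -> : - (3 / 2 * C2 - L ^+ 2 * x / (x - 1)) + C2 / 2 - L ^+ 2 * x / (2 * ka) =
    L * (2 * L - 1) / 4 * (1 + (x - 1)^-1) - C2.
    by rewrite /ka /th; field; apply/and3P; split; rewrite gt_eqF//; lra.
  have : 0 <= L * (2 * L - 1) / 4 * (x - 1)^-1.
    by rewrite mulr_ge0 ?invr_ge0//; [rewrite divr_ge0// mulr_ge0; lra | lra].
  by rewrite /C2 binr2 -/L; move: (x - 1)^-1 => z; clear; lra.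
move=> q11 cross q22 Yle Y0 ble m0 t0 b0 smalla smallb.
exact: (@coercive_arith R) q11 cross q22 Yle Y0 ble m0 t0 b0 Nh e2 e0 e1 gap kE Cle
  smalla smallb D0 C30 eta0 ka0.
Qed.

(** * Asymptotic calculus in powers of N^(-1/2) *)

Section BigO.
Variable R : realType.
Implicit Types (u v : nat -> R).

(* [bO k u] stands for u N = O(N ^ (- k / 2)). *)
Definition bO k u := exists C : R, 0 <= C /\
  forall N, (0 < N)%N -> `|u N| <= C * eps R N ^+ k.

Lemma bO_ext k u v : (forall N, (0 < N)%N -> u N = v N) -> bO k v -> bO k u.
Proof. by move=> uv [C [C0 h]]; exists C; split=> // N N0; rewrite uv ?h. Qed.

Lemma bOD k u v : bO k u -> bO k v -> bO k (fun N => u N + v N).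
Proof.
move=> [C [C0 h]] [D [D0 g]]; exists (C + D); split; first by rewrite addr_ge0.
move=> N N0; rewrite mulrDl; apply: le_trans (ler_normD _ _) _.
by rewrite lerD ?h ?g.
Qed.

Lemma bON k u : bO k u -> bO k (fun N => - u N).
Proof. by move=> [C [C0 h]]; exists C; split=> // N N0; rewrite normrN h. Qed.

Lemma bOB k u v : bO k u -> bO k v -> bO k (fun N => u N - v N).
Proof. by move=> hu /bON; exact: bOD. Qed.

Lemma bOM j k u v : bO j u -> bO k v -> bO (j + k) (fun N => u N * v N).
Proof.
move=> [C [C0 h]] [D [D0 g]]; exists (C * D); split; first by rewrite mulr_ge0.
move=> N N0; rewrite exprD mulrACA normrM.
by apply: ler_pM; rewrite ?normr_ge0 ?h ?g.
Qed.

Lemma bO_cst c : bO 0 (fun=> c).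
Proof. by exists `|c|; split=> // N N0; rewrite expr0 mulr1. Qed.

Lemma bO_cstM k c u : bO k u -> bO k (fun N => c * u N).
Proof. exact: (bOM (bO_cst c)). Qed.

Lemma bO_le j k u : (j <= k)%N -> bO k u -> bO j u.
Proof.
move=> jk [C [C0 h]]; exists C; split=> // N N0; apply: (le_trans (h N N0)).
by rewrite ler_wpM2l// ler_wiXn2l ?eps_le1 ?ltW ?eps_gt0.
Qed.

Lemma bO_inv : bO 2 (fun N => N%:R^-1).
Proof.
exists 1; split=> // N N0; rewrite mul1r eps_sqr ger0_norm ?invr_ge0//.
Qed.

Lemma bO_invX k : bO (k * 2) (fun N => N%:R^-1 ^+ k).
Proof.
exists 1; split=> // N N0; rewrite mul1r mulnC exprM eps_sqr ger0_norm//.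
by rewrite exprn_ge0 ?invr_ge0.
Qed.

Lemma bO_bound k u v : (forall N, (0 < N)%N -> `|u N| <= v N) -> bO k v -> bO k u.
Proof.
move=> uv [C [C0 h]]; exists C; split=> // N N0; apply: le_trans (h N N0).
exact: le_trans (uv N N0) (ler_norm _).
Qed.

Definition nu (N : nat) : R := Num.sqrt (2 * N%:R).

Lemma nu_sqr N : nu N ^+ 2 = 2 * N%:R.
Proof. by rewrite sqr_sqrtr// mulr_ge0. Qed.

Lemma nu_ge0 N : 0 <= nu N. Proof. exact: sqrtr_ge0. Qed.

(* The norm is measured in units of [nu N], the norm of the indicator function
   of the unit sphere. *)
Definition vO k (F : forall N, fsf R (lattice N)) := exists K : nat, exists C : R,
  0 <= C /\ forall N, (0 < N)%N -> near K (F N) /\ nrm (F N) <= C * eps R N ^+ k * nu N.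

Lemma vO_ext k (F F' : forall N, fsf R (lattice N)) :
  (forall N, (0 < N)%N -> F N = F' N) -> vO k F' -> vO k F.
Proof.
by move=> FF [K [C [C0 h]]]; exists K, C; split=> // N N0; rewrite FF//; exact: h.
Qed.

Lemma vOD k (F F' : forall N, fsf R (lattice N)) :
  vO k F -> vO k F' -> vO k (fun N => F N + F' N).
Proof.
move=> [K [C [C0 h]]] [K' [C' [C'0 h']]].
exists (K + K')%N, (C + C'); split=> [|N N0]; first by rewrite addr_ge0.
have [a1 a2] := h N N0; have [b1 b2] := h' N N0; split.
  by apply: nearD; [apply: near_le a1|apply: near_le b1]; rewrite ?leq_addr ?leq_addl.
by apply: (le_trans (nrmD _ _)); rewrite !mulrDl lerD.
Qed.

Lemma vOZ j k u (F : forall N, fsf R (lattice N)) :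
  bO j u -> vO k F -> vO (j + k) (fun N => u N *: F N).
Proof.
move=> [D [D0 g]] [K [C [C0 h]]]; exists K, (D * C); split=> [|N N0].
  by rewrite mulr_ge0.
have [a1 a2] := h N N0; split; first exact: nearZ.
rewrite nrmZ exprD mulrACA -[leRHS]mulrA.
exact: ler_pM (normr_ge0 _) (nrm_ge0 _) (g _ N0) a2.
Qed.

Lemma vO_le j k (F : forall N, fsf R (lattice N)) : (j <= k)%N -> vO k F -> vO j F.
Proof.
move=> jk [K [C [C0 h]]]; exists K, C; split=> // N N0; have [a1 a2] := h N N0.
split=> //; apply: (le_trans a2).
by rewrite ler_wpM2r ?nu_ge0// ler_wpM2l// ler_wiXn2l ?eps_le1 ?ltW ?eps_gt0.
Qed.

Lemma vO_iterB j k (F : forall N, fsf R (lattice N)) :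
  vO k F -> vO (j + k) (fun N => iter j B (F N)).
Proof.
move=> [K [C [C0 h]]]; have [D [D0 [K' g]]] := iterB_near R j K.
exists K', (D * C); split=> [|N N0]; first by rewrite mulr_ge0.
have [a1 a2] := h N N0; have [b1 b2] := g N _ N0 a1; split=> //.
apply: (le_trans b2); rewrite exprD mulrACA -[leRHS]mulrA ler_wpM2l//.
by rewrite mulr_ge0// exprn_ge0// ltW// eps_gt0.
Qed.

Lemma vO_mask k P (F : forall N, fsf R (lattice N)) :
  vO k F -> vO k (fun N => mask P (F N)).
Proof.
move=> [K [C [C0 h]]]; exists K, C; split=> // N N0; have [a1 a2] := h N N0.
by split; [exact: near_mask | exact: le_trans (nrm_mask _ _) a2].
Qed.

Lemma bO_ip j k (F F' : forall N, fsf R (lattice N)) :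
  vO j F -> vO k F' -> bO (j + k) (fun N => ip (F N) (F' N) / (2 * N%:R)).
Proof.
move=> [K [C [C0 h]]] [K' [C' [C'0 h']]]; exists (C * C'); split=> [|N N0].
  by rewrite mulr_ge0.
have [_ a] := h N N0; have [_ b] := h' N N0.
have N2 : 0 < 2 * N%:R :> R by rewrite mulr_gt0// ltr0n.
rewrite normrM normfV (gtr0_norm N2) ler_pdivrMr//.
apply: (le_trans (cauchy_schwarz _ _)).
apply: (le_trans (ler_pM (nrm_ge0 _) (nrm_ge0 _) a b)).
by rewrite le_eqVlt -nu_sqr exprD; apply/orP; left; apply/eqP; ring.
Qed.

End BigO.

(** * Closed walks *)

Lemma natr_dichotomy (R : realType) (k : nat) : k%:R = 0 :> R \/ 1 <= k%:R :> R.
Proof. by case: k => [|k]; [left | right; rewrite ler1n]. Qed.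

Section Walks.
Variables (R : realType) (N : nat).
Local Notation chi := (chi R N).
Local Notation tips := (tips R N).
Local Notation rest5 := (rest5 R N).
Local Notation n := (N%:R : R).

(** Only the orders of these walk counts matter: w22 is 20 N^3 + O(N^2), while w24 and w44 are
    O(N^2) and drop out of the energy at the order kept. *)
Definition w22 : R := ip (hop (chi 2)) (hop (chi 2)).
Definition w24 : R := ip (hop (chi 2)) (hop tips).
Definition w44 : R := ip (hop tips) (hop tips).

Lemma hop_chi0 : hop (chi 0) = chi 1.
Proof.
apply: fsfP => m; have [m3|m4] := leqP (sq m) 3.
  rewrite hop_chi// chiE; move: (sq m) m3 => [|[|[|[|k]]]]//= _; ring.
have -> : hop (chi 0) m = 0.
  apply/eqP; apply: contraT => /(near_hop (@near_chi R N 0)) h.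
  by move: m4 h; clear; move: (sq m) => k; lia.
by rewrite chiE; move: (sq m) m4 => [|[|k]].
Qed.

Lemma hop_hop_chi1 : hop (hop (chi 1)) = (2 * n) *: chi 1 + 2 *: hop (chi 2) + hop tips.
Proof. by rewrite {1}hop_chi1 !hopD !hopZ hop_chi0. Qed.

Lemma near_tips : near 4 tips.
Proof. exact: near_mask (near_hop (@near_chi R N 1)). Qed.

Lemma parity_tips : parity false tips.
Proof. exact: parity_mask (parity_hop (@parity_chi R N 1)). Qed.

Lemma ip_chi_tips k : k != 4%N -> ip (chi k) tips = 0.
Proof. by move=> k4; apply: ip_disjoint => m; exact: chi_tips. Qed.

Lemma ip_hop11 : ip (hop (chi 1)) (hop (chi 1)) = 12 * n ^+ 2 - 6 * n.
Proof.
rewrite hop_chi1 !(ipDl, ipDr) !(ipZl, ipZr) !ip_chi Sum_chi0 Sum_chi2.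
rewrite ip_tips_tips !(ipC tips) !ip_chi_tips// !ip_chi_neq//; ring.
Qed.

Lemma ip_chi1_hop_chi2 : ip (chi 1) (hop (chi 2)) = 4 * n * (n - 1).
Proof. rewrite ip_chi_hop// Sum_chi1 /=; ring. Qed.

Lemma ip_chi2_hop_chi3 : ip (chi 2) (hop (chi 3)) = 4 * n * (n - 1) * (n - 2).
Proof. rewrite ip_chi_hop// Sum_chi2 /=; ring. Qed.

Lemma ip_hop13 : ip (hop (chi 1)) (hop (chi 3)) = 8 * n * (n - 1) * (n - 2).
Proof.
rewrite ip_hop hop_hop_chi1 !(ipDl, ipZl) ip_chi_neq// -ip_hop ip_chi2_hop_chi3.
by rewrite ipC ip_chi3_hop_tips; ring.
Qed.

Lemma w22_bound : `|w22 - 20 * n ^+ 3| <= 52 * n ^+ 2.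
Proof.
have -> : w22 = (2 * n - 2) ^+ 2 * (2 * n) + 12 * n * (n - 1) * (n - 2) + ip rest5 rest5.
  rewrite /w22 hop_chi2 !(ipDl, ipDr) !(ipZl, ipZr) !ip_chi Sum_chi1 Sum_chi3.
  have r k : k != 5%N -> ip (chi k) rest5 = 0.
    by move=> k4; apply: ip_disjoint => m; exact: chi_rest5.
  rewrite !(ipC rest5 (chi _)) !r// !ip_chi_neq//; by field.
have := ip_rest5_le R N; have := ip_ge0 rest5; move: (ip _ _) => z z0 z1.
move: (natr_dichotomy R N); move: z0 z1; clear; move: (N%:R) => k z0 z1 [k0|k1].
  by move: z1; rewrite k0 => z1; rewrite ler_norml; apply/andP; split; lra.
rewrite ler_norml; apply/andP; split; nra.
Qed.

Lemma w44_bound : 0 <= w44 <= 288 * n ^+ 2.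
Proof.
rewrite ip_ge0 /=; have [N0|N0] := posnP N.
  have t0 : tips = 0 by apply: ip_eq0; rewrite ip_tips_tips N0 mulr0.
  by rewrite /w44 t0 -(scale0r 0) hopZ !scale0r ip0r mulr_ge0 ?sqr_ge0.
have := nrm_hop N0 near_tips => h.
have := ler_pM (nrm_ge0 _) (nrm_ge0 _) h h.
rewrite -!expr2 !exprMn !nrm_sqr ip_tips_tips sqr_sqrtr// => {}h.
apply: (le_trans h); rewrite le_eqVlt; apply/orP; left; apply/eqP; ring.
Qed.

Lemma w24_bound : `|w24| <= 44 * n ^+ 2.
Proof.
have /andP[_ b44] := w44_bound.
have -> : w24 = (2 * n - 2) * (2 * n) + ip rest5 (hop tips).
  rewrite /w24 hop_chi2 !(ipDl, ipZl) ip_chi1_hop_tips ip_chi3_hop_tips; ring.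
have r5 := ip_rest5_le R N.
have cs := cauchy_schwarz_sqr rest5 (hop tips).
have : `|ip rest5 (hop tips)| <= 40 * n ^+ 2.
  have p0 : 0 <= 40 * n ^+ 2 by rewrite mulr_ge0 ?sqr_ge0.
  rewrite -[leLHS]ger0_norm ?normr_ge0// -sqrtr_sqr -[leRHS]ger0_norm// -[leRHS]sqrtr_sqr.
  rewrite ler_sqrt ?sqr_ge0// real_normK ?num_real//; apply: (le_trans cs).
  apply: (le_trans (ler_pM (ip_ge0 _) (ip_ge0 _) r5 b44)).
  have : 0 <= n ^+ 4 by rewrite exprn_ge0.
  by clear; move: (N%:R : R) => z; lra.
move=> h; apply: (le_trans (ler_normD _ _)).
have [k0|n1] := natr_dichotomy R N.
  by move: h; rewrite k0 !(mulr0, expr0n) /= normr0 add0r.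
have : 0 <= (2 * n - 2) * (2 * n) by rewrite mulr_ge0//; lra.
by move=> p; rewrite (ger0_norm p); nra.
Qed.

Lemma ip_hophop1_hop2 : ip (hop (hop (chi 1))) (hop (chi 2)) =
  8 * n ^+ 2 * (n - 1) + 2 * w22 + w24.
Proof.
rewrite hop_hop_chi1 !(ipDl, ipZl) ip_chi1_hop_chi2 -/w22 [ip (hop tips) _]ipC -/w24; ring.
Qed.

Lemma ip_hophop1_hop_tips : ip (hop (hop (chi 1))) (hop tips) =
  4 * n ^+ 2 + 2 * w24 + w44.
Proof.
rewrite {1}hop_hop_chi1 !(ipDl, ipZl) ip_chi1_hop_tips -/w24 -/w44; ring.
Qed.

Lemma ip_hophop1 : ip (hop (hop (chi 1))) (hop (hop (chi 1))) =
  8 * n ^+ 3 + 32 * n ^+ 2 * (n - 1) + 8 * n ^+ 2 + 4 * w22 + 4 * w24 + w44.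
Proof.
rewrite {2}hop_hop_chi1 !(ipDr, ipZr) ip_hophop1_hop2 ip_hophop1_hop_tips.
by rewrite -(ip_hop (hop (chi 1)) (chi 1)) ip_hop11; ring.
Qed.

End Walks.

(** * The energy of the trial function *)

Section Form.
Variables (R : realType) (N : nat).
Implicit Types f g k : fsf R (lattice N).

Definition form j f g : R := ip f (iter j B g).

Lemma formC j f g : form j f g = form j g f.
Proof. by rewrite /form ip_iterB ipC. Qed.

Lemma formDr j f g k : form j f (g + k) = form j f g + form j f k.
Proof. by rewrite /form iterBD ipDr. Qed.

Lemma formDl j f g k : form j (f + g) k = form j f k + form j g k.
Proof. by rewrite formC formDr !(formC j k). Qed.

Lemma form_parity j p q f g : parity p f -> parity q g -> p (+) q (+) odd j ->
  form j f g = 0.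
Proof.
move=> pf pg pq; apply: ip_parity pf _; have := parity_iterB (j := j) pg.
by move: pq; clear; case: p; case: q; case: (odd j).
Qed.

End Form.

Section Trial.
Variables (R : realType) (b c d : R).

Definition t1 N : fsf R (lattice N) := chi R N 1.
Definition t2 N : fsf R (lattice N) := (b * N%:R^-1) *: chi R N 2.
Definition t3 N : fsf R (lattice N) := (c * N%:R^-1 ^+ 2) *: chi R N 3.
Definition t4 N : fsf R (lattice N) := (d * N%:R^-1) *: tips R N.
(** Grouped by parity: levels 1 and 3 are odd, levels 2 and 4 even. In units of [nu] the summands
    t1, t2, t3, t4 have sizes 1, eps, eps^2, eps^2. *)
Definition trial N : fsf R (lattice N) := t1 N + t3 N + (t2 N + t4 N).

Lemma vO_t1 : vO 0 t1.
Proof.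
exists 1%N, 1; split=> // N N0; split; first exact: near_chi.
rewrite expr0 !mul1r; apply: nrm_le; first exact: nu_ge0.
by rewrite ip_chi Sum_chi1 nu_sqr.
Qed.

Lemma vO_inv_chi2 : vO 1 (fun N => N%:R^-1 *: chi R N 2).
Proof.
exists 2%N, 1; split=> // N N0; split; first exact/nearZ/near_chi.
rewrite expr1 !mul1r; apply: nrm_le; first by rewrite mulr_ge0 ?nu_ge0// ltW ?eps_gt0.
rewrite exprMn nu_sqr eps_sqr ipZl ipZr ip_chi Sum_chi2.
have n1 : 1 <= N%:R :> R by rewrite ler1n.
have -> : N%:R^-1 * (N%:R^-1 * (2 * N%:R * (N%:R - 1))) =
  N%:R^-1 * (2 * (N%:R - 1)) :> R by field; rewrite gt_eqF; lra.
by rewrite ler_wpM2l ?invr_ge0//; lra.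
Qed.

Lemma vO_inv_chi3 : vO 2 (fun N => N%:R^-1 ^+ 2 *: chi R N 3).
Proof.
exists 3%N, 1; split=> // N N0; split; first exact/nearZ/near_chi.
rewrite !mul1r; apply: nrm_le; first by rewrite mulr_ge0 ?nu_ge0// exprn_ge0// ltW ?eps_gt0.
rewrite exprMn nu_sqr eps_sqr ipZl ipZr ip_chi Sum_chi3.
have n1 : 1 <= N%:R :> R by rewrite ler1n.
have -> : N%:R^-1 ^+ 2 * (N%:R^-1 ^+ 2 * (4 / 3 * N%:R * (N%:R - 1) * (N%:R - 2))) =
  N%:R^-1 ^+ 2 * (4 / 3 * (N%:R^-1 * ((N%:R - 1) * (N%:R - 2)))) :> R.
  by field; rewrite gt_eqF; lra.
rewrite ler_wpM2l ?exprn_ge0 ?invr_ge0//.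
have : N%:R^-1 * ((N%:R - 1) * (N%:R - 2)) <= N%:R :> R.
  by rewrite ler_pdivrMl; [nra | lra].
by lra.
Qed.

Lemma vO_inv_tips : vO 2 (fun N => N%:R^-1 *: tips R N).
Proof.
exists 4%N, 1; split=> // N N0; split; first exact/nearZ/near_tips.
rewrite !mul1r; apply: nrm_le; first by rewrite mulr_ge0 ?nu_ge0// exprn_ge0// ltW ?eps_gt0.
by rewrite exprMn nu_sqr eps_sqr ipZl ipZr ip_tips_tips mulrA expr2.
Qed.

Lemma vO_t2 : vO 1 t2.
Proof.
apply: (@vO_ext _ _ _ (fun N => b *: (N%:R^-1 *: chi R N 2))) => [N _|].
  by rewrite scalerA.
exact: (vOZ (bO_cst b) vO_inv_chi2).
Qed.

Lemma vO_t3 : vO 2 t3.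
Proof.
apply: (@vO_ext _ _ _ (fun N => c *: (N%:R^-1 ^+ 2 *: chi R N 3))) => [N _|].
  by rewrite scalerA.
exact: (vOZ (bO_cst c) vO_inv_chi3).
Qed.

Lemma vO_t4 : vO 2 t4.
Proof.
apply: (@vO_ext _ _ _ (fun N => d *: (N%:R^-1 *: tips R N))) => [N _|].
  by rewrite scalerA.
exact: (vOZ (bO_cst d) vO_inv_tips).
Qed.

Lemma vO_trial : vO 0 trial.
Proof.
by apply: vOD; apply: vOD; [exact: vO_t1 | exact: vO_le vO_t3 | exact: vO_le vO_t2
  | exact: vO_le vO_t4].
Qed.

Definition pair j (F F' : forall N, fsf R (lattice N)) N : R :=
  form j (F N) (F' N) / (2 * N%:R).

Lemma bO_pair i j k (F F' : forall N, fsf R (lattice N)) :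
  vO i F -> vO k F' -> bO (i + (j + k)) (pair j F F').
Proof. by move=> vF vF'; apply: bO_ip => //; exact: vO_iterB. Qed.

Lemma parity_t1 N : parity true (t1 N). Proof. exact: parity_chi. Qed.
Lemma parity_t2 N : parity false (t2 N). Proof. exact/parityZ/parity_chi. Qed.
Lemma parity_t3 N : parity true (t3 N). Proof. exact/parityZ/parity_chi. Qed.
Lemma parity_t4 N : parity false (t4 N). Proof. exact/parityZ/parity_tips. Qed.

(** B reverses the parity of the level, so an even power pairs only summands of equal parity, and an
    odd power only those of opposite parity. *)
Lemma pair_trial_even j N : ~~ odd j -> pair j trial trial N =
  pair j t1 t1 N + pair j t2 t2 N + 2 * pair j t1 t3 N + 2 * pair j t2 t4 N
  + (pair j t3 t3 N + pair j t4 t4 N).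
Proof.
move=> jo; rewrite /pair /trial !(formDl, formDr).
rewrite (formC j (t3 N) (t1 N)) (formC j (t4 N) (t2 N)).
rewrite (formC j (t2 N) (t1 N)) (formC j (t2 N) (t3 N)).
rewrite (formC j (t4 N) (t1 N)) (formC j (t4 N) (t3 N)).
rewrite (form_parity (@parity_t1 N) (@parity_t2 N)) ?(negPf jo)//.
rewrite (form_parity (@parity_t1 N) (@parity_t4 N)) ?(negPf jo)//.
rewrite (form_parity (@parity_t3 N) (@parity_t2 N)) ?(negPf jo)//.
rewrite (form_parity (@parity_t3 N) (@parity_t4 N)) ?(negPf jo)//.
by move: (2 * N%:R)^-1 => z; ring.
Qed.

Lemma pair_trial_odd j N : odd j -> pair j trial trial N =
  2 * (pair j t1 t2 N + pair j t1 t4 N + (pair j t3 t2 N + pair j t3 t4 N)).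
Proof.
move=> jo; rewrite /pair /trial !(formDl, formDr).
rewrite (formC j (t3 N) (t1 N)) (formC j (t4 N) (t2 N)).
rewrite (formC j (t2 N) (t1 N)) (formC j (t2 N) (t3 N)).
rewrite (formC j (t4 N) (t1 N)) (formC j (t4 N) (t3 N)).
rewrite (form_parity (@parity_t1 N) (@parity_t1 N)) ?jo//.
rewrite (form_parity (@parity_t1 N) (@parity_t3 N)) ?jo//.
rewrite (form_parity (@parity_t3 N) (@parity_t3 N)) ?jo//.
rewrite (form_parity (@parity_t2 N) (@parity_t2 N)) ?jo//.
rewrite (form_parity (@parity_t2 N) (@parity_t4 N)) ?jo//.
rewrite (form_parity (@parity_t4 N) (@parity_t4 N)) ?jo//.
by move: (2 * N%:R)^-1 => z; ring.
Qed.

Lemma form1E N (f g : fsf R (lattice N)) : form 1 f g = (2 * N%:R)^-1 * ip f (hop g).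
Proof. by rewrite /form /= /B ipZr. Qed.

Lemma form2E N (f g : fsf R (lattice N)) :
  form 2 f g = (2 * N%:R)^-1 ^+ 2 * ip (hop f) (hop g).
Proof. by rewrite /form /= ip_B /B ipZr ipZl mulrA -expr2. Qed.

Lemma form3E N (f g : fsf R (lattice N)) :
  form 3 f g = (2 * N%:R)^-1 ^+ 3 * ip (hop (hop f)) (hop g).
Proof.
rewrite /form /= ip_B ip_B /B ipZr hopZ scalerA ipZl mulrA; congr (_ * _).
Qed.

Lemma form4E N (f g : fsf R (lattice N)) :
  form 4 f g = (2 * N%:R)^-1 ^+ 4 * ip (hop (hop f)) (hop (hop g)).
Proof.
rewrite /form /= ip_B ip_B /B !hopZ !scalerA ipZl ipZr mulrA; congr (_ * _).
by rewrite -!expr2 -exprM.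
Qed.

Lemma bO_w22 : bO 2 (fun N => w22 R N * N%:R^-1 ^+ 3 - 20).
Proof.
apply: (@bO_bound _ _ _ (fun N => 52 * N%:R^-1)); last exact/bO_cstM/bO_inv.
move=> N N0; have NR : 0 < N%:R :> R by rewrite ltr0n.
have -> : w22 R N * N%:R^-1 ^+ 3 - 20 = (w22 R N - 20 * N%:R ^+ 3) * N%:R^-1 ^+ 3.
  by field; rewrite gt_eqF.
rewrite normrM [X in _ * X]ger0_norm ?exprn_ge0 ?invr_ge0//.
apply: (le_trans (ler_wpM2r _ (w22_bound R N))); first by rewrite exprn_ge0 ?invr_ge0.
by rewrite le_eqVlt; apply/orP; left; apply/eqP; field; rewrite gt_eqF.
Qed.

Lemma bO_w24 : bO 2 (fun N => w24 R N * N%:R^-1 ^+ 3).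
Proof.
apply: (@bO_bound _ _ _ (fun N => 44 * N%:R^-1)); last exact/bO_cstM/bO_inv.
move=> N N0; have NR : 0 < N%:R :> R by rewrite ltr0n.
rewrite normrM [X in _ * X]ger0_norm ?exprn_ge0 ?invr_ge0//.
apply: (le_trans (ler_wpM2r _ (w24_bound R N))); first by rewrite exprn_ge0 ?invr_ge0.
by rewrite le_eqVlt; apply/orP; left; apply/eqP; field; rewrite gt_eqF.
Qed.

Lemma bO_w44 : bO 2 (fun N => w44 R N * N%:R^-1 ^+ 3).
Proof.
apply: (@bO_bound _ _ _ (fun N => 288 * N%:R^-1)); last exact/bO_cstM/bO_inv.
move=> N N0; have NR : 0 < N%:R :> R by rewrite ltr0n.
have /andP[w0 w1] := w44_bound R N.
rewrite normrM !ger0_norm ?exprn_ge0 ?invr_ge0//.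
apply: (le_trans (ler_wpM2r _ w1)); first by rewrite exprn_ge0 ?invr_ge0.
by rewrite le_eqVlt; apply/orP; left; apply/eqP; field; rewrite gt_eqF.
Qed.

(** This and the next five lemmas expand the normalized form of B^j at the trial function up to
    N^(-2), with error N^(-3). Pairs that are already O(eps^6) by size are not computed; the others
    reduce to walk counts, and the function given to [bO_ext] is the exact remainder. *)
Lemma energy0 : bO 6 (fun N => pair 0 trial trial N -
  (1 + b ^+ 2 * N%:R^-1 + (- b ^+ 2 + 2 / 3 * c ^+ 2 + d ^+ 2) * N%:R^-1 ^+ 2)).
Proof.
apply: (@bO_ext _ _ _ (fun N => N%:R^-1 ^+ 3 * (2 / 3 * c ^+ 2 * (2 * N%:R^-1 - 3)))).
  move=> N N0; have NR : 0 < N%:R :> R by rewrite ltr0n.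
  rewrite pair_trial_even// /pair /form /= /t1 /t2 /t3 /t4 !(ipZl, ipZr) !ip_chi.
  rewrite ip_chi_neq// ip_chi_tips// ip_tips_tips Sum_chi1 Sum_chi2 Sum_chi3.
  by field; rewrite gt_eqF.
apply: (@bOM _ 6 0); first exact: (bO_invX R 3).
by apply/bO_cstM/bOB; [exact/bO_cstM/(bO_le _ (bO_inv R)) | exact: bO_cst].
Qed.

Lemma energy1 : bO 6 (fun N => pair 1 trial trial N -
  (2 * b * N%:R^-1 + (- (2 * b) + 2 * b * c + d) * N%:R^-1 ^+ 2)).
Proof.
apply: (@bO_ext _ _ _ (fun N => N%:R^-1 ^+ 3 * (2 * b * c * (2 * N%:R^-1 - 3)))).
  move=> N N0; have NR : 0 < N%:R :> R by rewrite ltr0n.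
  rewrite pair_trial_odd// /pair !form1E /t1 /t2 /t3 /t4 !hopZ !(ipZl, ipZr).
  rewrite (ip_hop (chi R N 3)) [ip (hop _) (chi R N 2)]ipC.
  rewrite ip_chi1_hop_chi2 ip_chi1_hop_tips ip_chi3_hop_tips ip_chi2_hop_chi3.
  by field; rewrite gt_eqF.
apply: (@bOM _ 6 0); first exact: (bO_invX R 3).
by apply/bO_cstM/bOB; [exact/bO_cstM/(bO_le _ (bO_inv R)) | exact: bO_cst].
Qed.

Lemma energy2 : bO 6 (fun N => pair 2 trial trial N -
  (3 / 2 * N%:R^-1 + (- (3 / 4) + 5 / 2 * b ^+ 2 + 2 * c) * N%:R^-1 ^+ 2)).
Proof.
apply: (@bO_ext _ _ _ (fun N => N%:R^-1 ^+ 3 * (2 * c * (2 * N%:R^-1 - 3))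
   + b ^+ 2 / 8 * (N%:R^-1 ^+ 2 * (w22 R N * N%:R^-1 ^+ 3 - 20))
   + b * d / 4 * (N%:R^-1 ^+ 2 * (w24 R N * N%:R^-1 ^+ 3))
   + (pair 2 t3 t3 N + pair 2 t4 t4 N))).
  move=> N N0; have NR : 0 < N%:R :> R by rewrite ltr0n.
  rewrite pair_trial_even// addrAC; congr (_ + _).
  rewrite /pair !form2E /t1 /t2 /t3 /t4 !hopZ !(ipZl, ipZr).
  rewrite ip_hop11 ip_hop13 -/(w22 R N) -/(w24 R N).
  by field; rewrite gt_eqF.
apply: bOD; [apply: bOD; [apply: bOD|]|].
- apply: (@bOM _ 6 0); first exact: (bO_invX R 3).
  by apply/bO_cstM/bOB; [exact/bO_cstM/(bO_le _ (bO_inv R)) | exact: bO_cst].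
- by apply: bO_cstM; apply: (@bOM _ 4 2); [exact: (bO_invX R 2) | exact: bO_w22].
- by apply: bO_cstM; apply: (@bOM _ 4 2); [exact: (bO_invX R 2) | exact: bO_w24].
- by apply: bOD; [exact: (bO_pair 2 vO_t3 vO_t3) | exact: (bO_pair 2 vO_t4 vO_t4)].
Qed.

Lemma energy3 : bO 6 (fun N => pair 3 trial trial N - 6 * b * N%:R^-1 ^+ 2).
Proof.
apply: (@bO_ext _ _ _ (fun N => 2 * (
     b / 16 * (N%:R^-1 ^+ 2 * (2 * (w22 R N * N%:R^-1 ^+ 3 - 20)
        + w24 R N * N%:R^-1 ^+ 3 - 8 * N%:R^-1))
   + d / 16 * (N%:R^-1 ^+ 2 * (4 * N%:R^-1 + 2 * (w24 R N * N%:R^-1 ^+ 3)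
        + w44 R N * N%:R^-1 ^+ 3))
   + (pair 3 t3 t2 N + pair 3 t3 t4 N)))).
  move=> N N0; have NR : 0 < N%:R :> R by rewrite ltr0n.
  rewrite pair_trial_odd//; set rest := pair 3 t3 t2 N + _.
  rewrite /pair !form3E /t1 /t2 /t4 !hopZ !(ipZl, ipZr).
  rewrite ip_hophop1_hop2 ip_hophop1_hop_tips.
  by field; rewrite gt_eqF.
apply: bO_cstM; apply: bOD; [apply: bOD|].
- apply: bO_cstM; apply: (@bOM _ 4 2); first exact: (bO_invX R 2).
  apply: bOB; last exact/bO_cstM/bO_inv.
  by apply: bOD; [exact/bO_cstM/bO_w22 | exact: bO_w24].
- apply: bO_cstM; apply: (@bOM _ 4 2); first exact: (bO_invX R 2).
  apply: bOD; last exact: bO_w44.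
  by apply: bOD; [exact/bO_cstM/bO_inv | exact/bO_cstM/bO_w24].
- apply: bOD; first exact: (bO_pair 3 vO_t3 vO_t2).
  exact: bO_le (bO_pair 3 vO_t3 vO_t4).
Qed.

Lemma energy4 : bO 6 (fun N => pair 4 trial trial N - 15 / 4 * N%:R^-1 ^+ 2).
Proof.
apply: (@bO_ext _ _ _ (fun N => 32^-1 * (N%:R^-1 ^+ 2 * (4 * (w22 R N * N%:R^-1 ^+ 3 - 20)
        + 4 * (w24 R N * N%:R^-1 ^+ 3) + w44 R N * N%:R^-1 ^+ 3 - 24 * N%:R^-1))
   + (pair 4 t2 t2 N + 2 * pair 4 t1 t3 N + 2 * pair 4 t2 t4 N
      + (pair 4 t3 t3 N + pair 4 t4 t4 N)))).
  move=> N N0; have NR : 0 < N%:R :> R by rewrite ltr0n.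
  rewrite pair_trial_even//; set p := pair 4 t1 t1 N.
  have -> : p = (2 * N%:R)^-1 ^+ 4 * (8 * N%:R ^+ 3 + 32 * N%:R ^+ 2 * (N%:R - 1)
      + 8 * N%:R ^+ 2 + 4 * w22 R N + 4 * w24 R N + w44 R N) / (2 * N%:R).
    by rewrite /p /pair form4E ip_hophop1.
  by field; rewrite gt_eqF.
apply: bOD.
  apply: bO_cstM; apply: (@bOM _ 4 2); first exact: (bO_invX R 2).
  apply: bOB; last exact/bO_cstM/bO_inv.
  apply: bOD; last exact: bO_w44.
  by apply: bOD; [exact/bO_cstM/bO_w22 | exact/bO_cstM/bO_w24].
apply: bOD; last first.
  by apply: bOD; [exact: bO_le (bO_pair 4 vO_t3 vO_t3) | exact: bO_le (bO_pair 4 vO_t4 vO_t4)].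
apply: bOD; last by apply: bO_cstM; exact: bO_le (bO_pair 4 vO_t2 vO_t4).
apply: bOD; first exact: (bO_pair 4 vO_t2 vO_t2).
by apply: bO_cstM; exact: (bO_pair 4 vO_t1 vO_t3).
Qed.

Lemma energy5 : bO 6 (pair 5 trial trial).
Proof.
apply: (@bO_ext _ _ _ (fun N => 2 * (pair 5 t1 t2 N + pair 5 t1 t4 N
   + (pair 5 t3 t2 N + pair 5 t3 t4 N)))).
  by move=> N N0; rewrite pair_trial_odd.
apply: bO_cstM; apply: bOD; apply: bOD.
- exact: (bO_pair 5 vO_t1 vO_t2).
- exact: bO_le (bO_pair 5 vO_t1 vO_t4).
- exact: bO_le (bO_pair 5 vO_t3 vO_t2).
- exact: bO_le (bO_pair 5 vO_t3 vO_t4).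
Qed.

Lemma weight_trial l : bO 6 (fun N => wip l (trial N) (trial N) / (2 * N%:R) -
  (1 + b ^+ 2 / 2 ^+ l * N%:R^-1
   + (- (b ^+ 2 / 2 ^+ l) + 2 / 3 * c ^+ 2 / 3 ^+ l + d ^+ 2 / 4 ^+ l) * N%:R^-1 ^+ 2)).
Proof.
apply: (@bO_ext _ _ _ (fun N => N%:R^-1 ^+ 3 * (2 / 3 * c ^+ 2 / 3 ^+ l * (2 * N%:R^-1 - 3)))).
  move=> N N0; have NR : 0 < N%:R :> R by rewrite ltr0n.
  have wc k (f : fsf R (lattice N)) : (forall n, f n != 0 -> sq n = k) ->
      fmul (wt R l) f = k%:R^-1 ^+ l *: f.
    move=> fk; apply: fsfP => n; rewrite fmulE fsfZE /wt.
    by have [->|/fk ->] := eqVneq (f n) 0; rewrite ?mulr0.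
  have wchi k : fmul (wt R l) (chi R N k) = k%:R^-1 ^+ l *: chi R N k.
    by apply: wc => n; rewrite chiE; have [//|] := eqVneq (sq n) k; rewrite eqxx.
  have wtips : fmul (wt R l) (tips R N) = 4^-1 ^+ l *: tips R N.
    by apply: wc => n; rewrite maskE; case: ifP => [/eqP//|]; rewrite eqxx.
  rewrite /trial /t1 /t2 /t3 /t4 !(wipDl, wipDr) !(wipZl, wipZr) /wip !wchi !wtips !ipZl.
  rewrite !ip_chi !(ipC (tips R N) (chi _ _ _)) !ip_chi_neq// !ip_chi_tips//.
  rewrite ip_tips_tips Sum_chi1 Sum_chi2 Sum_chi3 invr1 expr1n !exprVn.
  have p k : (0 < k)%N -> k%:R ^+ l != 0 :> R.
    by move=> k0; rewrite expf_neq0// pnatr_eq0 -lt0n.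
  by field; rewrite (p 2)// (p 3)// (p 4)//= gt_eqF.
apply: (@bOM _ 6 0); first exact: (bO_invX R 3).
by apply/bO_cstM/bOB; [exact/bO_cstM/(bO_le _ (bO_inv R)) | exact: bO_cst].
Qed.

End Trial.

(** * Lattice isometries and the invariance of the trial function *)

Section Isometry.
Variables (R : realType) (N : nat).
Implicit Types (n m u : lattice N) (f g : fsf R (lattice N)).

Definition dot n m : int := \sum_(i < N) n 0 i * m 0 i.

Lemma dotC n m : dot n m = dot m n.
Proof. by apply: eq_bigr => i _; rewrite mulrC. Qed.

Lemma dotDl n m u : dot (n + m) u = dot n u + dot m u.
Proof. by rewrite /dot -big_split; apply: eq_bigr => i _; rewrite mxE mulrDl. Qed.

Lemma dotZl a n m : dot (a *: n) m = a * dot n m.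
Proof. by rewrite /dot mulr_sumr; apply: eq_bigr => i _; rewrite mxE mulrA. Qed.

Lemma dotDr n m u : dot u (n + m) = dot u n + dot u m.
Proof. by rewrite dotC dotDl !(dotC u). Qed.

Lemma dotZr a n m : dot n (a *: m) = a * dot n m.
Proof. by rewrite dotC dotZl dotC. Qed.

Lemma sq_dot n : (sq n)%:Z = dot n n.
Proof. by rewrite sqZ. Qed.

Lemma dot_unitv n p : dot n (unitv p) = sgn p * n 0 p.1.
Proof.
rewrite /dot (bigD1 p.1)//= big1 => [|i ip]; last first.
  by rewrite unitvE (negPf ip) !mulr0.
by rewrite unitvE eqxx mulr1 addr0 mulrC.
Qed.

(** The Euclidean reflection along u when c = 2 / |u|^2. This c is an integer for u = e_i (c = 2)
    and for u = e_i - e_j (c = 1), so these reflections preserve the lattice; they suffice to move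
    any unit vector to any other. *)
Definition reflection (c : int) u n : lattice N := n - (c * dot n u) *: u.

Lemma reflectionD c u n m : reflection c u (n + m) = reflection c u n + reflection c u m.
Proof. by rewrite /reflection dotDl mulrDr scalerDl opprD addrACA. Qed.

Lemma sq_reflection c u n : c * dot u u = 2 -> sq (reflection c u n) = sq n.
Proof.
move=> cu; apply/eqP; rewrite -eqz_nat !sq_dot /reflection -scaleNr.
rewrite !(dotDl, dotDr) !(dotZl, dotZr) (dotC u n); set z := dot n u.
have -> : dot n n + - (c * z) * z + (- (c * z) * z + - (c * z) * (- (c * z) * dot u u)) =
  dot n n - c * z * z * 2 + c * z * z * (c * dot u u) by ring.
by rewrite cu subrK.
Qed.

Lemma sphere_transitive (p q : 'I_N * bool) : exists s : lattice N -> lattice N,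
  [/\ forall n m, s (n + m) = s n + s m, forall n, sq (s n) = sq n
    & s (unitv p) = unitv q].
Proof.
have d1 r : dot (unitv r) (unitv r) = 1 by rewrite -sq_dot sq_unitv.
have [pq|pq] := eqVneq p.1 q.1.
  have [->|bq] := eqVneq q p; first by exists id.
  have qE : q = flip p.
    by move: p q pq bq => [i a] [j b] /= <-; rewrite /flip /= xpair_eqE eqxx; case: a; case: b.
  exists (reflection 2 (unitv p)); split.
  - exact: reflectionD.
  - by move=> n; apply: sq_reflection; rewrite d1.
  - by rewrite /reflection d1 mulr1 qE unitv_flip scaler_nat mulr2n opprD addNKr.
have d0 : dot (unitv p) (unitv q) = 0.
  by rewrite dot_unitv unitvE eq_sym (negPf pq) !mulr0.
exists (reflection 1 (unitv p - unitv q)); split.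
- exact: reflectionD.
- move=> n; apply: sq_reflection.
  by rewrite -scaleN1r !(dotDl, dotDr) !(dotZl (-1)) !(dotZr (-1)) !d1 (dotC (unitv q)) d0.
- rewrite /reflection -[in X in dot _ X]scaleN1r dotDr (dotZr (-1)) d1 d0 mulr0 addr0 mulr1 scale1r.
  by rewrite subKr.
Qed.

Variable s : lattice N -> lattice N.
Hypothesis sD : forall n m, s (n + m) = s n + s m.
Hypothesis ssq : forall n, sq (s n) = sq n.

Definition invariant_under f := forall n, f (s n) = f n.

Lemma invariant_hop f : invariant_under f -> invariant_under (hop f).
Proof.
move=> fs n; rewrite !hopE /nsum.
have s0 : s 0 = 0 by have /eqP := sD 0 0; rewrite addr0 -subr_eq subrr => /eqP.
have sN m : s (- m) = - s m.
  by apply/eqP; rewrite -subr_eq0 opprK -sD addNr s0.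
have sinj : injective s.
  move=> m k mk; apply/eqP; rewrite -subr_eq0 -sq_eq0 -ssq sD sN mk subrr.
  by rewrite sq0.
pose pi p := odflt p [pick q | unitv q == s (unitv p)].
have piE p : unitv (pi p) = s (unitv p).
  rewrite /pi; case: pickP => [q /eqP//|h].
  have [r hr] := sq_eq1 (etrans (ssq (unitv p)) (sq_unitv p)).
  by have := h r; rewrite hr eqxx.
have piinj : injective pi.
  by move=> p q pq; apply/(@unitv_inj N)/sinj; rewrite -!piE pq.
rewrite (reindex_inj piinj); apply: eq_bigr => p _.
by rewrite piE -sD fs.
Qed.

Lemma invariantD f g : invariant_under f -> invariant_under g -> invariant_under (f + g).
Proof. by move=> hf hg n; rewrite !fsfDE hf hg. Qed.

Lemma invariantZ a f : invariant_under f -> invariant_under (a *: f).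
Proof. by move=> hf n; rewrite !fsfZE hf. Qed.

Lemma invariantN f : invariant_under f -> invariant_under (- f).
Proof. by move=> hf n; rewrite !fsfNE hf. Qed.

Lemma invariant_chi k : invariant_under (chi R N k).
Proof. by move=> n; rewrite !chiE ssq. Qed.

Lemma invariant_mask P f : invariant_under f -> invariant_under (mask P f).
Proof. by move=> hf n; rewrite !maskE ssq hf. Qed.

Lemma invariant_iterG j f : invariant_under f -> invariant_under (iter j G f).
Proof.
move=> hf; elim: j => // j IH; rewrite iterS; apply: invariantD => //.
exact/invariantN/invariantZ/invariant_hop.
Qed.

Lemma invariant_trial b c d : invariant_under (trial b c d N).
Proof.
apply: invariantD; apply: invariantD; try exact/invariantZ/invariant_chi.
  exact: invariant_chi.
exact/invariantZ/invariant_mask/invariant_hop/invariant_chi.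
Qed.

End Isometry.

(** This constancy lets the cross term in [residual_bound] ignore the sphere, where the residual
    itself need not be small to the order N^(-3/2). *)
Lemma iterG_trial_sphere (R : realType) N l (b c d : R) (p q : 'I_N * bool) :
  iter l G (trial b c d N) (unitv p) = iter l G (trial b c d N) (unitv q).
Proof.
have [s [sD ssq <-]] := sphere_transitive p q.
exact/esym/(invariant_iterG sD ssq)/(invariant_trial _ ssq).
Qed.

Lemma vO_taylor (R : realType) l J k (F : forall N, fsf R (lattice N)) : vO k F ->
  vO (J + k) (fun N => iter l G (F N) - \sum_(j < J) binc R l j *: iter j B (F N)).
Proof.
move=> [K [C [C0 h]]]; have [D [D0 [K' [K0 tay]]]] := iterG_taylor R l J K.
exists K', (D * C); split=> [|N N0]; first by rewrite mulr_ge0.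
have [a1 a2] := h N N0; have [r [-> nr rn]] := tay N _ N0 a1.
rewrite addrC addKr; split=> //; apply: (le_trans rn).
rewrite exprD mulrACA -[leRHS]mulrA ler_wpM2l//.
by rewrite mulr_ge0// exprn_ge0// ltW// eps_gt0.
Qed.

(** * Coefficients of the perturbation series, energy and residual of the trial function *)

Section Expansion.
Variables (R : realType) (l : nat).
Hypothesis l1 : (1 <= l)%N.

Let L : R := l%:R.
Let C2 : R := binr R l 2.
Let C3 : R := binr R l 3.
Let C4 : R := binr R l 4.
Let x : R := 2 ^+ l.
Let y : R := 3 ^+ l.

(** The three coefficients solve the leading-order equations of (G^l - W) psi = 0 on levels 2, 3 and
    4: the coefficient times 1 - |n|^(-2 l) equals what the terms -l B and C(l,2) B^2 bring there
    from the lower levels. *)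
Definition coef2 : R := L * x / (x - 1).
Definition coef3 : R := 3 / 2 * (L * coef2 - C2) * y / (y - 1).
Definition coef4 : R := L / 2 * x ^+ 2 / (x ^+ 2 - 1).

Definition g2 : R :=
  - (3 / 4) * C2 + 15 / 4 * C4 + x * L * (L - 6 * C3) / (x - 1)
   + x * L ^+ 2 * C2 * (5 * x - 3) / (2 * (x - 1) ^+ 2)
   + x ^+ 2 * L ^+ 4 / (x - 1) ^+ 3
   - 3 * y / (2 * (y - 1)) * (C2 - x * L ^+ 2 / (x - 1)) ^+ 2
   - x ^+ 2 * L ^+ 2 / (4 * (x ^+ 2 - 1)).

(* The infimum is (2 * N) ^+ l * (mu N + O(N^-3)), with [g1] and [g2] the first
   two coefficients of the perturbation series of the bottom eigenvalue. *)
Definition mu N : R := 1 + g1 R l / N%:R + g2 / N%:R ^+ 2.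

Definition psi N := trial coef2 coef3 coef4 N.

Lemma x_ge2 : 2 <= x. Proof. exact: x2_ge2. Qed.

Lemma y_ge3 : 3 <= y.
Proof. by rewrite /y -(prednK l1) exprS ler_peMr// exprn_ege1// ler1n. Qed.

Lemma xm1 : x - 1 != 0. Proof. by rewrite gt_eqF//; have := x_ge2; lra. Qed.
Lemma ym1 : y - 1 != 0. Proof. by rewrite gt_eqF//; have := y_ge3; lra. Qed.
Lemma xxm1 : x ^+ 2 - 1 != 0. Proof. by rewrite gt_eqF//; have := x_ge2; nra. Qed.
Lemma x0 : x != 0. Proof. by rewrite gt_eqF//; have := x_ge2; lra. Qed.
Lemma y0 : y != 0. Proof. by rewrite gt_eqF//; have := y_ge3; lra. Qed.

Lemma four_expr : 4 ^+ l = x ^+ 2.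
Proof. by rewrite /x -exprM mulnC exprM expr2 -natrM. Qed.

(** The coefficients of N^0, N^(-1) and N^(-2) cancel by the choice of [g1] and [g2], a rational
    identity in 2^l, 3^l and the binomials; what is left is the errors of the [energy] lemmas, of
    the weight and of the Taylor cut, and the product terms of order N^(-3). *)
Lemma energy_psi : bO 6 (fun N =>
  (ip (psi N) (iter l G (psi N)) - mu N * wip l (psi N) (psi N)) / (2 * N%:R)).
Proof.
pose E j N := pair j psi psi N.
pose w N := wip l (psi N) (psi N) / (2 * N%:R).
(* Six Taylor terms leave a remainder O(eps^6) = O(N^(-3)). *)
pose r N := ip (psi N) (iter l G (psi N) -
  \sum_(j < 6) binc R l j *: iter j B (psi N)) / (2 * N%:R).
have hr : bO 6 r.
  apply: (bO_ip (vO_trial coef2 coef3 coef4)).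
  exact: (vO_taylor l 6 (vO_trial coef2 coef3 coef4)).
pose b := coef2; pose c := coef3; pose d := coef4.
pose m0 (N : nat) := 1 + b ^+ 2 * N%:R^-1 + (- b ^+ 2 + 2 / 3 * c ^+ 2 + d ^+ 2) * N%:R^-1 ^+ 2.
pose m1 (N : nat) := 2 * b * N%:R^-1 + (- (2 * b) + 2 * b * c + d) * N%:R^-1 ^+ 2.
pose m2 (N : nat) := 3 / 2 * N%:R^-1 + (- (3 / 4) + 5 / 2 * b ^+ 2 + 2 * c) * N%:R^-1 ^+ 2 : R.
pose m3 (N : nat) := 6 * b * N%:R^-1 ^+ 2.
pose m4 (N : nat) := 15 / 4 * N%:R^-1 ^+ 2 : R.
pose wb := - (b ^+ 2 / x) + 2 / 3 * c ^+ 2 / y + d ^+ 2 / 4 ^+ l.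
pose mw (N : nat) := 1 + b ^+ 2 / x * N%:R^-1 + wb * N%:R^-1 ^+ 2.
apply: (@bO_ext _ _ _ (fun N => (E 0%N N - m0 N) - L * (E 1%N N - m1 N)
   + C2 * (E 2 N - m2 N) - C3 * (E 3 N - m3 N) + C4 * (E 4 N - m4 N)
   + binc R l 5 * E 5 N + r N - mu N * (w N - mw N)
   + N%:R^-1 ^+ 3 * (- (g1 R l * wb + g2 * (b ^+ 2 / x)) - g2 * wb * N%:R^-1))).
  move=> N N0; have NR : N%:R != 0 :> R by rewrite pnatr_eq0 -lt0n.
  have -> : (ip (psi N) (iter l G (psi N)) - mu N * wip l (psi N) (psi N)) / (2 * N%:R) =
     E 0%N N - L * E 1%N N + C2 * E 2 N - C3 * E 3 N + C4 * E 4 N + binc R l 5 * E 5 N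
      + r N - mu N * w N.
    rewrite /r ipDr ipNr ip_sumr !big_ord_recr big_ord0 /= !(ipZr (binc _ _ _)).
    rewrite /E /pair /form /w binc0.
    have -> : binc R l 1 = - L by rewrite /binc bin1 expr1 mulN1r.
    have -> : binc R l 2 = C2 by rewrite /binc sqrrN expr1n mul1r.
    have -> : binc R l 3 = - C3 by rewrite /binc /C3 /binr; ring.
    have -> : binc R l 4 = C4 by rewrite /binc /C4 /binr; ring.
    by move: (2 * N%:R)^-1 => z /=; ring.
  rewrite /mu /m0 /m1 /m2 /m3 /m4 /mw /wb four_expr /g2 /g1 /x2 -/x -/L -/C2 -/C3 -/C4.
  rewrite /c /d /b /coef3 /coef4 /coef2.
  move: (E 0%N N) (E 1%N N) (E 2 N) (E 3 N) (E 4 N) (binc R l 5 * E 5 N) (r N) (w N).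
  move=> e0 e1 e2 e3 e4 e5 rr ww.
  have := xm1; have := ym1; have := xxm1; have := x0; have := y0; move: NR.
  move: (x) (y) (L) (C2) (C3) (C4) (N%:R : R) => X Y l' c2 c3 c4 n n0 Y0 X0 XX Y1 X1.
  by field; rewrite n0 Y0 X0 XX Y1 X1.
have hmu : bO 0 mu.
  have i0 : bO 0 (fun N => N%:R^-1 : R) := bO_le (leq0n 2) (bO_inv R).
  have i2 : bO 0 (fun N => N%:R^-1 ^+ 2 : R) := bO_le (leq0n _) (bO_invX R 2).
  apply: (@bO_ext _ _ _ (fun N => 1 + g1 R l * N%:R^-1 + g2 * N%:R^-1 ^+ 2)).
    by move=> N _; rewrite /mu exprVn.
  by apply: bOD; [apply: bOD; [exact: bO_cst | exact: bO_cstM] | exact: bO_cstM].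
have hw : bO 6 (fun N => w N - mw N) := weight_trial b c d l.
apply: bOD; [apply: bOB; [apply: bOD; [apply: bOD; [apply: bOD; [apply: bOB; [apply: bOD;
  [apply: bOB|]|]|]|]|]|]|].
- exact: energy0.
- exact/bO_cstM/energy1.
- exact/bO_cstM/energy2.
- exact/bO_cstM/energy3.
- exact/bO_cstM/energy4.
- exact/bO_cstM/energy5.
- exact: hr.
- exact: (bOM hmu hw).
- apply: (@bOM _ 6 0); first exact: (bO_invX R 3).
  by apply: bOB; [exact: bO_cst | apply/bO_cstM/(bO_le _ (bO_inv R))].
Qed.

Definition off_sphere : pred nat := fun k => (2 <= k)%N.

Lemma mask_chi_ge2 N k : (2 <= k)%N -> mask off_sphere (chi R N k) = chi R N k.
Proof.
move=> k2; apply: fsfP => n; rewrite maskE chiE /off_sphere.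
by case: ifP => // h; case: eqP => // e; rewrite e k2 in h.
Qed.

Lemma mask_chi_le1 N k : (k <= 1)%N -> mask off_sphere (chi R N k) = 0.
Proof.
move=> k2; apply: fsfP => n; rewrite maskE chiE /off_sphere fsf0E.
by case: ifP => // h; case: eqP => // e; rewrite e leqNgt ltnS k2 in h.
Qed.

Lemma mask_mask_ge2 N k f : (2 <= k)%N ->
  mask off_sphere (mask (pred1 k) f) = mask (pred1 k) f :> fsf R (lattice N).
Proof.
move=> k2; apply: fsfP => n; rewrite !maskE /= /off_sphere.
by case: eqP => [->|]; rewrite ?k2 ?if_same.
Qed.

Lemma vO_rest5 : vO 3 (fun N => N%:R^-1 ^+ 2 *: rest5 R N).
Proof.
exists 5%N, 2; split=> // N N0; split.
  apply: nearZ; move=> n; rewrite maskE; case: ifP => [/eqP -> //|]; by rewrite eqxx.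
have NR : 0 < N%:R :> R by rewrite ltr0n.
have e0 := eps_gt0 R N0; apply: nrm_le.
  by rewrite mulr_ge0 ?nu_ge0// mulr_ge0// exprn_ge0// ltW.
rewrite exprMn [(2 * _) ^+ 2]exprMn nu_sqr -exprM mulnC exprM eps_sqr ipZl ipZr mulrA -expr2.
apply: (le_trans (ler_wpM2l (sqr_ge0 _) (ip_rest5_le R N))).
rewrite -subr_ge0.
have -> : 2 ^+ 2 * N%:R^-1 ^+ 3 * (2 * N%:R) - (N%:R^-1 ^+ 2) ^+ 2 * (4 * N%:R ^+ 2) =
   4 * N%:R^-1 ^+ 2 :> R by field; rewrite gt_eqF.
by rewrite mulr_ge0 ?exprn_ge0 ?invr_ge0.
Qed.

Lemma vO_hop_tips : vO 3 (fun N => N%:R^-1 ^+ 2 *: hop (tips R N)).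
Proof.
apply: (@vO_ext _ _ _ (fun N => 2 *: iter 1 B (N%:R^-1 *: tips R N))) => [N N0|].
  have NR : N%:R != 0 :> R by rewrite pnatr_eq0 -lt0n.
  rewrite /= /B hopZ !scalerA; congr (_ *: _).
  by field.
exact: (vOZ (bO_cst 2) (vO_iterB 1 (vO_inv_tips R))).
Qed.

Lemma bO_mu1 : bO 2 (fun N => mu N - 1).
Proof.
apply: (@bO_ext _ _ _ (fun N => g1 R l * N%:R^-1 + g2 * N%:R^-1 ^+ 2)).
  by move=> N _; rewrite /mu exprVn; ring.
by apply: bOD; apply: bO_cstM; [exact: bO_inv | exact: bO_le (bO_invX R 2)].
Qed.

Definition residual N : fsf R (lattice N) :=
  mask off_sphere (iter l G (psi N)) - mu N *: fmul (wt R l) (mask off_sphere (psi N)).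

Lemma mask_psi N : mask off_sphere (psi N) =
  t3 coef3 N + (t2 coef2 N + t4 coef4 N).
Proof.
rewrite /psi /trial !maskD /t1 mask_chi_le1// add0r /t2 /t3 /t4 !maskZ.
by rewrite !mask_chi_ge2// mask_mask_ge2.
Qed.

Lemma fmul_wt_level N k (f : fsf R (lattice N)) : (forall n, f n != 0 -> sq n = k) ->
  fmul (wt R l) f = (k%:R ^+ l)^-1 *: f.
Proof.
move=> fk; apply: fsfP => n; rewrite fmulE fsfZE /wt -exprVn.
by have [->|/fk ->] := eqVneq (f n) 0; rewrite ?mulr0.
Qed.

Lemma fmul_wt_chi N k : fmul (wt R l) (chi R N k) = (k%:R ^+ l)^-1 *: chi R N k.
Proof.
by apply: fmul_wt_level => n; rewrite chiE; have [//|] := eqVneq (sq n) k; rewrite eqxx.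
Qed.

Lemma fmul_wt_tips N : fmul (wt R l) (tips R N) = (x ^+ 2)^-1 *: tips R N.
Proof.
rewrite -four_expr; apply: fmul_wt_level => n.
by rewrite maskE; case: ifP => [/eqP//|]; rewrite eqxx.
Qed.

Lemma fmulD N a (f g : fsf R (lattice N)) : fmul a (f + g) = fmul a f + fmul a g.
Proof. by apply: fsfP => n; rewrite !fsfE mulrDr. Qed.

Lemma fmulZ N a e (f : fsf R (lattice N)) : fmul a (e *: f) = e *: fmul a f.
Proof. by apply: fsfP => n; rewrite !fsfE mulrCA. Qed.

(* The coefficients of [psi] are chosen to cancel the residual on the levels
   2, 3 and 4 up to the error made by replacing [mu] with 1. *)
Lemma vO_residual : vO 3 residual.
Proof.
pose b := coef2; pose c := coef3; pose d := coef4.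
have bE : b * (1 - x^-1) = L by rewrite /b /coef2; field; rewrite xm1 x0.
have dE : d * (1 - (x ^+ 2)^-1) = L / 2 by rewrite /d /coef4; field; rewrite xxm1 x0.
have cE : c * (1 - y^-1) = 3 / 2 * (L * b - C2) by rewrite /c /coef3 -/b; field; rewrite ym1 y0.
(* The residual is r + q + k + z, each O(eps^3) for its own reason: r is the Taylor remainder; q has
   one B on the O(eps^2) summands and two on the O(eps) part s; k is mu - 1 = O(eps^2) times the
   O(eps) part off the sphere; z is what reaches level 5 or leaves the tips. *)
pose r N := mask off_sphere
  (iter l G (psi N) - \sum_(j < 3) binc R l j *: iter j B (psi N)).
pose s N := psi N - t1 R N.
have sE N : psi N = t1 R N + s N by rewrite /s addrC subrK.
have s1 : vO 1 s.
  apply: (@vO_ext _ _ _ (fun N => t3 c N + (t2 b N + t4 d N))).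
    by move=> N _; rewrite /s /psi /trial addrC addrA addKr.
  by apply: vOD; [exact: vO_le (vO_t3 c)|apply: vOD; [exact: vO_t2|exact: vO_le (vO_t4 d)]].
have hr : vO 3 r by apply: vO_mask; exact: (vO_taylor l 3 (vO_trial b c d)).
pose q N := - L *: mask off_sphere (iter 1 B (t3 c N + t4 d N))
  + C2 *: mask off_sphere (iter 2 B (s N)).
have hq : vO 3 q.
  apply: vOD.
    apply: (@vOZ _ 0 3); first exact: bO_cst.
    apply: vO_mask; apply: (@vO_iterB _ 1 2).
    by apply: vOD; [exact: vO_t3 | exact: vO_t4].
  apply: (@vOZ _ 0 3); first exact: bO_cst.
  by apply: vO_mask; exact: (vO_iterB 2 s1).
pose k N := (- (mu N - 1)) *: ((b / x) *: (N%:R^-1 *: chi R N 2)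
   + (d / x ^+ 2) *: (N%:R^-1 *: tips R N) + (c / y) *: (N%:R^-1 ^+ 2 *: chi R N 3)).
have hk : vO 3 k.
  apply: (@vOZ _ 2 1); first exact/bON/bO_mu1.
  apply: vOD; [apply: vOD|].
  - exact: (vOZ (bO_cst _) (vO_inv_chi2 R)).
  - exact: vO_le (vOZ (bO_cst _) (vO_inv_tips R)).
  - exact: vO_le (vOZ (bO_cst _) (vO_inv_chi3 R)).
pose z N := (C2 / 2 - L * b / 2) *: (N%:R^-1 ^+ 2 *: rest5 R N)
   + (C2 / 4) *: mask off_sphere (N%:R^-1 ^+ 2 *: hop (tips R N)).
have hz : vO 3 z.
  apply: vOD; first exact: (vOZ (bO_cst _) vO_rest5).
  exact: (vOZ (bO_cst _) (vO_mask _ vO_hop_tips)).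
apply: (@vO_ext _ _ _ (fun N => r N + q N + k N + z N)); last first.
  by do 3?[apply: vOD => //].
move=> N N0; have NR : N%:R != 0 :> R by rewrite pnatr_eq0 -lt0n.
have rE : mask off_sphere (iter l G (psi N)) = r N + mask off_sphere (psi N)
   - L *: mask off_sphere (B (psi N)) + C2 *: mask off_sphere (B (B (psi N))).
  rewrite /r (big_ord3 (fun j => binc R l j *: iter j B (psi N))) /= binc0 scale1r.
  have -> : binc R l 1 = - L by rewrite /binc bin1 expr1 mulN1r.
  have -> : binc R l 2 = C2 by rewrite /binc sqrrN expr1n mul1r.
  move: (iter l G (psi N)) (B (psi N)) (B (B (psi N))) (psi N) => u1 u2 u3 u4.
  by apply: fsfP => n; rewrite !(fsfDE, fsfNE, fsfZE, maskE); case: ifP => _; ring.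
have hop1 : mask off_sphere (hop (t1 R N)) = 2 *: chi R N 2 + tips R N.
  rewrite /t1 hop_chi1 !maskD !maskZ mask_chi_le1// mask_chi_ge2// mask_mask_ge2//.
  by rewrite scaler0 add0r.
have hop2 : mask off_sphere (hop (chi R N 2)) = 3 *: chi R N 3 + rest5 R N.
  rewrite hop_chi2 !maskD !maskZ mask_chi_le1// mask_chi_ge2// mask_mask_ge2//.
  by rewrite scaler0 add0r.
have hop11 : mask off_sphere (hop (hop (t1 R N))) =
    6 *: chi R N 3 + 2 *: rest5 R N + mask off_sphere (hop (tips R N)).
  rewrite /t1 hop_hop_chi1 !maskD !maskZ hop2 mask_chi_le1// scaler0 add0r.
  by rewrite scalerDr scalerA -natrM.
pose M1 := mask off_sphere (iter 1 B (t3 c N + t4 d N)).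
pose M2 := mask off_sphere (iter 2 B (s N)).
pose M3 := mask off_sphere (hop (tips R N)).
have qE : q N = - L *: M1 + C2 *: M2 by [].
have zE : z N = (C2 / 2 - L * b / 2) *: (N%:R^-1 ^+ 2 *: rest5 R N)
    + (C2 / 4) *: (N%:R^-1 ^+ 2 *: M3) by rewrite /z maskZ.
have B1 : mask off_sphere (B (psi N)) = (2 * N%:R)^-1 *: (2 *: chi R N 2 + tips R N)
   + (b * N%:R^-1 * (2 * N%:R)^-1) *: (3 *: chi R N 3 + rest5 R N)
   + M1.
  have -> : psi N = t1 R N + t2 b N + (t3 c N + t4 d N).
    rewrite /psi /trial -/b -/c -/d -!addrA; congr (_ + _).
    by rewrite addrCA.
  rewrite (BD (_ + _) (_ + _)) (BD (t1 R N)) (maskD _ (_ + _)) (maskD _ (B (t1 R N))) /=.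
  congr (_ + _ + _).
    by rewrite /B maskZ hop1.
  by rewrite /t2 BZ maskZ /B maskZ hop2 scalerA.
have B2 : mask off_sphere (B (B (psi N))) =
   (2 * N%:R)^-1 ^+ 2 *: (6 *: chi R N 3 + 2 *: rest5 R N + M3)
   + M2.
  rewrite sE (BD (t1 R N)) (BD (B (t1 R N))) maskD /=; congr (_ + _).
  by rewrite /B hopZ scalerA maskZ hop11 expr2.
rewrite /residual rE B1 B2 mask_psi qE zE; clearbody M1 M2 M3.
rewrite /t2 /t3 /t4 !fmulD !fmulZ fmul_wt_tips !fmul_wt_chi -/x -/y /k.
move: (r N) (tips R N) (rest5 R N) (chi R N 2) (chi R N 3) (mu N).
move=> v3 v4 v5 v6 v7 m.
apply: fsfP => n; rewrite !(fsfDE, fsfNE, fsfZE).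
move: (M1 n) (M2 n) (M3 n) (v3 n) (v4 n) (v5 n) (v6 n) (v7 n) => w1 w2 w3 w4 w5 w6 w7 w8.
have := xm1; have := ym1; have := xxm1; have := x0; have := y0; move: NR.
rewrite /b /c /d /coef3 /coef4 /coef2.
move: (x) (y) (L) (C2) (N%:R : R) => X Y l' c2 nn n0 Y0 X0 XX Y1 X1.
by field; rewrite n0 Y0 X0 XX Y1 X1.
Qed.

End Expansion.

(** * The infimum for real functions *)

Lemma mask_fmul (R : realType) N P a (f : fsf R (lattice N)) :
  mask P (fmul a f) = fmul a (mask P f).
Proof. by apply: fsfP => n; rewrite !fmulE mulrCA. Qed.

Section RealBounds.
Variables (R : realType) (l : nat).
Hypothesis l1 : (1 <= l)%N.
Local Notation psi := (psi R l).
Local Notation mu := (mu R l).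

Lemma trial_sphere N n : sq n = 1%N -> psi N n = 1.
Proof.
move=> n1; rewrite /psi /trial /t1 /t2 /t3 /t4.
by rewrite !(fsfDE, fsfZE, chiE) maskE /= n1 /= !mulr0 !addr0.
Qed.

Lemma trial_0 N : psi N 0 = 0.
Proof.
rewrite /psi /trial /t1 /t2 /t3 /t4.
by rewrite !(fsfDE, fsfZE, chiE) maskE /= sq0 /= !mulr0 !addr0.
Qed.

Lemma ip_chi1_psi N : ip (chi R N 1) (psi N) = 2 * N%:R.
Proof.
rewrite -Sum_chi1; apply: eq_Sum => n; rewrite fmulE chiE.
by case: eqP => [/trial_sphere ->|]; rewrite ?mulr1 ?mul0r.
Qed.

Lemma mean_sqr_le N (u : fsf R (lattice N)) : u 0 = 0 ->
  ip (chi R N 1) u ^+ 2 <= 2 * N%:R * wip l u u.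
Proof.
move=> u0; have := weighted_cs l (chi R N 1) u0.
have -> : fmul (sroot R l) (chi R N 1) = chi R N 1.
  apply: fsfP => n; rewrite fmulE chiE; case: eqP => [n1|]; last by rewrite mulr0.
  by rewrite /sroot n1 expr1n sqrtr1 mulr1.
move=> h; have := ler_pM (normr_ge0 _) (normr_ge0 _) h h.
rewrite -!expr2 real_normK ?num_real// exprMn wnrm_sqr nrm_sqr ip_chi Sum_chi1 ipC.
by rewrite [wip _ _ _ * _]mulrC.
Qed.

(** On the sphere f is the constant k and v sums to 0; at the origin v vanishes. *)
Lemma ip_sphere_const N (v f : fsf R (lattice N)) (k : R) : v 0 = 0 ->
  ip (chi R N 1) v = 0 -> (forall n, sq n = 1%N -> f n = k) ->
  ip v f = ip (mask off_sphere v) (mask off_sphere f).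
Proof.
move=> v0 mv fk; rewrite {1}(mask_split off_sphere v) ipDl [X in _ + X](_ : _ = 0).
  rewrite addr0 ip_mask ip_mask; congr (ip _ _); apply: fsfP => n.
  by rewrite !maskE; case: ifP.
rewrite -[RHS](mulr0 k) -mv -ipZl; apply: eq_Sum => n.
rewrite [RHS]fmulE [LHS]fmulE maskE fsfZE chiE /off_sphere /=.
case: (ltngtP (sq n) 1%N) => h.
- have : sq n == 0%N by rewrite -leqn0 -ltnS.
  rewrite sq_eq0 => /eqP n0; have -> : v n = 0 by rewrite n0.
  by rewrite !mulr0 /= mul0r.
- by rewrite /= mul0r mulr0 mul0r.
- by rewrite /= fk// [k * _]mulr1 mulrC.
Qed.

Lemma psi_weight_ge N : 2 * N%:R <= wip l (psi N) (psi N).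
Proof.
have [->|N0] := posnP N; first by rewrite mulr0 wip_ge0.
have := mean_sqr_le (trial_0 N); rewrite ip_chi1_psi expr2 ler_pM2l//.
by rewrite mulr_gt0// ltr0n.
Qed.

Lemma psi_energy : exists C : R, 0 <= C /\ forall N, (0 < N)%N ->
  `|ip (psi N) (iter l G (psi N)) - mu N * wip l (psi N) (psi N)|
    <= C / N%:R ^+ 3 * (2 * N%:R).
Proof.
have [C [C0 h]] := energy_psi R l1; exists C; split=> // N N0.
have N2 : 0 < 2 * N%:R :> R by rewrite mulr_gt0// ltr0n.
have := h N N0; rewrite normrM normfV (gtr0_norm N2) ler_pdivrMr//.
by rewrite -[6%N]/(2 * 3)%N exprM eps_sqr exprVn.
Qed.

Lemma residual_bound : exists C : R, 0 <= C /\ forall N (v : fsf R (lattice N)),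
  (0 < N)%N -> v 0 = 0 -> ip (chi R N 1) v = 0 ->
  `|ip v (iter l G (psi N)) - mu N * wip l v (psi N)| <=
    wnrm l (mask off_sphere v) * (C * eps R N ^+ 3 * nu R N).
Proof.
have [K [C [C0 h]]] := vO_residual R l1.
exists (K.+1%:R ^+ l * C); split=> [|N v N0 v0 mv]; first by rewrite mulr_ge0// exprn_ge0.
have [nr rn] := h N N0.
have -> : ip v (iter l G (psi N)) - mu N * wip l v (psi N) =
    ip (mask off_sphere v) (residual R l N).
  rewrite /residual ipDr ipNr ipZr; congr (_ - _ * _).
    apply: (@ip_sphere_const _ _ _ (iter l G (psi N) (unitv (Ordinal N0, false)))) => //.
    by move=> n /sq_eq1[p ->]; exact: iterG_trial_sphere.
  rewrite /wip ip_fmul [LHS](@ip_sphere_const _ _ _ 1)//.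
    by rewrite mask_fmul.
  by move=> n n1; rewrite fmulE trial_sphere// /wt n1 invr1 expr1n mul1r.
have w0 : mask off_sphere v 0 = 0 by rewrite maskE v0 if_same.
apply: le_trans (weighted_cs l _ w0) _; rewrite ler_wpM2l ?wnrm_ge0//.
apply: le_trans (nrm_sroot_near l (ltn0Sn K) (near_le (leqnSn K) nr)) _.
have -> : K.+1%:R ^+ l * C * eps R N ^+ 3 * nu R N = K.+1%:R ^+ l * (C * eps R N ^+ 3 * nu R N).
  by rewrite !mulrA.
by apply: ler_wpM2l => //; rewrite exprn_ge0.
Qed.

Lemma lower_bound : exists (a : R) (N0 : nat), (0 < N0)%N /\
  forall N (u : fsf R (lattice N)), (N0 <= N)%N -> u 0 = 0 ->
  (mu N - a / N%:R ^+ 3) * wip l u u <= ip u (iter l G u).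
Proof.
have [C1 [C10 he]] := psi_energy.
have [C2 [C20 hr]] := residual_bound.
have [c [c0 [N1 [N10 hc]]]] := coercive (g2 R l) l1.
exists (C1 + C2 ^+ 2 / c), N1; split=> // N u NN u0.
have N0 : (0 < N)%N by exact: leq_trans NN.
have NR : 0 < 2 * N%:R :> R by rewrite mulr_gt0// ltr0n.
have NR0 : N%:R != 0 :> R by rewrite pnatr_eq0 -lt0n.
(* As psi is 1 on the sphere, this is the mean of u there, and v gets mean zero. *)
pose al := ip (chi R N 1) u / (2 * N%:R).
pose v := u - al *: psi N.
have uE : u = al *: psi N + v by rewrite /v addrC subrK.
have v0 : v 0 = 0 by rewrite /v fsfBE fsfZE u0 trial_0 mulr0 subrr.
have mv : ip (chi R N 1) v = 0.
  by rewrite /v ipDr ipNr ipZr ip_chi1_psi /al mulfVK ?subrr// gt_eqF.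
have wu : al ^+ 2 * (2 * N%:R) <= wip l u u.
  rewrite -(ler_pM2l NR) (le_trans _ (mean_sqr_le u0))//.
  by rewrite /al le_eqVlt; apply/orP; left; apply/eqP; field.
have /= H1 := he N N0; have /= H2 := hr N v N0 v0 mv.
have H3 : mu N * wip l v v + c * wnrm l (mask off_sphere v) ^+ 2 <= ip v (iter l G v).
  by rewrite wnrm_sqr; exact: hc.
have qu : ip u (iter l G u) = al ^+ 2 * ip (psi N) (iter l G (psi N))
    + 2 * al * ip v (iter l G (psi N)) + ip v (iter l G v).
  rewrite [in LHS]uE iterGD iterGZ (ipDl _ v) (ipDr _ (al *: _)) (ipDr v).
  rewrite (ipZl _ (psi N)) (ipZr _ (psi N)) (ipZl _ (psi N)) (ipZr _ v).
  by rewrite (ip_iterG _ (psi N) v) [ip _ v]ipC; ring.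
have wE : wip l u u = al ^+ 2 * wip l (psi N) (psi N) + 2 * al * wip l v (psi N) + wip l v v.
  rewrite [in LHS]uE (wipDl _ _ v) (wipDr _ (al *: _)) (wipDr _ _ _ v).
  rewrite !(wipZl _ _ (psi N)) !(wipZr _ _ (psi N)).
  by rewrite (wipC l (psi N) v); ring.
move: H1 H2 H3 wu.
set t := wnrm l (mask off_sphere v); have t0 : 0 <= t := wnrm_ge0 _ _.
rewrite qu; set D := wip l u u.
have DE := wE; rewrite -/D in DE; clearbody D.
set q1 := ip (psi N) _; set q2 := ip v (iter l G (psi N)); set q3 := ip v (iter l G v).
set w1 := wip l (psi N) _ in DE *; set w2 := wip l v (psi N) in DE *.
set w3 := wip l v v in DE *.
have es : (eps R N ^+ 3 * nu R N) ^+ 2 = 2 * N%:R / N%:R ^+ 3.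
  by rewrite exprMn nu_sqr -exprM mulnC exprM eps_sqr exprVn mulrC.
have s0 : 0 <= eps R N ^+ 3 * nu R N.
  by rewrite mulr_ge0 ?nu_ge0// exprn_ge0// ltW// eps_gt0.
move: es s0; rewrite -(mulrA C2); set s := eps R N ^+ 3 * nu R N => es s0.
have i0 : 0 <= (N%:R ^+ 3)^-1 :> R by rewrite invr_ge0 exprn_ge0.
move: (mu N) es i0; set i := (N%:R ^+ 3)^-1; set n2 := 2 * N%:R.
move=> m es i0 H1 H2 H3 wu; move: H1; rewrite ler_norml => /andP[H1 _].
(* Completed square: the cross term is paid by c t^2 at the price of al^2 s^2 C2^2 / c. As s^2 = 2 N
   / N^3 and al^2 2 N is at most the weighted norm of u, this is a relative error O(N^(-3)). *)
have A : 0 <= c * t ^+ 2 - 2 * `|al| * (t * (C2 * s)) + C2 ^+ 2 / c * (al ^+ 2 * s ^+ 2).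
  have : 0 <= c^-1 * (c * t - `|al| * (C2 * s)) ^+ 2.
    by rewrite mulr_ge0 ?sqr_ge0// invr_ge0 ltW.
  have -> : c^-1 * (c * t - `|al| * (C2 * s)) ^+ 2 =
    c * t ^+ 2 - 2 * `|al| * (t * (C2 * s)) + C2 ^+ 2 / c * (`|al| ^+ 2 * s ^+ 2).
    by field; rewrite gt_eqF.
  by rewrite real_normK ?num_real.
have Bq : - (`|al| * (t * (C2 * s))) <= al * (q2 - m * w2).
  have : `|al * (q2 - m * w2)| <= `|al| * (t * (C2 * s)) by rewrite normrM ler_wpM2l.
  by rewrite ler_norml => /andP[].
have al0 := sqr_ge0 al.
have Cq : - (C1 * i * (al ^+ 2 * n2)) <= al ^+ 2 * (q1 - m * w1).
  have := ler_wpM2l al0 H1; rewrite mulrN; congr (- _ <= _); ring.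
have E : (C1 + C2 ^+ 2 / c) * i * (al ^+ 2 * n2) <= (C1 + C2 ^+ 2 / c) * i * D.
  rewrite ler_wpM2l// mulr_ge0// addr_ge0// divr_ge0 ?sqr_ge0// ltW//.
move: A; rewrite es -/n2 => A.
have A' : C2 ^+ 2 / c * (al ^+ 2 * (n2 * i)) = C2 ^+ 2 / c * i * (al ^+ 2 * n2) by ring.
rewrite A' in A; rewrite mulrBl {1}DE.
move: A Bq Cq E H3; rewrite !mulrDl.
move: (C2 ^+ 2 / c) => k A Bq Cq E H3.
have F : 0 <= 2 * (al * (q2 - m * w2) + `|al| * (t * (C2 * s))) by rewrite mulr_ge0//; lra.
move: A Cq E H3 F; clear; lra.
Qed.

End RealBounds.

(** * Complex functions *)

Section ComplexParts.
Variable R : realType.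

Lemma Re_sum (I : Type) (r : seq I) (F : I -> R[i]) :
  complex.Re (\sum_(i <- r) F i) = \sum_(i <- r) complex.Re (F i).
Proof. by apply: (big_morph _ _ _) => // -[a b] [c d]. Qed.

Lemma Im_sum (I : Type) (r : seq I) (F : I -> R[i]) :
  complex.Im (\sum_(i <- r) F i) = \sum_(i <- r) complex.Im (F i).
Proof. by apply: (big_morph _ _ _) => // -[a b] [c d]. Qed.

Lemma complex_natr k : k%:R = k%:R +i* 0 :> R[i].
Proof.
elim: k => [//|k IH]; rewrite -addn1 !natrD IH.
by apply/eqP; rewrite eq_complex /= addr0 !eqxx.
Qed.

Variable N : nat.
Implicit Types (u : lattice N -> R[i]) (f g : fsf R (lattice N)).

Lemma enormE (n : lattice N) : enorm R n = Num.sqrt (sq n)%:R.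
Proof.
rewrite /enorm; congr Num.sqrt; rewrite pmulrn sqZ rmorph_sum /=.
by apply: eq_bigr => i _; rewrite rmorphXn.
Qed.

Lemma enorm_eq1 (n : lattice N) : enorm R n = 1 <-> sq n = 1%N.
Proof.
rewrite enormE; split=> [h|->]; last by rewrite sqrtr1.
have := congr1 (fun x => x ^+ 2) h; rewrite sqr_sqrtr// expr1n => /eqP.
by rewrite -[1]/(1%:R) eqr_nat => /eqP.
Qed.

Definition cjoin f g : lattice N -> R[i] := fun n => f n +i* g n.

Lemma laplacianE u n : laplacian u n = (2 * N)%:R * u n - \sum_p u (n + unitv p).
Proof.
congr (_ - _).
have -> : [set m : lattice N | enorm R (m - n) = 1] =
    (fun p => n + unitv p) @` [set: 'I_N * bool].
  apply/seteqP; split=> m /=.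
    by move=> /enorm_eq1/sq_eq1[p hp]; exists p => //; rewrite -hp addrC subrK.
  by move=> [p _ <-]; apply/enorm_eq1; rewrite addrC addKr sq_unitv.
rewrite fsbig_image; last by move=> p q _ _ /addrI/unitv_inj.
rewrite (fsbigE (index_enum _)) ?index_enum_uniq//=.
  by apply: eq_bigl => p; rewrite in_setT.
by move=> p _; rewrite mem_index_enum.
Qed.

Lemma laplacian_cjoin f g : (0 < N)%N ->
  laplacian (cjoin f g) = cjoin ((2 * N%:R) *: G f) ((2 * N%:R) *: G g).
Proof.
move=> N0; apply: funext => n; rewrite laplacianE complex_natr.
have NR : N%:R != 0 :> R by rewrite pnatr_eq0 -lt0n.
have ReB (a b : R[i]) : complex.Re (a - b) = complex.Re a - complex.Re b.
  by case: a; case: b.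
have ImB (a b : R[i]) : complex.Im (a - b) = complex.Im a - complex.Im b.
  by case: a; case: b.
have GE (k : fsf R (lattice N)) :
    (2 * N%:R) * G k n = 2 * N%:R * k n - \sum_p k (n + unitv p).
  rewrite /G fsfDE fsfNE /B fsfZE hopE /nsum mulrBr mulrA mulfV ?mul1r//.
  by rewrite mulf_neq0 ?pnatr_eq0 // -lt0n.
apply/eqP; rewrite eq_complex ReB ImB Re_sum Im_sum /= !GE.
by rewrite natrM !mul0r subr0 addr0 !eqxx.
Qed.

Lemma iter_laplacian_cjoin l f g : (0 < N)%N ->
  iter l (@laplacian R N) (cjoin f g) =
  cjoin ((2 * N%:R) ^+ l *: iter l G f) ((2 * N%:R) ^+ l *: iter l G g).
Proof.
move=> N0; elim: l => [|l IH]; first by rewrite !scale1r.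
by rewrite iterS IH laplacian_cjoin// !GZ !scalerA -!exprS.
Qed.

Lemma Re_inner f g f' g' :
  complex.Re (inner (cjoin f g) (cjoin f' g')) = ip f f' + ip g g'.
Proof.
pose A := (supp f `|` supp g)%fset.
have fA n : n \notin A -> f n = 0.
  by rewrite !inE negb_or => /andP[/notin_supp].
have gA n : n \notin A -> g n = 0.
  by rewrite !inE negb_or => /andP[_ /notin_supp].
rewrite /inner (fsbigTE A) => [|n nA]; last first.
  by rewrite /cjoin fA// gA//; apply/eqP; rewrite eq_complex /= oppr0 !mul0r subr0 addr0 eqxx.
rewrite Re_sum /ip !(@SumE _ _ A) => [|n /gA h|n /fA h]; last 2 first.
- by rewrite fmulE h mul0r.
- by rewrite fmulE h mul0r.
by rewrite -big_split; apply: eq_bigr => n _ /=; rewrite mulNr opprK.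
Qed.

Lemma hardy_weighted_norm_cjoin l f g : (1 <= l)%N ->
  hardy_weighted_norm l (cjoin f g) = wip l f f + wip l g g.
Proof.
move=> l1; rewrite /hardy_weighted_norm fsbig_mkcond.
rewrite /wip /ip -SumD; apply: eq_Sum => n.
rewrite fsfDE !fmulE /patch; case: ifPn => h.
  rewrite /cjoin /= sqr_sqrtr ?addr_ge0 ?sqr_ge0// enormE exprM sqr_sqrtr//.
  by rewrite /wt exprVn; ring.
(* The sum defining the Hardy norm omits the origin; on the right the convention 0^(-1) = 0 with l
   >= 1 makes the weight vanish there. *)
have -> : n = 0 by apply/eqP; apply: contraNT h => n0; rewrite inE.
by rewrite /wt sq0 invr0 expr0n (_ : (l == 0)%N = false) ?mul0r ?addr0// eqn0Ngt l1.
Qed.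

Lemma cjoin_parts u : finitely_supported u -> exists f g, u = cjoin f g.
Proof.
move=> fu.
have ffin : finite_set [set n | complex.Re (u n) != 0].
  by apply: sub_finite_set fu => n /=; apply: contra_neq => ->.
have gfin : finite_set [set n | complex.Im (u n) != 0].
  by apply: sub_finite_set fu => n /=; apply: contra_neq => ->.
by exists (FSF ffin), (FSF gfin); apply: funext => n; rewrite /cjoin /=; case: (u n).
Qed.

Lemma cjoin_fin f g : finitely_supported (cjoin f g).
Proof.
have := conj (fsf_fin f) (fsf_fin g); rewrite -finite_setU; apply: sub_finite_set => n /=.
have [f0|] := eqVneq (f n) 0; last by left.
have [g0|] := eqVneq (g n) 0; last by right.
by rewrite /cjoin f0 g0 eqxx.
Qed.

(** The Laplacian has real coefficients, so real and imaginary parts decouple. A lower bound for the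
    real quadratic form then adds up over the two parts, and a real trial function suffices for the
    upper bound. *)
Lemma rayleigh_cjoin l f g : (0 < N)%N -> (1 <= l)%N ->
  rayleigh l (cjoin f g) = (2 * N%:R) ^+ l *
    ((ip f (iter l G f) + ip g (iter l G g)) / (wip l f f + wip l g g)).
Proof.
move=> N0 l1; rewrite /rayleigh iter_laplacian_cjoin// Re_inner !ipZr.
by rewrite hardy_weighted_norm_cjoin// -mulrDr mulrA.
Qed.

Lemma wip_eq0 l f : f 0 = 0 -> wip l f f = 0 -> f = 0.
Proof.
move=> f0; rewrite -wnrm_sqr => /eqP; rewrite sqrf_eq0 => /eqP w0.
have := nrm_sqr (fmul (fun n => (sroot R l n)^-1) f); rewrite -/(wnrm l f) w0 expr0n /=.
move=> /esym/ip_eq0 h; apply: fsfP => n; rewrite fsf0E.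
have [->|n0] := eqVneq n 0; first by [].
have := congr1 (fun k : fsf R (lattice N) => k n) h; rewrite fmulE fsf0E => /eqP.
rewrite mulf_eq0 invr_eq0 gt_eqF ?orFb => [/eqP//|].
by apply: sroot_gt0; rewrite lt0n sq_eq0.
Qed.

End ComplexParts.

Section Hardy.
Variables (R : realType) (l : nat).
Hypothesis l1 : (1 <= l)%N.

Lemma hardy_constant_bounds : exists (a : R) (N0 : nat), (0 < N0)%N /\
  forall N, (N0 <= N)%N ->
    (2 * N%:R) ^+ l * (mu R l N - a / N%:R ^+ 3) <= hardy_constant R l N
      <= (2 * N%:R) ^+ l * (mu R l N + a / N%:R ^+ 3).
Proof.
have [C [C0 hE]] := psi_energy R l1.
have [a [N0 [N00 hL]]] := lower_bound R l1.
exists (Num.max a C), N0; split=> // N NN.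
have Np : (0 < N)%N by exact: leq_trans NN.
have NR : 0 < N%:R :> R by rewrite ltr0n.
have i0 : 0 <= (N%:R ^+ 3)^-1 :> R by rewrite invr_ge0 exprn_ge0.
have p0 : 0 <= (2 * N%:R) ^+ l :> R by rewrite exprn_ge0// mulr_ge0.
rewrite /hardy_constant; set S := [set rayleigh l u | u in _].
have Slb : forall z, S z -> (2 * N%:R) ^+ l * (mu R l N - Num.max a C / N%:R ^+ 3) <= z.
  move=> z [u [fu u0 un0] <-]; have [f [g uE]] := cjoin_parts fu.
  have f0 : f 0 = 0 by have := congr1 (@complex.Re R) u0; rewrite uE.
  have g0 : g 0 = 0 by have := congr1 (@complex.Im R) u0; rewrite uE.
  rewrite uE rayleigh_cjoin// ler_wpM2l//.
  have w0 : 0 < wip l f f + wip l g g.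
    rewrite lt_neqAle addr_ge0 ?wip_ge0// andbT eq_sym paddr_eq0 ?wip_ge0//.
    apply/negP => /andP[/eqP wf /eqP wg]; apply: un0.
    rewrite uE (wip_eq0 f0 wf) (wip_eq0 g0 wg); apply: funext => n; rewrite /cjoin.
    by apply/eqP; rewrite eq_complex /= !eqxx.
  rewrite ler_pdivlMr//; apply: (@le_trans _ _ ((mu R l N - a / N%:R ^+ 3) *
    (wip l f f + wip l g g))).
    rewrite ler_wpM2r ?(ltW w0)// lerD2l lerN2 ler_wpM2r//.
    by rewrite le_max lexx.
  by rewrite mulrDr lerD// hL.
have Spsi : S (rayleigh l (cjoin (psi R l N) 0)).
  exists (cjoin (psi R l N) 0) => //; split; first exact: cjoin_fin.
    by rewrite /cjoin trial_0.
  move=> h; have /eqP : psi R l N (unitv (Ordinal Np, false)) = 0.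
    exact: (congr1 (fun u => complex.Re (u (unitv (Ordinal Np, false)))) h).
  by rewrite trial_sphere ?sq_unitv// oner_eq0.
apply/andP; split.
  by apply: lb_le_inf; [exists (rayleigh l (cjoin (psi R l N) 0)) | exact: Slb].
apply: (@le_trans _ _ (rayleigh l (cjoin (psi R l N) 0))).
  apply: ge_inf => //.
  by exists ((2 * N%:R) ^+ l * (mu R l N - Num.max a C / N%:R ^+ 3)).
rewrite rayleigh_cjoin// ip0l [wip l 0 0](_ : _ = 0) ?addr0; last first.
  by rewrite /wip ip0r.
rewrite ler_wpM2l//.
(* The error in [psi_energy] is measured against 2 N, which the weighted norm of psi dominates, so
   it stays O(N^(-3)) in the quotient. *)
have wge := psi_weight_ge R l N.
have w0 : 0 < wip l (psi R l N) (psi R l N).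
  by apply: lt_le_trans wge; rewrite mulr_gt0.
rewrite ler_pdivrMr// mulrDl -lerBlDl.
have := hE N Np; rewrite ler_norml => /andP[_ h]; apply: (le_trans h).
apply: ler_pM => //; rewrite ?mulr_ge0 ?divr_ge0 ?exprn_ge0//.
by rewrite ler_wpM2r// le_max lexx orbT.
Qed.

Lemma expz_subn (k : nat) (z : R) : z != 0 -> z ^ (l%:Z - k%:Z) = z ^+ l / z ^+ k.
Proof. by move=> z0; rewrite expfzDr// -exprnP -exprnN. Qed.

Lemma gamma_coefE : gamma_coef R l = 2 ^+ l * g1 R l.
Proof.
rewrite /gamma_coef /g1 binr2 /x2.
have -> : 2 ^ (l%:Z - 2) = 2 ^+ l / 4 :> R.
  have -> : 4 = 2 ^+ 2 :> R by ring.
  by apply: (@expz_subn 2); rewrite pnatr_eq0.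
rewrite mulnC exprM; have := xm1 R l1; move: (2 ^+ l) => x x1.
by field.
Qed.

Lemma delta_coefE : delta_coef R l = 2 ^+ l * g2 R l.
Proof.
rewrite /delta_coef /g2 /binr [(2 * l)%N]mulnC exprM (exprS 3).
have := xm1 R l1; have := ym1 R l1; have := xxm1 R l1.
move: (2 ^+ l) (3 ^+ l) => x y xx1 y1 x1.
by field; rewrite xx1 y1 x1.
Qed.

End Hardy.

Theorem theorem1p1 (R : realType) (l : nat) (hl : (1 <= l)%N) :
  exists (N0 : nat) (A : R), forall N : nat, (1 <= N)%N -> (N0 <= N)%N ->
    `| hardy_constant R l N
       - 2 ^+ l * N%:R ^+ l
       - gamma_coef R l * N%:R ^ (l%:Z - 1)
       - delta_coef R l * N%:R ^ (l%:Z - 2) |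
    <= A * N%:R ^ (l%:Z - 3).
Proof.
have [a [N0 [_ h]]] := hardy_constant_bounds R hl.
exists N0, (2 ^+ l * a) => N N1 NN.
have NR : N%:R != 0 :> R by rewrite pnatr_eq0 -lt0n.
have -> : N%:R ^ (l%:Z - 1) = N%:R ^+ l / N%:R :> R by exact: (@expz_subn _ _ 1).
have -> : N%:R ^ (l%:Z - 2) = N%:R ^+ l / N%:R ^+ 2 :> R by exact: expz_subn.
have -> : N%:R ^ (l%:Z - 3) = N%:R ^+ l / N%:R ^+ 3 :> R by exact: expz_subn.
have := h N NN; rewrite gamma_coefE// delta_coefE// /mu.
set H := hardy_constant R l N; rewrite exprMn => /andP[h1 h2].
rewrite ler_norml; apply/andP; split.
  rewrite -subr_ge0; move: h1; rewrite -subr_ge0; congr (_ <= _); field => //.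
rewrite -subr_ge0; move: h2; rewrite -subr_ge0; congr (_ <= _); field => //.
Qed.
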